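(* Let $1 \le k < n$ and let $B \subset \mathbb{G}(k-1,n)$ be an irreducible $1$-clustered family of $(k-1)$-dimensional projective linear subspaces of $\mathbb{P}^n$, of codimension $\epsilon>0$ in $\mathbb{G}(k-1,n)$. Then $\epsilon \le n-k+1$. Moreover, if $\epsilon \ge 2$, then there is an irreducible subvariety $Z \subset \mathbb{P}^n$ of dimension $n-k+1-\epsilon$ such that $B$ is exactly the set of $(k-1)$-dimensional linear subspaces of $\mathbb{P}^n$ that intersect $Z$.
   Context: $\mathbb{G}(k,n)$ denotes the Grassmannian of $k$-dimensional projective linear subspaces of $\mathbb{P}^n$. For an irreducible family $B \subset \mathbb{G}(k-1,n)$ of codimension $\epsilon>0$, its containing family is $C \subset \mathbb{G}(k,n)$, the set of all $k$-dimensional linear subspaces containing some member of $B$. Let $I_{B,C}=\{(b,c)\in B\times C : b\subset c\}$ with projection $\pi_2: I_{B,C}\to C$. The family $B$ is called $\ell$-clustered if the general fiber of $\pi_2$ has dimension $k-\ell$ (i.e. a general member of $C$ contains a $(k-\ell)$-dimensional family of members of $B$); equivalently, the codimension of $C$ in $\mathbb{G}(k,n)$ is $\epsilon-\ell$. *)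

(* Defs.v *)
(* Grassmannians over an algebraically closed field K.
   A point of G(k-1,n) (a projective (k-1)-plane in P^n) is a linear
   subspace of K^(n+1) = 'rV[K]_n.+1 of vector-space dimension k. *)
From HB Require Import structures.
From mathcomp Require Import all_boot all_order all_algebra.
From mathcomp Require Import mpoly.
Set Implicit Arguments. Unset Strict Implicit. Unset Printing Implicit Defensive.
Import Order.TTheory GRing.Theory.
Local Open Scope ring_scope.

Section Grass.
Variables (K : fieldType) (n : nat).

Notation vT := 'rV[K]_n.+1.
Notation gset := ({vspace vT} -> Prop).

Definition rowspan (k : nat) (M : 'M[K]_(k, n.+1)) : {vspace vT} :=
  <<[seq row i M | i <- enum 'I_k]>>%VS.

(* Zariski closed subsets of the Grassmannian of vector k-dimensional
   subspaces (= G(k-1,n)): subsets of the Grassmannian whose preimage in the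
   Stiefel variety of rank-k matrices k x (n+1) is cut out by polynomials in
   the matrix entries (the quotient topology, which is the Zariski topology). *)
Definition gclosed (k : nat) (S : gset) : Prop :=
  (forall U, S U -> \dim U = k) /\
  exists F : {mpoly K[k * n.+1]} -> Prop,
    forall M : 'M[K]_(k, n.+1), \rank M = k ->
      (S (rowspan M) <-> forall f, F f -> f.@[fun i => mxvec M 0 i] = 0).

Definition grass (k : nat) : gset := fun U => \dim U = k.

Definition rel_closed (k : nat) (S Y : gset) : Prop :=
  exists F, gclosed k F /\ forall U, Y U <-> (S U /\ F U).

Definition girred (k : nat) (Y : gset) : Prop :=
  (exists U, Y U) /\
  forall F1 F2, gclosed k F1 -> gclosed k F2 ->
    (forall U, Y U -> F1 U \/ F2 U) ->
    (forall U, Y U -> F1 U) \/ (forall U, Y U -> F2 U).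

Definition gchain (k : nat) (S : gset) (d : nat) : Prop :=
  exists c : nat -> gset,
    (forall i, (i <= d)%N -> rel_closed k S (c i) /\ girred k (c i)) /\
    (forall i, (i < d)%N ->
       (forall U, c i U -> c i.+1 U) /\ exists U, c i.+1 U /\ ~ c i U).

Definition gdim (k : nat) (S : gset) (d : nat) : Prop :=
  gchain k S d /\ ~ gchain k S d.+1.

Definition containing_family (k : nat) (B : gset) : gset :=
  fun c => \dim c = k.+1 /\ exists b, B b /\ (b <= c)%VS.

(* B (a subset of G(k-1,n)) is l-clustered: the general fiber of
   I_{B,C} -> C has dimension k - l, i.e. there is a nonempty (hence dense,
   C being irreducible) relatively open subset of C over which every fiber
   {b in B | b subset c} has dimension k - l. *)
Definition clustered (k l : nat) (B : gset) : Prop :=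
  let C := containing_family k B in
  exists F, gclosed k.+1 F /\ (exists c, C c /\ ~ F c) /\
    forall c, C c -> ~ F c ->
      gdim k (fun b => B b /\ (b <= c)%VS) (k - l).

End Grass.

(* Main.v *)
(* Write C for the containing family. Since B is 1-clustered, the members of B
   inside a general c in C form a hypersurface of the dual of c, so they meet
   every pencil a < b < c; as B is irreducible, this holds for all c in C, and it
   implies that C is closed. If every (k+1)-dimensional c lies in C, then B
   meets every pencil, is a hypersurface, and eps = 1.

   Otherwise let T have dimension k+2, with some y < T outside C. In the dual
   projective space of T the set X of the c in C is a union of lines, namely of
   the pencils [b, T] with b in B, and through each point of X there is such a
   line in every plane through that point. Hence a proper plane section of X is
   a finite union of lines, so every linear subspace of X extends to a
   hyperplane contained in X: each b in B with b < T contains a vertex p such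
   that all c < T through p lie in C. By a pencil argument all b < T through p
   lie in B, and moving T gives all b through p. Thus B consists of the
   subspaces meeting the closed set Z of vertices.

   Dimensions are lengths of chains. Long chains come from Zorn's lemma: a
   closed set that is minimal among those meeting a connected family of compact
   test sets is irreducible. Chains are bounded by counting: a chain of length s
   gives s algebraically independent functions on a chart, and their monomials
   outgrow the functions of bounded degree on a set that is integral over fewer
   than s coordinates. Closedness of projections reduces to the projective
   line, that is, to ideals of K[s]. *)

(* Dimensions are those of vector spaces, with k = h+1: in a pencil a < b < c they are h, h+1, h+2,
   and T has dimension h+3. Clustering enters through the property [star]: B meets every pencil
   [a, c] with c in C. For a general c this holds because [a, c] is a line in the dual projective
   space of c, of dimension h+1. A closed set missing that line is finite over its projection from
   the line, a space of dimension h-1, whereas the fibre carries a chain of length h. It spreads to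
   every c by two closed conditions on b that together cover B.

   With m+1 = n-k+1, the Grassmannian has dimension (h+1)(m+1) and the b through a fixed point have
   dimension h(m+1), so dim Z = dim B - h(m+1) = m+1-eps. This is proved with chains alone: chains
   of Z lift to chains of B, and conversely a maximal linear space missing Z, of dimension l, bounds
   the chains of B by (n-l) + h(m+1) and yields a chain of length n-l in Z. *)
Require Import Defs.
From HB Require Import structures.
From mathcomp Require Import all_boot all_order all_algebra.
From mathcomp Require Import mpoly zify ring.
From mathcomp Require classical_sets.
From Stdlib Require Import Classical.
Set Implicit Arguments. Unset Strict Implicit. Unset Printing Implicit Defensive.
Import GRing.Theory.
Local Open Scope ring_scope.

(** * Cofinite sets of scalars and polynomial functions *)

Section Cofinite.
Variable K : closedFieldType.

(** Plays the role of density: finitely many open conditions, each satisfied somewhere on a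
    parameter line, hold at a common parameter. *)
Definition cofin (P : K -> Prop) := exists s : seq K, forall t, t \notin s -> P t.

(** Euclid's argument: a root of X times the product of the X - a, plus 1, lies outside [s]. The
    factor ['X] keeps the polynomial nonconstant when [s] is empty. *)
Lemma fresh (s : seq K) : exists t, t \notin s.
Proof.
pose p := \prod_(a <- s) ('X - a%:P) * 'X + 1 : {poly K}.
have sq : size (\prod_(a <- s) ('X - a%:P) * 'X : {poly K}) = (size s).+2.
  by rewrite size_mulX ?monic_neq0 ?monic_prod_XsubC // size_prod_XsubC.
have sp : size p != 1.
  by rewrite /p size_polyDl ?sq // size_poly1.
have /closed_rootP [t rt] := sp.
exists t; apply/negP => ts; move: rt; rewrite /p /root hornerD hornerM hornerC horner_prod.
rewrite (big_rem t) //= hornerXsubC subrr !mul0r add0r; exact/negP/oner_neq0.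
Qed.

Lemma cofin_ex P : cofin P -> exists t, P t.
Proof. by case=> s Ps; case: (fresh s) => t /Ps; exists t. Qed.

Lemma cofin_and P Q : cofin P -> cofin Q -> cofin (fun t => P t /\ Q t).
Proof.
case=> s Ps [u Qu]; exists (s ++ u) => t; rewrite mem_cat negb_or => /andP[/Ps ? /Qu ?].
by split.
Qed.

Lemma cofin_sub (P Q : K -> Prop) : (forall t, P t -> Q t) -> cofin P -> cofin Q.
Proof. by move=> PQ [s Ps]; exists s => t /Ps /PQ. Qed.

Lemma cofin_neq a : cofin (fun t => t != a).
Proof. by exists [:: a] => t; rewrite inE. Qed.

Lemma cofin_inv P : cofin P -> cofin (fun t => P t^-1).
Proof.
case=> s Ps; exists [seq x^-1 | x <- s] => t ts; apply: Ps; apply/negP => ts'.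
by move/negP: ts; apply; apply/mapP; exists t^-1 => //; rewrite invrK.
Qed.

Lemma cofin_all (T : eqType) (l : seq T) (P : T -> K -> Prop) :
  (forall x, x \in l -> cofin (P x)) -> cofin (fun t => forall x, x \in l -> P x t).
Proof.
elim: l => [|a l IH] H; first by exists [::].
have Ha := H a (mem_head _ _).
have Hl : cofin (fun t => forall x, x \in l -> P x t).
  by apply: IH => x xl; apply: H; rewrite inE xl orbT.
apply: cofin_sub (cofin_and Ha Hl) => t [Pa Pl] x.
by rewrite inE => /orP[/eqP->|/Pl].
Qed.

Lemma cofin_root (p : {poly K}) : p != 0 -> cofin (fun t => p.[t] != 0).
Proof.
move=> p0; case: (closed_field_poly_normal p) => r er.
exists r => t; apply: contraNneq => pt.
have : root p t by apply/eqP.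
by rewrite er rootZ ?root_prod_XsubC // lead_coef_eq0.
Qed.

End Cofinite.

Section PolyFun.
Variable K : closedFieldType.

(** Polynomials appear as functions, so that pulling back along a matrix-valued map is plain
    composition. The degree bound d serves the counting in [growth_bound]. *)
Inductive pfd (W : Type) (X : (W -> K) -> Prop) : nat -> (W -> K) -> Prop :=
| pfd_const d c : pfd X d (fun _ => c)
| pfd_gen d g : X g -> pfd X d.+1 g
| pfd_add d f g : pfd X d f -> pfd X d g -> pfd X d (fun w => f w + g w)
| pfd_mul d e f g : pfd X d f -> pfd X e g -> pfd X (d + e) (fun w => f w * g w)
| pfd_ext d f g : pfd X d f -> f =1 g -> pfd X d g.

Definition pf (W : Type) X (f : W -> K) := exists d, pfd X d f.

Section Fixed.
Variables (W : Type) (X : (W -> K) -> Prop).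
Implicit Types f g : W -> K.

Lemma pfd_le d e f : pfd X d f -> (d <= e)%N -> pfd X e f.
Proof.
move=> fd de; rewrite -(subnKC de).
by apply: pfd_ext (pfd_mul fd (pfd_const X _ 1)) _ => w; rewrite mulr1.
Qed.

Lemma pfd_scale d c f : pfd X d f -> pfd X d (fun w => c * f w).
Proof. by move=> fd; rewrite -[d]add0n; apply: pfd_mul (pfd_const _ _ _) fd. Qed.

Lemma pfd_sum d (I : Type) (r : seq I) (P : pred I) (F : I -> W -> K) :
  (forall i, P i -> pfd X d (F i)) -> pfd X d (fun w => \sum_(i <- r | P i) F i w).
Proof.
move=> H; elim: r => [|a r IH].
  by apply: pfd_ext (pfd_const X d 0) _ => w; rewrite big_nil.
case Pa : (P a); last by apply: pfd_ext IH _ => w; rewrite big_cons Pa.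
by apply: pfd_ext (pfd_add (H _ Pa) IH) _ => w; rewrite big_cons Pa.
Qed.

Lemma pf_ext f g : pf X f -> f =1 g -> pf X g.
Proof. by case=> d fd fg; exists d; apply: pfd_ext fg. Qed.
Lemma pf_const c : pf X (fun _ => c). Proof. by exists 0%N; apply: pfd_const. Qed.
Lemma pf_gen g : X g -> pf X g. Proof. by exists 1%N; apply: pfd_gen. Qed.
Lemma pf_add f g : pf X f -> pf X g -> pf X (fun w => f w + g w).
Proof.
case=> d fd [e ge]; exists (maxn d e).
by apply: pfd_add; [apply: pfd_le fd _|apply: pfd_le ge _]; rewrite ?leq_maxl ?leq_maxr.
Qed.
Lemma pf_mul f g : pf X f -> pf X g -> pf X (fun w => f w * g w).
Proof. by case=> d fd [e ge]; exists (d + e)%N; apply: pfd_mul. Qed.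
Lemma pf_scale c f : pf X f -> pf X (fun w => c * f w).
Proof. by apply: pf_mul; apply: pf_const. Qed.
Lemma pf_exp n f : pf X f -> pf X (fun w => f w ^+ n).
Proof.
move=> pff; elim: n => [|n IH]; first exact: pf_const.
by apply: pf_ext (pf_mul pff IH) _ => w; rewrite exprS.
Qed.
Lemma pf_sum (I : Type) (r : seq I) (P : pred I) (F : I -> W -> K) :
  (forall i, P i -> pf X (F i)) -> pf X (fun w => \sum_(i <- r | P i) F i w).
Proof.
move=> H; elim: r => [|a r IH].
  by apply: pf_ext (pf_const 0) _ => w; rewrite big_nil.
case Pa : (P a); last by apply: pf_ext IH _ => w; rewrite big_cons Pa.
by apply: pf_ext (pf_add (H _ Pa) IH) _ => w; rewrite big_cons Pa.
Qed.
Lemma pf_prod (I : Type) (r : seq I) (P : pred I) (F : I -> W -> K) :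
  (forall i, P i -> pf X (F i)) -> pf X (fun w => \prod_(i <- r | P i) F i w).
Proof.
move=> H; elim: r => [|a r IH].
  by apply: pf_ext (pf_const 1) _ => w; rewrite big_nil.
case Pa : (P a); last by apply: pf_ext IH _ => w; rewrite big_cons Pa.
by apply: pf_ext (pf_mul (H _ Pa) IH) _ => w; rewrite big_cons Pa.
Qed.

Definition pmx k N (M : W -> 'M[K]_(k, N)) := forall i j, pf X (fun w => M w i j).

Lemma pmx_const k N (A : 'M[K]_(k, N)) : pmx (fun _ => A).
Proof. by move=> i j; apply: pf_const. Qed.
Lemma pmx_add k N (M M' : W -> 'M[K]_(k, N)) :
  pmx M -> pmx M' -> pmx (fun w => M w + M' w).
Proof. by move=> h h' i j; apply: pf_ext (pf_add (h i j) (h' i j)) _ => w; rewrite mxE. Qed.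
Lemma pmx_scale k N f (M : W -> 'M[K]_(k, N)) :
  pf X f -> pmx M -> pmx (fun w => f w *: M w).
Proof. by move=> h h' i j; apply: pf_ext (pf_mul h (h' i j)) _ => w; rewrite mxE. Qed.
Lemma pmx_mul k l N (M : W -> 'M[K]_(k, l)) (M' : W -> 'M[K]_(l, N)) :
  pmx M -> pmx M' -> pmx (fun w => M w *m M' w).
Proof.
move=> h h' i j; apply: (@pf_ext (fun w => \sum_a M w i a * M' w a j)).
  by apply: pf_sum => a _; apply: pf_mul.
by move=> w; rewrite mxE.
Qed.
Lemma pmx_col k l N (M : W -> 'M[K]_(k, N)) (M' : W -> 'M[K]_(l, N)) :
  pmx M -> pmx M' -> pmx (fun w => col_mx (M w) (M' w)).
Proof.
move=> h h' i j; case: (splitP i) => a ia.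
  have -> : i = lshift l a by apply: val_inj.
  by apply: pf_ext (h a j) _ => w; rewrite col_mxEu.
have -> : i = rshift k a by apply: val_inj.
by apply: pf_ext (h' a j) _ => w; rewrite col_mxEd.
Qed.
Lemma pmx_row k l N (M : W -> 'M[K]_(N, k)) (M' : W -> 'M[K]_(N, l)) :
  pmx M -> pmx M' -> pmx (fun w => row_mx (M w) (M' w)).
Proof.
move=> h h' j i; case: (splitP i) => a ia.
  have -> : i = lshift l a by apply: val_inj.
  by apply: pf_ext (h j a) _ => w; rewrite row_mxEl.
have -> : i = rshift k a by apply: val_inj.
by apply: pf_ext (h' j a) _ => w; rewrite row_mxEr.
Qed.
Lemma pf_det k (M : W -> 'M[K]_k) : pmx M -> pf X (fun w => \det (M w)).
Proof.
move=> h; rewrite /determinant; apply: pf_sum => s _.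
by apply: pf_scale; apply: pf_prod.
Qed.
Lemma pmx_adj k (M : W -> 'M[K]_k) : pmx M -> pmx (fun w => \adj (M w)).
Proof.
move=> h i j; apply: (@pf_ext (fun w => cofactor (M w) j i)); last by move=> w; rewrite mxE.
apply: pf_scale; apply: pf_det => a b.
by apply: pf_ext (h (lift j a) (lift i b)) _ => w; rewrite !mxE.
Qed.

End Fixed.

Lemma pf_comp (W W' : Type) (X : (W -> K) -> Prop) (X' : (W' -> K) -> Prop)
    (phi : W -> W') f :
  (forall g, X' g -> pf X (fun w => g (phi w))) -> pf X' f -> pf X (fun w => f (phi w)).
Proof.
move=> H [d fd]; elim: {f d} fd => [d c|d g /H//|d f g _ IHf _ IHg|d e f g _ IHf _ IHg|d f g _ IHf fg].
- exact: pf_const.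
- exact: pf_add.
- exact: pf_mul.
- by apply: pf_ext IHf _ => w; rewrite fg.
Qed.

(** With these generators, [pmx idgen M] says that M is a polynomial curve of matrices. *)
Definition idgen (g : K -> K) := g = id.

Lemma pf_id : pf idgen id. Proof. exact: pf_gen. Qed.

Lemma pf_poly f : pf idgen f -> exists p : {poly K}, forall t, f t = p.[t].
Proof.
case=> d fd; elim: {d f} fd => [d c|d g ->|d f g _ [p Hp] _ [q Hq]
   |d e f g _ [p Hp] _ [q Hq]|d f g _ [p Hp] fg].
- by exists c%:P => t; rewrite hornerC.
- by exists 'X => t; rewrite hornerX.
- by exists (p + q) => t; rewrite hornerD Hp Hq.
- by exists (p * q) => t; rewrite hornerM Hp Hq.
- by exists p => t; rewrite -fg.
Qed.

Lemma pf_cofin f t0 : pf idgen f -> f t0 != 0 -> cofin (fun t => f t != 0).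
Proof.
move=> /pf_poly [p Hp]; rewrite Hp => pt.
have p0 : p != 0 by apply: contraNneq pt => ->; rewrite horner0.
by apply: cofin_sub (cofin_root p0) => t; rewrite Hp.
Qed.

Definition mxgen k N (g : 'M[K]_(k, N) -> K) := exists i j, g = fun M => M i j.
Notation mpf := (pf (@mxgen _ _)).

Lemma pf_mxcomp W (X : (W -> K) -> Prop) k N (phi : W -> 'M[K]_(k, N)) f :
  mpf f -> pmx X phi -> pf X (fun w => f (phi w)).
Proof. by move=> pff H; apply: pf_comp pff => g [i [j ->]]; apply: H. Qed.

Lemma pmx_id k N : pmx (@mxgen k N) id.
Proof. by move=> i j; apply: pf_gen; exists i, j. Qed.

(** With [pf_meval], the bridge to [mpoly]: once [gclosedP] is proved, only polynomial functions of
    matrices are handled. *)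
Lemma meval_pf k N (f : {mpoly K[k * N]}) :
  pf (@mxgen k N) (fun M => f.@[fun i => mxvec M 0 i]).
Proof.
apply: (@pf_ext _ _ (fun M : 'M[K]_(k, N) => \sum_(m <- msupp f) f@_m * \prod_i mxvec M 0 i ^+ m i)).
  apply: pf_sum => m _; apply: pf_scale; apply: pf_prod => i _; apply: pf_exp.
  case/mxvec_indexP: i => i j.
  by apply: (@pf_ext _ _ (fun M : 'M[K]_(k, N) => M i j)); [apply: pmx_id | move=> M; rewrite mxvecE].
by move=> M; rewrite mevalE.
Qed.

Lemma pf_meval k N (f : 'M[K]_(k, N) -> K) : mpf f ->
  exists p : {mpoly K[k * N]}, forall M, f M = p.@[fun i => mxvec M 0 i].
Proof.
case=> d fd; elim: {d f} fd => [d c|d g [i [j ->]]|d f g _ [p Hp] _ [q Hq]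
   |d e f g _ [p Hp] _ [q Hq]|d f g _ [p Hp] fg].
- by exists c%:MP => t; rewrite mevalC.
- by exists 'X_(mxvec_index i j) => t; rewrite mevalXU mxvecE.
- by exists (p + q) => t; rewrite mevalD Hp Hq.
- by exists (p * q) => t; rewrite mevalM Hp Hq.
- by exists p => t; rewrite -fg.
Qed.

End PolyFun.
Notation mpf := (pf (@mxgen _ _ _)).

(** * Closed sets of subspaces *)

Section Rowspan.
Variables (K : closedFieldType) (n : nat).
Notation vT := 'rV[K]_n.+1.

Lemma row_mem_rowspan k (M : 'M[K]_(k, n.+1)) i : row i M \in rowspan M.
Proof. by apply: memv_span; apply/mapP; exists i; rewrite ?mem_enum. Qed.

Lemma mem_rowspan k (M : 'M[K]_(k, n.+1)) (v : vT) : (v \in rowspan M) = (v <= M)%MS.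
Proof.
apply/idP/idP => [vM|/submxP [D ->]]; last first.
  rewrite mulmx_sum_row; apply: memv_suml => i _; apply: memvZ; exact: row_mem_rowspan.
have [X eX] : exists X : k.-tuple vT, tval X = [seq row i M | i <- enum 'I_k].
  have h : size [seq row i M | i <- enum 'I_k] == k by rewrite size_map size_enum_ord.
  by exists (Tuple h).
move: vM; rewrite /rowspan -eX => vM; rewrite (coord_span vM).
apply: summx_sub => i _; apply: scalemx_sub.
have -> : X`_i = row i M.
  by rewrite eX (nth_map i) ?size_enum_ord // nth_ord_enum.
exact: row_sub.
Qed.

Lemma rowspan_le k l (M : 'M[K]_(k, n.+1)) (M' : 'M[K]_(l, n.+1)) :
  (rowspan M <= rowspan M')%VS = (M <= M')%MS.
Proof.
apply/subvP/idP => [H|H v]; last by rewrite !mem_rowspan => /submx_trans; apply.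
by apply/row_subP => i; rewrite -mem_rowspan; apply: H; apply: row_mem_rowspan.
Qed.

Lemma rowspan_eq k l (M : 'M[K]_(k, n.+1)) (M' : 'M[K]_(l, n.+1)) :
  (M :=: M')%MS -> rowspan M = rowspan M'.
Proof. by move=> e; apply: subv_anti; rewrite !rowspan_le !e !submx_refl. Qed.

Lemma dim_rowspan_free k (M : 'M[K]_(k, n.+1)) : row_free M -> \dim (rowspan M) = k.
Proof.
move=> fM.
have [X eX] : exists X : k.-tuple vT, tval X = [seq row i M | i <- enum 'I_k].
  have h : size [seq row i M | i <- enum 'I_k] == k by rewrite size_map size_enum_ord.
  by exists (Tuple h).
rewrite /rowspan -eX.
suff : free X by rewrite /free => /eqP ->; rewrite size_tuple.
apply/freeP => c c0 i.
have : (\row_j c j) *m M = 0.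
  rewrite mulmx_sum_row -[RHS]c0; apply: eq_bigr => j _.
  by rewrite mxE eX (nth_map j) ?size_enum_ord // nth_ord_enum.
by rewrite -(mul0mx _ M) => /(row_free_inj fM) /rowP /(_ i); rewrite !mxE.
Qed.

Lemma dim_rowspan k (M : 'M[K]_(k, n.+1)) : \dim (rowspan M) = \rank M.
Proof.
rewrite -(rowspan_eq (eq_row_base M)); apply: dim_rowspan_free; exact: row_base_free.
Qed.

Lemma rowspan1 (v : vT) : rowspan v = <[v]>%VS.
Proof.
apply/vspaceP => w; rewrite mem_rowspan; apply/idP/idP.
  by move/sub_rVP => [a ->]; apply: memvZ; apply: memv_line.
by move/vlineP => [a ->]; apply: scalemx_sub.
Qed.

Lemma rowspan_col k l (A : 'M[K]_(k, n.+1)) (B : 'M[K]_(l, n.+1)) :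
  rowspan (col_mx A B) = (rowspan A + rowspan B)%VS.
Proof.
apply: subv_anti; apply/andP; split; last first.
  by rewrite subv_add !rowspan_le -!addsmxE addsmxSl addsmxSr.
apply/subvP => v; rewrite mem_rowspan -addsmxE => /sub_addsmxP [[u w] /= ->].
by apply: memv_add; rewrite mem_rowspan submxMl.
Qed.

Lemma rowspan_ex (U : {vspace vT}) : exists M : 'M[K]_(\dim U, n.+1), rowspan M = U.
Proof.
pose M : 'M[K]_(\dim U, n.+1) := \matrix_(i < \dim U) (vbasis U)`_i.
exists M.
have -> : rowspan M = <<vbasis U>>%VS.
  congr span; apply: (@eq_from_nth _ 0); first by rewrite size_map size_enum_ord size_tuple.
  move=> i; rewrite size_map size_enum_ord => iU.
  by rewrite (nth_map (Ordinal iU)) ?size_enum_ord // rowK nth_enum_ord.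
exact/span_basis/vbasisP.
Qed.

Lemma rowspan_exd k (U : {vspace vT}) : \dim U = k ->
  exists M : 'M[K]_(k, n.+1), rowspan M = U /\ \rank M = k.
Proof. by move=> <-; case: (rowspan_ex U) => M e; exists M; rewrite -dim_rowspan e. Qed.

Lemma rowspan_mul k (G : 'M[K]_k) (M : 'M[K]_(k, n.+1)) :
  \det G != 0 -> rowspan (G *m M) = rowspan M.
Proof.
move=> dG; apply: rowspan_eq; apply: eqmxMfull; rewrite row_full_unit unitmxE unitfE //.
Qed.

(** Turns full rank into the nonvanishing of one polynomial, which can be multiplied into any
    separating function. *)
Lemma rank_right_inv k (M : 'M[K]_(k, n.+1)) :
  \rank M = k <-> exists R, \det (M *m R) != 0.
Proof.
split=> [rM|[R dR]].
  have /row_freeP [R MR] : row_free M by apply/eqP.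
  by exists R; rewrite MR det1 oner_neq0.
apply/eqP; rewrite eqn_leq rank_leq_row /=.
have : \rank (M *m R) = k by apply/eqP; rewrite [_ == _]row_free_unit unitmxE unitfE.
by move=> {1}<-; apply: mxrankM_maxl.
Qed.

End Rowspan.

Section Closed.
Variables (K : closedFieldType) (n : nat).
Notation vT := 'rV[K]_n.+1.
Notation gset := ({vspace vT} -> Prop).

(* Closedness in the Stiefel variety: points off P are separated from P by one
   polynomial, which avoids carrying families of equations. *)
Definition sclosed k (P : 'M[K]_(k, n.+1) -> Prop) :=
  forall M, \rank M = k -> ~ P M ->
    exists2 f, mpf f & f M != 0 /\ forall M', \rank M' = k -> P M' -> f M' = 0.

(** For the converse, the equations taken are all the polynomials that vanish on S. *)
Lemma gclosedP k (S : gset) :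
  gclosed k S <-> (forall U, S U -> \dim U = k) /\ @sclosed k (fun M => S (rowspan M)).
Proof.
split=> [[dS [F HF]]|[dS cS]]; split=> //.
  move=> M rM nS.
  have [f [Ff fM]] : exists f, F f /\ f.@[fun i => mxvec M 0 i] != 0.
    apply: NNPP => H; apply: nS; apply/HF => // f Ff; apply: NNPP => f0.
    by apply: H; exists f; split=> //; apply/eqP.
  exists (fun M => f.@[fun i => mxvec M 0 i]); first exact: meval_pf.
  by split=> // M' rM' /HF; apply.
exists (fun f => forall M', \rank M' = k -> S (rowspan M') -> f.@[fun i => mxvec M' 0 i] = 0).
move=> M rM; split=> [SM f|H]; first exact.
apply: NNPP => /(cS _ rM) [f /pf_meval [p Hp] [fM f0]].
by move/eqP: fM; apply; rewrite Hp; apply: H => M' rM' SM'; rewrite -Hp; apply: f0.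
Qed.

Lemma gclosed_dim k (S : gset) U : gclosed k S -> S U -> \dim U = k.
Proof. by case=> dS _; apply: dS. Qed.

Lemma gclosed_sclosed k (S : gset) : gclosed k S -> @sclosed k (fun M => S (rowspan M)).
Proof. by case/gclosedP. Qed.

Lemma gclosed_inter k (I : Type) (S : I -> gset) (i0 : I) :
  (forall i, gclosed k (S i)) -> gclosed k (fun U => forall i, S i U).
Proof.
move=> cS; apply/gclosedP; split=> [U SU|M rM nS]; first exact: (gclosed_dim (cS i0)).
have [i nSi] := not_all_ex_not _ _ nS.
have [f pff [fM f0]] := gclosed_sclosed (cS i) rM nSi.
by exists f => //; split=> // M' rM' /(_ i); apply: f0.
Qed.

Lemma gclosed_and k (S T : gset) : gclosed k S -> gclosed k T -> gclosed k (fun U => S U /\ T U).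
Proof.
move=> cS cT; apply/gclosedP; split=> [U [SU _]|M rM nS]; first exact: (gclosed_dim cS).
case: (classic (S (rowspan M))) => SM.
  have [TM|f pff [fM f0]] := @gclosed_sclosed _ _ cT M rM; first by apply: nS.
  by exists f => //; split=> // M' rM' []; auto.
have [f pff [fM f0]] := @gclosed_sclosed _ _ cS M rM SM.
by exists f => //; split=> // M' rM' []; auto.
Qed.

Lemma gclosed_grass k : gclosed k (@grass K n k).
Proof. by apply/gclosedP; split=> // M rM []; rewrite /grass dim_rowspan. Qed.

Lemma gclosed_eq k (S T : gset) : (forall U, S U <-> T U) -> gclosed k S -> gclosed k T.
Proof.
move=> e /gclosedP [dS cS]; apply/gclosedP; split=> [U /e/dS//|M rM nT].
have [/e//|f pff [fM f0]] := @cS M rM.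
by exists f => //; split=> // M' rM' /e; apply: f0.
Qed.

(* The condition is void where phi drops rank: there the factor det (phi M *m R)
   vanishes. *)
Lemma sclosed_pull k m (P : 'M[K]_(m, n.+1) -> Prop) (phi : 'M[K]_(k, n.+1) -> 'M[K]_(m, n.+1)) :
  sclosed P -> pmx (@mxgen K _ _) phi ->
  sclosed (fun N => \rank (phi N) = m -> P (phi N)).
Proof.
move=> cP pphi N rN nH; have [r nP] := imply_to_and _ _ nH.
have [f pff [fM f0]] := cP _ r nP.
have /rank_right_inv [R dR] := r.
exists (fun N => f (phi N) * \det (phi N *m R)).
  apply: pf_mul; first exact: pf_mxcomp pff pphi.
  by apply: pf_det; apply: pmx_mul => //; apply: pmx_const.
split=> [|M' rM' H]; first by rewrite mulf_neq0.
case: (eqVneq (\det (phi M' *m R)) 0) => [->|d]; first by rewrite mulr0.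
have r' : \rank (phi M') = m by apply/rank_right_inv; exists R.
by rewrite f0 ?mul0r //; apply: H.
Qed.

(** Lets a condition quantified over auxiliary matrices be proved closed for one value of the
    parameter at a time. *)
Lemma sclosed_all k (I : Type) (P : I -> 'M[K]_(k, n.+1) -> Prop) :
  (forall i, sclosed (P i)) -> sclosed (fun M => forall i, P i M).
Proof.
move=> cP M rM /not_all_ex_not [i nP]; have [f pff [fM f0]] := cP i M rM nP.
by exists f => //; split=> // M' rM' /(_ i); apply: f0.
Qed.

Lemma sclosed_eq k (P Q : 'M[K]_(k, n.+1) -> Prop) :
  (forall M, \rank M = k -> (P M <-> Q M)) -> sclosed P -> sclosed Q.
Proof.
move=> e cP M rM nQ.
have [/e|f pff [fM f0]] := cP M rM; first by move/(_ rM).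
by exists f => //; split=> // M' rM' Q'; apply: f0 => //; apply/e.
Qed.

(** Along a polynomial curve, the separating function and a determinant witnessing full rank are
    polynomials in t that do not vanish at t0. *)
Lemma sclosed_curve k (P : 'M[K]_(k, n.+1) -> Prop) (M : K -> 'M[K]_(k, n.+1)) t0 :
  sclosed P -> pmx (@idgen K) M -> \rank (M t0) = k -> ~ P (M t0) ->
  cofin (fun t => \rank (M t) = k /\ ~ P (M t)).
Proof.
move=> cP pM r nP; have [f pff [fM f0]] := cP _ r nP.
have /rank_right_inv [R dR] := r.
have c1 : cofin (fun t => f (M t) != 0).
  by apply: (pf_cofin (t0 := t0)) => //; apply: pf_mxcomp pff pM.
have c2 : cofin (fun t => \det (M t *m R) != 0).
  apply: (pf_cofin (t0 := t0)) => //; apply: pf_det; apply: pmx_mul => //; exact: pmx_const.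
apply: cofin_sub (cofin_and c1 c2) => t [ft dt].
have rt : \rank (M t) = k by apply/rank_right_inv; exists R.
by split=> // Pt; move/eqP: ft; apply; apply: f0.
Qed.

Lemma gclosed_curve k (S : gset) (M : K -> 'M[K]_(k, n.+1)) t0 :
  gclosed k S -> pmx (@idgen K) M -> \rank (M t0) = k -> ~ S (rowspan (M t0)) ->
  cofin (fun t => \rank (M t) = k /\ ~ S (rowspan (M t))).
Proof. by move=> /gclosed_sclosed cS; apply: (sclosed_curve (P := fun M => S (rowspan M))). Qed.

Lemma pmx_id_scale k N (A : 'M[K]_(k, N)) : pmx (@idgen K) (fun t => t *: A).
Proof. by apply: pmx_scale; [exact: pf_id | exact: pmx_const]. Qed.

(** Closedness restricted to affine lines of overspaces of D. The incidence arguments know [B] and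
    [C] to be closed only in this sense. *)
Definition pcl k (S : gset) := forall (D : {vspace vT}) (x y : vT),
  \dim D = k -> x \notin D -> ~ S (D + <[x]>)%VS ->
  cofin (fun t => x + t *: y \notin D /\ ~ S (D + <[x + t *: y]>)%VS).

Lemma dim_addl (D : {vspace vT}) (x : vT) : x \notin D -> \dim (D + <[x]>)%VS = (\dim D).+1.
Proof.
move=> xD; have x0 : x != 0 by apply: contraNneq xD => ->; rewrite mem0v.
rewrite dimv_disjoint_sum; first by rewrite dim_vline x0 addn1.
apply/eqP; rewrite -subv0; apply/subvP => v /memv_capP [vD /vlineP [a va]].
case: (eqVneq a 0) => [a0|a0]; first by rewrite va a0 scale0r mem0v.
case/negP: xD; rewrite -[x]scale1r -(mulVf a0) -scalerA -va; exact: memvZ.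
Qed.

Lemma gclosed_pcl k (S : gset) : gclosed k.+1 S -> pcl k S.
Proof.
move=> cS D x y dD xD nS.
have [A [eA rA]] := rowspan_exd dD.
pose M t : 'M[K]_(k.+1, n.+1) := col_mx (x + t *: y) A.
have eM t : rowspan (M t) = (D + <[x + t *: y]>)%VS.
  by rewrite [LHS](rowspan_col (x + t *: y) A) rowspan1 eA addvC.
have pM : pmx (@idgen K) M.
  apply: (@pmx_col K K _ 1 k n.+1 (fun t => x + t *: y) (fun=> A)); last exact: pmx_const.
  apply: pmx_add; [exact: pmx_const | exact: pmx_id_scale].
have [||s Hs] := gclosed_curve (t0 := 0) cS pM.
- by rewrite -dim_rowspan eM scale0r addr0 dim_addl // dD.
- by rewrite eM scale0r addr0.
exists s => t /Hs []; rewrite eM -dim_rowspan eM => dM nSt; split=> //.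
apply/negP => xyD; move: dM; have -> : (D + <[x + t *: y]>)%VS = D by apply/addv_idPl.
by rewrite dD => /n_Sn.
Qed.

End Closed.

(** * Elimination along pencils *)

Section Elimination.
Variables (K : closedFieldType) (n : nat).
Notation vT := 'rV[K]_n.+1.
Notation gset := ({vspace vT} -> Prop).

Section Homogeneous.
Variable l : nat.
Notation mT := 'M[K]_(l, n.+1).

(** Forms of degree e in the first row u, with arbitrary polynomial dependence on the other rows a.
    [pfh_zero] makes 0 a form of every degree. *)
Inductive pfh : nat -> (vT -> mT -> K) -> Prop :=
| pfh_const c : pfh 0 (fun _ _ => c)
| pfh_zero e : pfh e (fun _ _ => 0)
| pfh_top j : pfh 1 (fun u _ => u 0 j)
| pfh_rest i j : pfh 0 (fun _ a => a i j)
| pfh_add e f g : pfh e f -> pfh e g -> pfh e (fun u a => f u a + g u a)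
| pfh_mul d e f g : pfh d f -> pfh e g -> pfh (d + e) (fun u a => f u a * g u a)
| pfh_ext e f g : pfh e f -> (forall u a, f u a = g u a) -> pfh e g.

Lemma pfh_sum e (I : Type) (r : seq I) (F : I -> vT -> mT -> K) :
  (forall i, pfh e (F i)) -> pfh e (fun u a => \sum_(i <- r) F i u a).
Proof.
move=> H; elim: r => [|i r IH].
  by apply: pfh_ext (pfh_zero e) _ => u a; rewrite big_nil.
by apply: pfh_ext (pfh_add (H i) IH) _ => u a; rewrite big_cons.
Qed.

(** Scaling the first row by t grades f: the coefficient of t^e is the component of degree e in that
    row. *)
Lemma pfh_decomp (f : 'M[K]_(1 + l, n.+1) -> K) : mpf f ->
  exists P : vT -> mT -> {poly K}, (forall e, pfh e (fun u a => (P u a)`_e)) /\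
    forall t u a, f (col_mx (t *: u) a) = (P u a).[t].
Proof.
case=> d fd; elim: {d f} fd => [d c|d g [i [j ->]]|d f g _ [p [hp Hp]] _ [q [hq Hq]]
   |d e f g _ [p [hp Hp]] _ [q [hq Hq]]|d f g _ [p [hp Hp]] fg].
- exists (fun _ _ => c%:P); split=> [[|e]|t u a]; last by rewrite hornerC.
    by apply: pfh_ext (pfh_const c) _ => u a; rewrite coefC.
  by apply: pfh_ext (pfh_zero _) _ => u a; rewrite coefC.
- case: (splitP i) => a ia.
    have -> : i = lshift l a by apply: val_inj.
    exists (fun u _ => u 0 j *: 'X); split=> [[|[|e]]|t u b].
    + by apply: pfh_ext (pfh_zero _) _ => u b; rewrite coefZ coefX mulr0.
    + by apply: pfh_ext (pfh_top j) _ => u b; rewrite coefZ coefX mulr1.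
    + by apply: pfh_ext (pfh_zero _) _ => u b; rewrite coefZ coefX mulr0.
    by rewrite col_mxEu hornerZ hornerX mxE mulrC ord1.
  have -> : i = rshift 1 a by apply: val_inj.
  exists (fun _ b => (b a j)%:P); split=> [[|e]|t u b].
  + by apply: pfh_ext (pfh_rest a j) _ => u b; rewrite coefC.
  + by apply: pfh_ext (pfh_zero _) _ => u b; rewrite coefC.
  by rewrite col_mxEd hornerC.
- exists (fun u a => p u a + q u a); split=> [e|t u a]; last by rewrite hornerD Hp Hq.
  by apply: pfh_ext (pfh_add (hp e) (hq e)) _ => u a; rewrite coefD.
- exists (fun u a => p u a * q u a); split=> [i|t u a]; last by rewrite hornerM Hp Hq.
  apply: (@pfh_ext _ (fun u a => \sum_(j < i.+1) (p u a)`_j * (q u a)`_(i - j))).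
    apply: pfh_sum => j; rewrite -[X in pfh X](subnKC (_ : j <= i)%N) ?leq_ord //.
    exact: pfh_mul (hp j) (hq (i - j)%N).
  by move=> u a; rewrite coefM.
- by exists p; split=> // t u a; rewrite -fg.
Qed.

Notation M3 u v a := (col_mx u (col_mx v a) : 'M[K]_(1 + (1 + l), n.+1)).

(** Restricts a form to the projective line through u and v: evaluation at s gives the affine
    points, and the coefficient of formal degree e is the value at the point at infinity u. *)
Lemma pfh_line e f : pfh e f ->
  exists p : 'M[K]_(1 + (1 + l), n.+1) -> {poly K},
    (forall i, mpf (fun M => (p M)`_i)) /\
    (forall M, (size (p M) <= e.+1)%N) /\
    (forall (u v : vT) (a : mT) s, f (s *: u + v) a = (p (M3 u v a)).[s]) /\
    forall (u v : vT) (a : mT), f u a = (p (M3 u v a))`_e.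
Proof.
elim=> {e f} [c|e|j|i j|e f g _ [p [cp [sp [Hp Tp]]]] _ [q [cq [sq [Hq Tq]]]]
  |d e f g _ [p [cp [sp [Hp Tp]]]] _ [q [cq [sq [Hq Tq]]]]|e f g _ [p [cp [sp [Hp Tp]]]] fg].
- exists (fun _ => c%:P); split=> [i|]; first exact: pf_const.
  split=> [M|]; first exact: size_polyC_leq1.
  by split=> *; rewrite ?hornerC ?coefC.
- exists (fun _ => 0); split=> [i|]; first exact: pf_const.
  by split=> [M|]; rewrite ?size_poly0 //; split=> *; rewrite ?horner0 ?coef0.
- exists (fun M => (M (lshift _ 0) j) *: 'X + (M (rshift 1 (lshift l 0)) j)%:P); split=> [i|].
    apply: (@pf_ext _ _ _ (fun M : 'M[K]_(1 + (1 + l), n.+1) => M (lshift _ 0) j * ('X : {poly K})`_i +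
      (if i == 0%N then 1 else 0) * M (rshift 1 (lshift l 0)) j)).
      apply: pf_add; apply: pf_mul; (try exact: pf_const); exact: pmx_id.
    by move=> M; rewrite coefD coefZ coefC; case: (i == 0%N); rewrite ?mul1r ?mul0r.
  split=> [M|].
    apply: leq_trans (size_polyD _ _) _; rewrite geq_max (leq_trans (size_polyC_leq1 _)) // andbT.
    by apply: leq_trans (size_scale_leq _ _) _; rewrite size_polyX.
  split=> u v a *; rewrite ?hornerD ?hornerZ ?hornerX ?hornerC ?coefD ?coefZ ?coefX ?coefC /=.
    by rewrite col_mxEu col_mxEd col_mxEu !mxE mulrC.
  by rewrite col_mxEu mulr1 addr0.
- exists (fun M => (M (rshift 1 (rshift 1 i)) j)%:P); split=> [i0|].
    apply: (@pf_ext _ _ _ (fun M : 'M[K]_(1 + (1 + l), n.+1) =>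
      (if i0 == 0%N then 1 else 0) * M (rshift 1 (rshift 1 i)) j)).
      apply: pf_mul; (try exact: pf_const); exact: pmx_id.
    by move=> M; rewrite coefC; case: (i0 == 0%N); rewrite ?mul1r ?mul0r.
  split=> [M|]; first exact: size_polyC_leq1.
  by split=> *; rewrite ?hornerC ?coefC !col_mxEd.
- exists (fun M => p M + q M); split=> [i|].
    by apply: pf_ext (pf_add (cp i) (cq i)) _ => M; rewrite coefD.
  split=> [M|]; first by apply: leq_trans (size_polyD _ _) _; rewrite geq_max sp sq.
  by split=> u v a *; rewrite ?hornerD ?coefD ?Hp ?Hq // -Tp -Tq.
- exists (fun M => p M * q M); split=> [i|].
    apply: (@pf_ext _ _ _ (fun M => \sum_(j < i.+1) (p M)`_j * (q M)`_(i - j))).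
      by apply: pf_sum => j _; apply: pf_mul.
    by move=> M; rewrite coefM.
  split=> [M|].
    apply: leq_trans (size_polyMleq _ _) _.
    have := sp M; have := sq M; lia.
  split=> u v a *; first by rewrite hornerM Hp Hq.
  rewrite coefM (bigD1 (inord d)) //= inordK; last by lia.
  rewrite addKn -Tp -Tq big1 ?addr0 // => j jd.
  have jd' : (j : nat) != d by apply: contraNneq jd => jd; apply/eqP/val_inj; rewrite /= inordK //; lia.
  case: (ltngtP j d) jd' => // jd' _.
    by rewrite [X in _ * X]nth_default ?mulr0 //; apply: leq_trans (sq _) _; lia.
  by rewrite nth_default ?mul0r //; apply: leq_trans (sp _) _; lia.
- by exists p; do !split => //; move=> *; rewrite -fg.
Qed.

(** Membership in S depends on the first row only up to a scalar, so every homogeneous component of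
    a separating function vanishes on S again; one of them is nonzero at the given point. *)
Lemma gclosed_hsep (S : gset) (u0 : vT) (a0 : mT) : gclosed l.+1 S ->
  \rank (col_mx u0 a0) = l.+1 -> ~ S (rowspan (col_mx u0 a0)) ->
  exists e f, pfh e f /\ f u0 a0 != 0 /\
    forall (u : vT) (a : mT), \rank (col_mx u a) = l.+1 -> S (rowspan (col_mx u a)) -> f u a = 0.
Proof.
move=> /gclosed_sclosed cS r nS.
have [f pff [fM f0]] := cS _ r nS.
have [P [hP HP]] := pfh_decomp pff.
have [e Pe] : exists e, (P u0 a0)`_e != 0.
  apply: NNPP => H; case/eqP: fM; rewrite -(scale1r u0) [LHS]HP.
  have -> : P u0 a0 = 0; last by rewrite horner0.
  by apply/polyP => i; rewrite coef0; apply: NNPP => Pi; apply: H; exists i; apply/eqP.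
exists e, (fun u a => (P u a)`_e); split=> //; split=> // u a rua Sua.
suff -> : P u a = 0 by rewrite coef0.
apply/eqP/negPn/negP => /cofin_root cP.
have [t [Pt t0]] := cofin_ex (cofin_and cP (cofin_neq 0)).
have e1 : (col_mx (t *: u) a :=: col_mx u a)%MS.
  apply/eqmxP; rewrite -!addsmxE.
  have h : (t *: u :=: u)%MS by apply: eqmx_scale.
  by apply/andP; split; rewrite (adds_eqmx h (eqmx_refl a)).
move/eqP: Pt; apply; rewrite -HP; apply: f0.
  exact: etrans (eqmx_rank (introT eqmxP e1)) rua.
by rewrite (rowspan_eq e1).
Qed.

End Homogeneous.

Lemma row_free0 m N (A : 'M[K]_(m, N)) :
  row_free A <-> (forall v : 'rV_m, v *m A = 0 -> v = 0).
Proof.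
split=> [fA v vA|]; last exact: inj_row_free.
by apply: (row_free_inj fA); rewrite vA mul0mx.
Qed.

Lemma rank_pencil l (u v : vT) (a : 'M[K]_(l, n.+1)) s r :
  \rank (col_mx u (col_mx v a)) = l.+2 -> (s != 0) || (r != 0) ->
  \rank (col_mx (s *: u + r *: v) a) = l.+1.
Proof.
move=> rM sr; apply/eqP; change (row_free (col_mx (s *: u + r *: v) a)).
have /row_free0 H : row_free (col_mx u (col_mx v a)) by apply/eqP.
apply/row_free0 => w; rewrite -[w]hsubmxK mul_row_col => E.
set y := lsubmx w in E *; set z := rsubmx w in E *.
have := H (row_mx (s *: y) (row_mx (r *: y) z)).
rewrite !mul_row_col -!scalemxAl addrA !scalemxAr -mulmxDr E => /(_ erefl) /eqP.
rewrite -[0]row_mx0 -[X in row_mx 0 X]row_mx0.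
move=> /eqP /eq_row_mx [sy /eq_row_mx [ry ->]].
suff -> : y = 0 by rewrite row_mx0.
by case/orP: sr => h; [move: sy | move: ry] => /eqP; rewrite scaler_eq0 (negPf h) => /eqP.
Qed.

(** The pencil between [rowspan a] and [rowspan M], written as the affine line together with one
    point at infinity. *)
Definition pencil_meets (S : gset) l (M : 'M[K]_(1 + (1 + l), n.+1)) :=
  let u := usubmx M in let v := usubmx (dsubmx M) in let a := dsubmx (dsubmx M) in
  S (rowspan (col_mx u a)) \/ exists s, S (rowspan (col_mx (s *: u + v) a)).

(** Nullstellensatz in one variable. A nonconstant member p has a root x; the remainder modulo p of
    a member that is nonzero at x is again in I, nonzero and of smaller degree. *)
Lemma poly_ideal1 (I : {poly K} -> Prop) :
  (forall p q, I p -> I q -> I (p + q)) -> (forall p q, I q -> I (p * q)) ->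
  (forall x, exists2 p, I p & p.[x] != 0) -> I 1.
Proof.
move=> ID IM H.
have [p0 Ip0 p00] := H 0.
have : p0 != 0 by apply: contraNneq p00 => ->; rewrite horner0.
elim: (size p0) {-2}p0 (leqnn (size p0)) Ip0 => {p0 p00} [|k IH] p sp Ip p0.
  by move: sp; rewrite leqn0 size_poly_eq0 (negPf p0).
have [/size_poly1P [c c0 pc]|s1] := boolP (size p == 1%N).
  by have := IM c^-1%:P _ Ip; rewrite pc -polyCM mulVf.
have /closed_rootP [x /rootP px] := s1.
have [q Iq qx] := H x.
have Ir : I (q %% p).
  have -> : q %% p = q + (- (q %/ p)) * p by rewrite {2}(divp_eq q p) mulNr addrAC subrr add0r.
  by apply: ID => //; apply: IM.
have r0 : q %% p != 0.
  by apply: contraNneq qx => r0; rewrite (divp_eq q p) r0 addr0 hornerM px mulr0.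
by apply: IH Ir r0; rewrite -ltnS (leq_trans _ sp) // ltn_modp.
Qed.

(** Elimination over the projective line, by a resultant. If S misses the pencil of M0, the forms
    vanishing on S have no common zero there; multiples of two of them fill a square matrix that is
    invertible at M0 and singular wherever S meets the pencil. *)
Theorem pencil_meets_closed l (S : gset) : gclosed l.+1 S -> sclosed (@pencil_meets S l).
Proof.
move=> cS M0; rewrite -[M0]vsubmxK -[dsubmx M0]vsubmxK.
move: (usubmx M0) (usubmx (dsubmx M0)) (dsubmx (dsubmx M0)) => u0 v0 a0 {M0} rM.
rewrite /pencil_meets !(col_mxKu, col_mxKd) => /not_or_and [nS0 nSs].
have {}nSs s : ~ S (rowspan (col_mx (s *: u0 + v0) a0)) by move=> h; apply: nSs; exists s.
pose M0 := col_mx u0 (col_mx v0 a0).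
(* [G e p]: on the pencil of each M, p is a form of degree e vanishing at the members of S, with
   coefficients polynomial in M. The coefficient of degree e is the value at infinity, so the formal
   degree is part of the data. *)
pose G e (p : 'M[K]_(1 + (1 + l), n.+1) -> {poly K}) :=
  (forall i, mpf (fun M => (p M)`_i)) /\
  forall M, \rank M = l.+2 -> (size (p M) <= e.+1)%N /\
  (forall s, S (rowspan (col_mx (s *: usubmx M + usubmx (dsubmx M)) (dsubmx (dsubmx M)))) ->
    (p M).[s] = 0) /\
  (S (rowspan (col_mx (usubmx M) (dsubmx (dsubmx M)))) -> (p M)`_e = 0).
have GS e p : G e p -> G e.+1 p.
  case=> cp Hp; split=> // M /Hp [sp [ps pe]]; split; first exact: leqW.
  by split=> // _; rewrite nth_default.
have Gle e d p : G e p -> (e <= d)%N -> G d p.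
  by move=> Gp /subnK <-; elim: (d - e)%N => // k IH; rewrite addSn; apply: GS.
have GD e p q : G e p -> G e q -> G e (fun M => p M + q M).
  move=> [cp Hp] [cq Hq]; split=> [i|M rk].
    by apply: pf_ext (pf_add (cp i) (cq i)) _ => M; rewrite coefD.
  have [sp [ps pe]] := Hp _ rk; have [sq [qs qe]] := Hq _ rk.
  split; first by apply: leq_trans (size_polyD _ _) _; rewrite geq_max sp sq.
  by split=> [s h|h]; rewrite ?hornerD ?coefD ?ps ?qs ?pe ?qe ?addr0.
have GZ e p c : G e p -> G e (fun M => c *: p M).
  move=> [cp Hp]; split=> [i|M rk].
    by apply: pf_ext (pf_scale c (cp i)) _ => M; rewrite coefZ.
  have [sp [ps pe]] := Hp _ rk.
  split; first exact: leq_trans (size_scale_leq _ _) sp.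
  by split=> [s h|h]; rewrite ?hornerZ ?coefZ ?ps ?pe ?mulr0.
have GX e p k : G e p -> G (k + e)%N (fun M => 'X^k * p M).
  move=> [cp Hp]; split=> [i|M rk].
    case: (ltnP i k) => ik.
      by apply: pf_ext (pf_const _ 0) _ => M; rewrite coefXnM ik.
    by apply: pf_ext (cp (i - k)%N) _ => M; rewrite coefXnM ltnNge ik.
  have [sp [ps pe]] := Hp _ rk; split.
    apply: leq_trans (size_polyMleq _ _) _; rewrite size_polyXn; lia.
  split=> [s h|h]; first by rewrite hornerM ps ?mulr0.
  by rewrite coefXnM ltnNge leq_addr /= addKn pe.
have Gsum e k (F : nat -> 'M[K]_(1 + (1 + l), n.+1) -> {poly K}) :
    (forall i, (i < k)%N -> G e (F i)) -> G e (fun M => \sum_(i < k) F i M).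
  elim: k => [|k IH] H.
    split=> [i|M rk]; first by apply: pf_ext (pf_const _ 0) _ => M; rewrite big_ord0 coef0.
    by rewrite big_ord0 size_poly0; split=> //; split=> *; rewrite ?horner0 ?coef0.
  have [c0 H0] := GD _ _ _ (IH (fun i ik => H i (leqW ik))) (H k (leqnn _)).
  split=> [i|M rk]; first by apply: pf_ext (c0 i) _ => M; rewrite big_ord_recr.
  by rewrite big_ord_recr; apply: H0.
have Gh e f : pfh e f -> (forall (u : vT) (a : 'M_(l, n.+1)), \rank (col_mx u a) = l.+1 ->
    S (rowspan (col_mx u a)) -> f u a = 0) -> exists p, G e p /\
      (p M0)`_e = f u0 a0 /\ forall s, (p M0).[s] = f (s *: u0 + v0) a0.
  move=> /pfh_line [p [cp [sp [Hp Tp]]]] f0; exists p; split; last by split=> *; rewrite ?Hp ?(Tp _ v0).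
  split=> // M; rewrite -[M]vsubmxK -[dsubmx M]vsubmxK => rk.
  rewrite !(col_mxKu, col_mxKd); split=> //; split=> [s h|h].
    by rewrite -Hp f0 //; have := rank_pencil (s := s) (r := 1) rk; rewrite scale1r oner_neq0 orbT => ->.
  by rewrite -Tp f0 //; have := rank_pencil (s := 1) (r := 0) rk; rewrite scale1r scale0r addr0 oner_neq0 => ->.
have rk0 : \rank (col_mx u0 a0) = l.+1.
  by have := rank_pencil (s := 1) (r := 0) rM; rewrite scale1r scale0r addr0 oner_neq0 => ->.
have rks s : \rank (col_mx (s *: u0 + v0) a0) = l.+1.
  by have := rank_pencil (s := s) (r := 1) rM; rewrite scale1r oner_neq0 orbT => ->.
(* The values at M0 of all these forms make up an ideal of K[s] without common zero, since S misses
   the affine part of the pencil; hence some g equals 1 at M0. *)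
have [e [g [Gg g1]]] : exists e p, G e p /\ p M0 = 1.
  pose I p := exists e q, G e q /\ q M0 = p.
  apply: (@poly_ideal1 I).
  - move=> _ _ [e [p [Gp <-]]] [d [q [Gq <-]]]; exists (maxn e d), (fun M => p M + q M); split=> //.
    by apply: GD; [apply: Gle Gp _ | apply: Gle Gq _]; rewrite ?leq_maxl ?leq_maxr.
  - move=> p _ [e [q [Gq <-]]].
    exists (size p + e)%N, (fun M => \sum_(i < size p) p`_i *: ('X^i * q M)); split.
      apply: (@Gsum _ _ (fun i M => p`_i *: ('X^i * q M))) => i ip.
      by apply: GZ; apply: Gle (GX _ _ i Gq) _; rewrite leq_add2r ltnW.
    rewrite -[in RHS](coefK p) poly_def mulr_suml.
    by apply: eq_bigr => i _; rewrite -scalerAl.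
  - move=> x; have [e [f [hf [fx f0]]]] := gclosed_hsep cS (rks x) (nSs x).
    have [p [Gp [_ px]]] := Gh _ _ hf f0.
    by exists (p M0); [exists e, p | rewrite px].
have [d [f [hf [fx f0]]]] := gclosed_hsep cS rk0 nS0.
have [h [Gh' [hd _]]] := Gh _ _ hf f0; rewrite -hd in fx.
(* A matrix of Sylvester type, of order e + d + 1: d multiples of g and e + 1 multiples of h. At M0,
   where g = 1 and h has degree exactly d, it is triangular. *)
pose r (i : nat) (M : 'M[K]_(1 + (1 + l), n.+1)) : {poly K} :=
  if (i < d)%N then 'X^i * g M else 'X^(i - d) * h M.
have Gr i : (i <= e + d)%N -> G (e + d)%N (r i).
  move=> ie; rewrite /r; case: ltnP => id; first by apply: Gle (GX _ _ i Gg) _; lia.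
  by apply: Gle (GX _ _ (i - d)%N Gh') _; lia.
exists (fun M => \det (\matrix_(i < (e + d).+1, j < (e + d).+1) (r i M)`_j)).
  apply: pf_det => i j; have [cr _] := Gr i (leq_ord i).
  by apply: pf_ext (cr j) _ => M; rewrite mxE.
split.
  rewrite det_trig.
    apply/prodf_neq0 => i _; rewrite mxE /r; case: ltnP => id.
      by rewrite g1 mulr1 coefXn eqxx oner_neq0.
    by rewrite coefXnM ltnNge leq_subr /= subKn.
  apply/is_trig_mxP => i j ij; rewrite mxE /r; case: ltnP => id.
    by rewrite g1 mulr1 coefXn gtn_eqF.
  rewrite coefXnM; case: ltnP => // _; apply: nth_default.
  case: Gh' => _ /(_ M0 rM) [sh _]; apply: leq_trans sh _; lia.
move=> M rk; rewrite /pencil_meets => pm; apply/eqP; rewrite -det_tr; apply/det0P.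
(* The kernel vector is the last unit vector if the point at infinity is in S, and the vector of
   powers of s otherwise. *)
case: pm => [S0|[s Ss]].
  exists (delta_mx 0 ord_max).
    by apply/negP => /eqP /matrixP /(_ 0 ord_max) /eqP; rewrite !mxE !eqxx oner_eq0.
  apply/rowP => i; rewrite -rowE !mxE; have [_ /(_ M rk) [_ [_ H]]] := Gr i (leq_ord i).
  exact: H.
exists (\row_j s ^+ j).
  by apply/negP => /eqP /rowP /(_ 0) /eqP; rewrite !mxE expr0 oner_eq0.
apply/rowP => i; rewrite !mxE; have [_ /(_ M rk) [sz [H _]]] := Gr i (leq_ord i).
rewrite -[RHS](H s Ss) (horner_coef_wide _ sz).
by apply: eq_bigr => j _; rewrite !mxE mulrC.
Qed.

End Elimination.

(** * Incidence geometry *)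

Ltac dlia := repeat match goal with
  | H : ?T |- _ => lazymatch type of T with
     | Prop => lazymatch T with
        | @eq ?A _ _ => tryif unify A nat then fail else clear H
        | is_true (leq _ _) => fail
        | is_true (andb (leq _ _) (leq _ _)) => fail
        | _ => clear H
        end
     | _ => fail
     end
  end; lia.

Section Subspaces.
Variables (K : closedFieldType) (n : nat).
Notation vT := 'rV[K]_n.+1.
Notation gset := ({vspace vT} -> Prop).
Implicit Types (U V W D E T a b c : {vspace vT}) (x v : vT).

Lemma vs_eqdim U V : (U <= V)%VS -> (\dim V <= \dim U)%N -> U = V.
Proof. by move=> UV VU; apply/eqP; rewrite eqEdim UV. Qed.

Lemma memv_addline D x v : reflect (exists t, v - t *: x \in D) (v \in (D + <[x]>)%VS).
Proof.
apply: (iffP memv_addP) => [[u uD [w /vlineP [t ->] ->]]|[t vD]].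
  by exists t; rewrite addrK.
by exists (v - t *: x) => //; exists (t *: x); rewrite ?subrK // memvZ ?memv_line.
Qed.

Lemma subv_addline D x U : ((D + <[x]> <= U) = (D <= U) && (x \in U))%VS.
Proof. by rewrite subv_add memvE. Qed.

Lemma addline_Z D x t : t != 0 -> (D + <[t *: x]> = D + <[x]>)%VS.
Proof.
move=> t0; apply: subv_anti; rewrite !subv_addline !addvSl /=.
rewrite memvZ /=; last by apply/memv_addline; exists 1; rewrite scale1r subrr mem0v.
by rewrite -[x in x \in _]scale1r -(mulVf t0) -scalerA memvZ //; apply/memv_addline; exists 1; rewrite scale1r subrr mem0v.
Qed.

Lemma mem_addline D x : x \in (D + <[x]>)%VS.
Proof. by apply/memv_addline; exists 1; rewrite scale1r subrr mem0v. Qed.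

Lemma addline_eq U V x : (U <= V)%VS -> x \in V -> x \notin U -> (\dim V <= (\dim U).+1)%N ->
  V = (U + <[x]>)%VS.
Proof.
by move=> UV xV xU d; apply/esym/vs_eqdim; rewrite ?dim_addl // subv_addline UV.
Qed.

Lemma addline_shift D x y : y - x \in D -> (D + <[y]> = D + <[x]>)%VS.
Proof.
move=> yx; apply: subv_anti; rewrite !subv_addline !addvSl /=; apply/andP; split.
  by apply/memv_addline; exists 1; rewrite scale1r.
by apply/memv_addline; exists 1; rewrite scale1r -memvN opprB.
Qed.

Lemma subv_exN U V : ~~ (U <= V)%VS -> exists2 x, x \in U & x \notin V.
Proof. by case/subvPn => x; exists x. Qed.

Lemma vs_between D U d : (D <= U)%VS -> (\dim D <= d <= \dim U)%N ->
  exists E, (D <= E)%VS /\ (E <= U)%VS /\ \dim E = d.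
Proof.
move=> DU /andP[]; elim: d => [|d IH] dD dU.
  by exists D; split=> //; split=> //; apply/eqP; rewrite -leqn0.
move: dD; rewrite leq_eqVlt => /orP[/eqP dD|dD]; first by exists D.
have [E [DE [EU dE]]] := IH dD (ltnW dU).
have [x xU xE] : exists2 x, x \in U & x \notin E.
  by apply: subv_exN; apply/negP => /dimvS; dlia.
exists (E + <[x]>)%VS; rewrite subv_addline EU xU dim_addl // dE; split=> //.
exact: subv_trans DE (addvSl _ _).
Qed.

Lemma vs_avoid D U x : (D <= U)%VS -> x \in U -> x \notin D ->
  exists E, (D <= E)%VS /\ (E <= U)%VS /\ x \notin E /\ U = (E + <[x]>)%VS.
Proof.
move=> DU xU xD.
have H d : (d < \dim U)%N -> (\dim D <= d)%N ->
    exists E, (D <= E)%VS /\ (E <= U)%VS /\ x \notin E /\ \dim E = d.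
  elim: d => [|d IH] dU dD.
    by exists D; split=> //; split=> //; split=> //; apply/eqP; rewrite -leqn0.
  move: dD; rewrite leq_eqVlt => /orP[/eqP dD|dD]; first by exists D.
  have [E [DE [EU [xE dE]]]] := IH (ltnW dU) dD.
  have [z zU zE] : exists2 z, z \in U & z \notin (E + <[x]>)%VS.
    by apply: subv_exN; apply/negP => /dimvS; rewrite dim_addl // dE; dlia.
  have zE' : z \notin E by apply: contra zE => /(subvP (addvSl _ _)).
  exists (E + <[z]>)%VS; rewrite subv_addline EU zU dim_addl // dE.
  split; first exact: subv_trans DE (addvSl _ _).
  split=> //; split=> //; apply: contra zE => /memv_addline [t xt].
  have t0 : t != 0 by apply: contraNneq xE => t0; rewrite t0 scale0r subr0 in xt.
  apply/memv_addline; exists t^-1.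
  by rewrite -memvN opprB -[z]scale1r -(mulVf t0) -scalerA -scalerBr memvZ.
have dDU : (\dim D < \dim U)%N.
  by have := dimvS (_ : D + <[x]> <= U)%VS; rewrite dim_addl // subv_addline DU xU; apply.
have [|E [DE [EU [xE dE]]]] := H (\dim U).-1 (ltac:(dlia)); first dlia.
by exists E; do !split => //; apply: addline_eq => //; dlia.
Qed.

(** The same pencil seen from its point at infinity: x + t y and y + t^-1 x span the same space with
    D. *)
Lemma pcl_infty k S D x y : pcl k S -> \dim D = k -> y \notin D -> ~ S (D + <[y]>)%VS ->
  cofin (fun t => x + t *: y \notin D /\ ~ S (D + <[x + t *: y]>)%VS).
Proof.
move=> pS dD yD nS; have := cofin_and (cofin_inv (pS D y x dD yD nS)) (cofin_neq 0).
apply: cofin_sub => t [[m1 m2] t0].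
have e : x + t *: y = t *: (y + t^-1 *: x).
  by rewrite scalerDr scalerA mulfV // scale1r addrC.
rewrite e addline_Z //; split=> //; apply: contra m1 => m1.
by rewrite -[_ + _]scale1r -(mulVf t0) -scalerA memvZ.
Qed.

Lemma memv_shift D x y t : x \notin D -> y \in D -> x + t *: y \notin D.
Proof. by move=> xD yD; rewrite rpredDr // memvZ. Qed.

Lemma memv_comb U x v t : x \in U -> v \in U -> x + t *: v \in U.
Proof. by move=> xU vU; rewrite memvD // memvZ. Qed.

(** * Consequences of [star] for families closed along pencils *)

Section Incidence.
Variables (h : nat) (B C : gset).
Hypothesis dB : forall b, B b -> \dim b = h.+1.
Hypothesis CE : forall c, C c <-> \dim c = h.+2 /\ exists b, B b /\ (b <= c)%VS.
Hypothesis pB : pcl h B.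
Hypothesis pC : pcl h.+1 C.
Hypothesis star : forall a c, C c -> (a <= c)%VS -> \dim a = h ->
  exists b, B b /\ (a <= b)%VS /\ (b <= c)%VS.

(** The pencil [b0, T] is parametrised with y at infinity; as y is outside C, so are all but
    finitely many members. *)
Lemma pencil_finite T y b0 : \dim T = h.+3 -> (y <= T)%VS -> \dim y = h.+2 -> ~ C y ->
  (b0 <= y)%VS -> \dim b0 = h.+1 ->
  exists ws : seq {vspace vT},
    (forall w, w \in ws -> (b0 <= w)%VS /\ (w <= T)%VS /\ \dim w = h.+2) /\
    forall w, (b0 <= w)%VS -> (w <= T)%VS -> \dim w = h.+2 -> C w -> w \in ws.
Proof.
move=> dT yT dy nCy b0y db0.
have [x xy xb0] : exists2 x, x \in y & x \notin b0.
  by apply: subv_exN; apply/negP => /dimvS; dlia.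
have yE : y = (b0 + <[x]>)%VS by apply: addline_eq => //; dlia.
have [z zT zy] : exists2 z, z \in T & z \notin y.
  by apply: subv_exN; apply/negP => /dimvS; dlia.
have TE : T = (y + <[z]>)%VS by apply: addline_eq => //; dlia.
have ztx t : z + t *: x \notin b0.
  apply: contra zy => m; rewrite -(addrK (t *: x) z) memvB ?memvZ //.
  exact: (subvP b0y).
have [s Hs] : cofin (fun t => z + t *: x \notin b0 /\ ~ C (b0 + <[z + t *: x]>)%VS).
  by apply: (pcl_infty z pC) => //; rewrite -yE.
exists [seq (b0 + <[z + t *: x]>)%VS | t <- s]; split=> [w /mapP [t _ ->]|w b0w wT dw Cw].
  rewrite addvSl subv_addline dim_addl // db0; split=> //; split=> //.
  by rewrite (subv_trans b0y) //= memvD // memvZ // (subvP yT).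
have [v vw vb0] : exists2 v, v \in w & v \notin b0.
  by apply: subv_exN; apply/negP => /dimvS; dlia.
have wE : w = (b0 + <[v]>)%VS by apply: addline_eq => //; dlia.
have /memv_addline [r] : v \in (y + <[z]>)%VS by rewrite -TE (subvP wT).
rewrite yE => /memv_addline [q vq].
have r0 : r != 0.
  apply/negP => /eqP r0; apply: nCy; suff -> : y = w by [].
  apply/esym/vs_eqdim; last by rewrite dw dy.
  rewrite wE subv_addline b0y /= yE.
  by apply/memv_addline; exists q; move: vq; rewrite r0 scale0r subr0.
have wE' : w = (b0 + <[z + (q / r) *: x]>)%VS.
  rewrite wE -(addline_Z b0 (z + _) r0); apply: addline_shift.
  by rewrite scalerDr scalerA mulrCA divff // mulr1 opprD addrA.
rewrite wE'; apply: map_f; apply: NNPP => /negP /Hs []; by rewrite -wE'.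
Qed.

(* A point c of the line joining c1 and c2 is cut by w in a pencil of
   hyperplanes of w, since no c containing e lies in w. *)
Lemma sweep_line T e c1 c2 : \dim T = h.+3 -> c1 <> c2 ->
  (e <= c1)%VS -> (c1 <= T)%VS -> \dim c1 = h.+2 ->
  (e <= c2)%VS -> (c2 <= T)%VS -> \dim c2 = h.+2 ->
  exists g : K -> {vspace vT},
    (forall t, (e <= g t)%VS /\ (g t <= T)%VS /\ \dim (g t) = h.+2) /\
    forall w, (w <= T)%VS -> \dim w = h.+2 -> ~~ (e <= w)%VS ->
      (~ B (c1 :&: w)%VS -> cofin (fun t => ~ B (g t :&: w)%VS)) /\
      (~ B (c2 :&: w)%VS -> cofin (fun t => ~ B (g t :&: w)%VS)).
Proof.
move=> dT c12 ec1 c1T dc1 ec2 c2T dc2.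
pose d := (c1 :&: c2)%VS.
have dd : \dim d = h.+1.
  have := dimv_sum_cap c1 c2; rewrite -/d dc1 dc2.
  have := dimvS (_ : c1 + c2 <= T)%VS; rewrite subv_add c1T c2T dT => /(_ isT) d1.
  have : (\dim d < h.+2)%N; last by dlia.
  rewrite ltnNge; apply/negP => d2; apply: c12.
  have e1 : d = c1 by apply: vs_eqdim; rewrite ?capvSl ?dc1.
  have e2 : d = c2 by apply: vs_eqdim; rewrite ?capvSr ?dc2.
  by rewrite -e1.
have [x1 x1c x1d] : exists2 x, x \in c1 & x \notin d.
  by apply: subv_exN; apply/negP => /dimvS; dlia.
have [x2 x2c x2d] : exists2 x, x \in c2 & x \notin d.
  by apply: subv_exN; apply/negP => /dimvS; dlia.
have x1T : x1 \in T := subvP c1T _ x1c.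
have x2T : x2 \in T := subvP c2T _ x2c.
have x1c2 : x1 \notin c2 by move: x1d; rewrite memv_cap x1c.
have x2c1 : x2 \notin c1 by move: x2d; rewrite memv_cap x2c andbT.
have xd t : x1 + t *: x2 \notin d.
  apply: contra x1c2 => m; rewrite -(addrK (t *: x2) x1) memvB ?memvZ //.
  exact: (subvP (capvSr c1 c2)).
have ed : (e <= d)%VS by rewrite subv_cap ec1.
have dT' : (d <= T)%VS := subv_trans (capvSl _ _) c1T.
exists (fun t => d + <[x1 + t *: x2]>)%VS; split=> [t|w wT dw ew].
  rewrite (subv_trans ed (addvSl _ _)) subv_addline dT' dim_addl // dd; do !split => //.
  by rewrite memv_comb.
have [z ze zw] := subv_exN ew.
have TE : T = (w + <[z]>)%VS by apply: addline_eq => //; [exact: (subvP (subv_trans ec1 c1T)) | dlia].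
have zd : z \in d := subvP ed z ze.
have [t1 y1w] : exists t, x1 - t *: z \in w by apply/memv_addline; rewrite -TE.
have [t2 y2w] : exists t, x2 - t *: z \in w by apply/memv_addline; rewrite -TE.
set y1 := _ - _ in y1w; set y2 := _ - _ in y2w.
have capE c x : (d <= c)%VS -> (c <= T)%VS -> \dim c = h.+2 -> x \in c -> x \in w -> x \notin d ->
    (c :&: w = d :&: w + <[x]>)%VS /\ \dim (d :&: w)%VS = h.
  move=> dc cT dimc xc xw xd'.
  have sw U : (d <= U)%VS -> (U <= T)%VS -> (U + w = T)%VS.
    move=> dU UT; apply: subv_anti; rewrite subv_add UT wT /= TE subv_addline addvSr /=.
    by rewrite (subvP (addvSl _ _)) // (subvP dU).
  have h1 := dimv_sum_cap d w; rewrite sw // dT dd dw in h1.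
  have h2 := dimv_sum_cap c w; rewrite sw // dT dimc dw in h2.
  split; last dlia.
  apply: addline_eq; [exact: capvS | by rewrite memv_cap xc | | dlia].
  by apply: contra xd'; apply: (subvP (capvSl _ _)).
have y1x : y1 - x1 \in d by rewrite /y1 addrC addKr memvN memvZ.
have y2x : y2 - x2 \in d by rewrite /y2 addrC addKr memvN memvZ.
have nd x y : y - x \in d -> x \notin d -> y \notin d.
  by move=> yx; apply: contra => yd; rewrite -(subKr y x) memvB.
have y1d := nd _ _ y1x x1d; have y2d := nd _ _ y2x x2d.
have y1c : y1 \in c1 by rewrite memvB // memvZ // (subvP (capvSl c1 c2)).
have y2c : y2 \in c2 by rewrite memvB // memvZ // (subvP (capvSr c1 c2)).
clearbody y1 y2.
have [e1 dD] := capE c1 y1 (capvSl _ _) c1T dc1 y1c y1w y1d.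
have [e2 _] := capE c2 y2 (capvSr _ _) c2T dc2 y2c y2w y2d.
have eg t : ((d + <[x1 + t *: x2]>) :&: w = d :&: w + <[y1 + t *: y2]>)%VS.
  have sh : (y1 + t *: y2) - (x1 + t *: x2) \in d.
    have -> : (y1 + t *: y2) - (x1 + t *: x2) = (y1 - x1) + t *: (y2 - x2).
      by rewrite scalerBr opprD addrACA.
    by rewrite memvD // memvZ.
  apply: (capE _ _ _ _ _ _ _ _).1; rewrite ?addvSl ?dim_addl ?dd //.
  - by rewrite subv_addline dT' /= memv_comb.
  - by rewrite -(addline_shift sh) mem_addline.
  - by rewrite memvD // memvZ.
  - exact: nd sh (xd t).
have nw x : x \notin d -> x \notin (d :&: w)%VS.
  by apply: contra; apply: (subvP (capvSl _ _)).
split=> nb.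
  have := pB y2 dD (nw _ y1d); rewrite -e1 => /(_ nb).
  by apply: cofin_sub => t [_]; rewrite eg.
have := pcl_infty y1 pB dD (nw _ y2d); rewrite -e2 => /(_ nb).
by apply: cofin_sub => t [_]; rewrite eg.
Qed.

(** Induction on [ws]. If the first w fails at c1 and all the others fail at c2, then by
    [sweep_line] a general point of the line through c1 and c2 fails for every w. *)
Lemma sweep_cover T e (ws : seq {vspace vT}) : \dim T = h.+3 -> (e <= T)%VS -> (\dim e <= h.+2)%N ->
  (forall w, w \in ws -> (w <= T)%VS /\ \dim w = h.+2 /\ ~~ (e <= w)%VS) ->
  (forall c, (e <= c)%VS -> (c <= T)%VS -> \dim c = h.+2 -> exists2 w, w \in ws & B (c :&: w)%VS) ->
  exists2 w, w \in ws &
    forall c, (e <= c)%VS -> (c <= T)%VS -> \dim c = h.+2 -> B (c :&: w)%VS.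
Proof.
move=> dT eT de; elim: ws => [|w ws IH] Hw cov.
  have [|c [ec [cT dc]]] := vs_between (d := h.+2) eT; first by dlia.
  by have [] := cov c ec cT dc.
case: (classic (forall c, (e <= c)%VS -> (c <= T)%VS -> \dim c = h.+2 -> B (c :&: w)%VS)) => [H|].
  by exists w; rewrite ?mem_head.
move=> H; have [c1 Hc1] := not_all_ex_not _ _ H.
have [ec1 Hc1'] := imply_to_and _ _ Hc1; have [c1T Hc1''] := imply_to_and _ _ Hc1'.
have [dc1 nB1] := imply_to_and _ _ Hc1''.
have [w' ws' Hw'] : exists2 w, w \in ws &
    forall c, (e <= c)%VS -> (c <= T)%VS -> \dim c = h.+2 -> B (c :&: w)%VS; last first.
  by exists w' => //; rewrite inE ws' orbT.
apply: IH => [w' w'ws|c2 ec2 c2T dc2]; first by apply: Hw; rewrite inE w'ws orbT.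
apply: NNPP => nc2.
have nB2 w' : w' \in ws -> ~ B (c2 :&: w')%VS by move=> w'ws Bw; apply: nc2; exists w'.
case: (classic (c1 = c2)) => [c12|c12].
  have [w'] := cov c1 ec1 c1T dc1; rewrite inE => /orP[/eqP -> //|/nB2].
  by rewrite -c12.
have [g [Hg Hgw]] := sweep_line dT c12 ec1 c1T dc1 ec2 c2T dc2.
have cf1 : cofin (fun t => ~ B (g t :&: w)%VS).
  by have [wT [dw ew]] := Hw w (mem_head _ _); have [H1 _] := Hgw w wT dw ew; apply: H1.
have cf2 : cofin (fun t => forall w', w' \in ws -> ~ B (g t :&: w')%VS).
  apply: cofin_all => w' w'ws.
  have [|wT [dw ew]] := Hw w'; first by rewrite inE w'ws orbT.
  by have [_ H2] := Hgw w' wT dw ew; apply: H2; apply: nB2.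
have [t [n1 n2]] := cofin_ex (cofin_and cf1 cf2).
have [eg [gT dg]] := Hg t; have [w'] := cov _ eg gT dg.
by rewrite inE => /orP[/eqP -> //|/n2].
Qed.

(* In the dual of T, the c containing e form a linear subspace inside C. It is
   enlarged by joining it to a point w of a fixed pencil [b0, T]: that pencil
   contains finitely many members of C, so one w serves all c. *)
Lemma vertex_descent T y e : \dim T = h.+3 -> (y <= T)%VS -> \dim y = h.+2 -> ~ C y ->
  (0 < \dim e <= h.+2)%N -> (e <= T)%VS ->
  (forall c, (e <= c)%VS -> (c <= T)%VS -> \dim c = h.+2 -> C c) ->
  exists p, p != 0 /\ p \in e /\
    forall c, p \in c -> (c <= T)%VS -> \dim c = h.+2 -> C c.
Proof.
move=> dT yT dy nCy; case/andP.
case ej : (\dim e) => [//|j] _; elim: j e ej => [|j IH] e ej eh eT eC.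
  exists (vpick e); rewrite vpick0 memv_pick; split; first by rewrite -dimv_eq0 ej.
  split=> // c pc cT dc; apply: eC => //.
  suff -> : e = <[vpick e]>%VS by rewrite -memvE.
  by apply/esym/vs_eqdim; rewrite -?memvE ?memv_pick // ej dim_vline vpick0 -dimv_eq0 ej.
have ey : ~~ (e <= y)%VS by apply/negP => ey; apply: nCy; apply: eC.
have [x xe x0] : exists2 x, x \in (e :&: y)%VS & x \notin 0%VS.
  apply: subv_exN; apply/negP => /dimvS; rewrite dimv0.
  have := dimv_sum_cap e y; have := dimvS (_ : e + y <= T)%VS.
  rewrite subv_add eT yT ej dy dT => /(_ isT); dlia.
move: xe; rewrite memv_cap => /andP[xe xy].
(* A hyperplane b0 of y that omits a vector of e; as e is not inside y, e and b0 span T. *)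
have [b0 [_ [b0y [xb0 yE]]]] := vs_avoid (sub0v y) xy x0.
have db0 : \dim b0 = h.+1 by apply: succn_inj; rewrite -dy yE dim_addl.
have eb0 : (e + b0 = T)%VS.
  apply: vs_eqdim; first by rewrite subv_add eT (subv_trans b0y).
  have [z ze zy] := subv_exN ey.
  have : (y + <[z]> <= e + b0)%VS.
    rewrite subv_addline yE subv_addline addvSr /= !(subvP (addvSl _ _)) //.
  by move/dimvS; rewrite dim_addl // dy dT.
have [ws [Hws ws_all]] := pencil_finite dT yT dy nCy b0y db0.
have Hws' w : w \in ws -> (w <= T)%VS /\ \dim w = h.+2 /\ ~~ (e <= w)%VS.
  move=> /Hws [b0w [wT dw]]; split=> //; split=> //; apply/negP => ew.
  by have := dimvS (_ : e + b0 <= w)%VS; rewrite subv_add ew b0w eb0 dT dw => /(_ isT); dlia.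
have dcap c w : (c + w = T)%VS -> \dim c = h.+2 -> \dim w = h.+2 -> \dim (c :&: w)%VS = h.+1.
  by move=> cw dc dw; have := dimv_sum_cap c w; rewrite cw dT dc dw; dlia.
have addT c w : (e <= c)%VS -> (c <= T)%VS -> (w <= T)%VS -> \dim w = h.+2 -> ~~ (e <= w)%VS ->
    (c + w = T)%VS.
  move=> ec cT wT dw ew; apply: vs_eqdim; first by rewrite subv_add cT.
  have [z ze zw] := subv_exN ew.
  have /dimvS : (w + <[z]> <= c + w)%VS.
    by rewrite subv_addline addvSr (subvP (addvSl _ _)) // (subvP ec).
  by rewrite dim_addl // dw dT.
have eh' : (\dim e <= h.+2)%N by rewrite ej.
have [] := @sweep_cover T e ws dT eT eh' Hws'.
  (* The section of c by b0 lies in some b of B inside c. Then b + b0 is in C and in the pencil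
     [b0, T], and it cuts c exactly in b. *)
  move=> c ec cT dc; have Cc := eC c ec cT dc.
  have cb0 : (c + b0 = T)%VS.
    by apply: subv_anti; rewrite subv_add cT (subv_trans b0y yT) -eb0 addvS.
  have dcb : \dim (c :&: b0)%VS = h.
    by have := dimv_sum_cap c b0; rewrite cb0 dT dc db0; dlia.
  have [b [Bb [ab bc]]] := star Cc (capvSl c b0) dcb.
  have bb0 : \dim (b :&: b0)%VS = h.
    apply/eqP; rewrite eqn_leq -{2}dcb !dimvS ?andbT //; last by rewrite subv_cap ab capvSr.
    by rewrite -dcb dimvS // capvS.
  have dw : \dim (b + b0)%VS = h.+2.
    by have := dimv_sum_cap b b0; rewrite bb0 (dB Bb) db0; dlia.
  have wT : (b + b0 <= T)%VS by rewrite subv_add (subv_trans bc cT) (subv_trans b0y yT).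
  have Cw : C (b + b0)%VS by apply/CE; split=> //; exists b; rewrite addvSl.
  have wws := ws_all _ (addvSr _ _) wT dw Cw.
  exists (b + b0)%VS => //.
  have [_ [_ ew]] := Hws' _ wws.
  suff <- : b = (c :&: (b + b0))%VS by [].
  apply: vs_eqdim; first by rewrite subv_cap bc addvSl.
  by rewrite (dB Bb) dcap // addT.
move=> w wws Bw; have [wT [dw ew]] := Hws' w wws.
(* The descent continues with e :&: w, which is one dimension smaller. *)
have de' : \dim (e :&: w)%VS = j.+1.
  by have := dimv_sum_cap e w; rewrite (addT e w) // dT ej dw; dlia.
have [|||p [p0 [pe Hp]]] := IH (e :&: w)%VS de'.
- exact: ltnW.
- exact: subv_trans (capvSl _ _) eT.
- move=> c ewc cT dc.
  case: (eqVneq c w) => [->|cw].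
    have [|c1 [ec1 [c1T dc1]]] := vs_between (d := h.+2) eT; first by rewrite ej; dlia.
    by apply/CE; split=> //; exists (c1 :&: w)%VS; split; [apply: Bw | apply: capvSr].
  have dcw : \dim (c :&: w)%VS = h.+1.
    have h1 := dimv_sum_cap c w; rewrite dc dw in h1.
    have h2 := dimvS (_ : c + w <= T)%VS; rewrite subv_add cT wT dT in h2.
    have h3 : (\dim (c :&: w)%VS < h.+2)%N.
      rewrite ltnNge; apply: contra cw => h3.
      have e1 : (c :&: w = c)%VS by apply: vs_eqdim; rewrite ?capvSl ?dc.
      have e2 : (c :&: w = w)%VS by apply: vs_eqdim; rewrite ?capvSr ?dw.
      by rewrite -e1 e2.
    by have := h2 isT; dlia.
  (* A c that contains only e :&: w is traded for (c :&: w) + e, which contains e and has the same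
     section by w. *)
  have icap : ((c :&: w) :&: e = e :&: w)%VS.
    apply: subv_anti; rewrite !subv_cap capvSl ewc capvSr !andbT.
    by rewrite capvSr /= (subv_trans (capvSl _ _) (capvSr _ _)).
  have dc' : \dim ((c :&: w) + e)%VS = h.+2.
    by have := dimv_sum_cap (c :&: w)%VS e; rewrite icap de' dcw ej; dlia.
  have c'T : ((c :&: w) + e <= T)%VS by rewrite subv_add eT (subv_trans (capvSl _ _) cT).
  have c'w := dcap _ w (addT _ _ (addvSr _ _) c'T wT dw ew) dc' dw.
  have := Bw _ (addvSr _ _) c'T dc'.
  have -> : (((c :&: w) + e) :&: w = c :&: w)%VS.
    by apply/esym/vs_eqdim; rewrite ?c'w ?dcw // subv_cap addvSl capvSr.
  by move=> Bcw; apply/CE; split=> //; exists (c :&: w)%VS; rewrite capvSl.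
by exists p; split=> //; split=> //; apply: (subvP (capvSl e w)).
Qed.

Lemma exists_vertex T y b : \dim T = h.+3 -> (y <= T)%VS -> \dim y = h.+2 -> ~ C y ->
  B b -> (b <= T)%VS ->
  exists p, p != 0 /\ p \in b /\
    forall c, p \in c -> (c <= T)%VS -> \dim c = h.+2 -> C c.
Proof.
move=> dT yT dy nCy Bb bT; apply: (vertex_descent dT yT dy nCy) => //.
  by rewrite (dB Bb) /=; dlia.
by move=> c bc cT dc; apply/CE; split=> //; exists b.
Qed.

(** Put a = b :&: y and suppose b is not in B. For each t, [star] gives a member of B of the form a
    + <z + u p + t be>. Only finitely many u occur, because u = 0 would give y, outside C; so one u
    serves infinitely many t. The limit a + <be> is then in B, which puts y in C. *)
Lemma vertex_members T y p b : \dim T = h.+3 -> (y <= T)%VS -> \dim y = h.+2 -> ~ C y ->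
  (forall c, p \in c -> (c <= T)%VS -> \dim c = h.+2 -> C c) ->
  p \in b -> (b <= T)%VS -> \dim b = h.+1 -> B b.
Proof.
move=> dT yT dy nCy Hp pb bT db; apply: NNPP => nBb.
have py : p \notin y by apply/negP => py; apply: nCy; apply: Hp.
have TE : T = (y + <[p]>)%VS by apply: addline_eq => //; [exact: (subvP bT) | dlia].
have by_T : (b + y = T)%VS.
  apply: subv_anti; rewrite subv_add bT yT /= TE subv_addline addvSr /=.
  by rewrite (subvP (addvSl _ _)).
pose a := (b :&: y)%VS.
have da : \dim a = h by have := dimv_sum_cap b y; rewrite by_T dT db dy -/a; dlia.
have pa : p \notin a by rewrite memv_cap (negPf py) andbF.
have bE : b = (a + <[p]>)%VS by apply: addline_eq; rewrite ?capvSl // db da.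
have [be bey bea] : exists2 x, x \in y & x \notin a.
  by apply: subv_exN; apply/negP => /dimvS; dlia.
have ay : (a <= y)%VS := capvSr _ _.
pose b0 := (a + <[be]>)%VS.
have db0 : \dim b0 = h.+1 by rewrite dim_addl ?da.
have b0y : (b0 <= y)%VS by rewrite subv_addline ay.
have [z zy zb0] : exists2 x, x \in y & x \notin b0.
  by apply: subv_exN; apply/negP => /dimvS; dlia.
have yE : y = (b0 + <[z]>)%VS by apply: addline_eq => //; dlia.
have zt t : z + t *: be \notin b.
  apply/negP => m.
  have : z + t *: be \in a by rewrite memv_cap m memvD // memvZ.
  by move/(subvP (addvSl _ <[be]>))=> m'; case/negP: zb0; rewrite -(addrK (t *: be) z) memvB // memvZ // mem_addline.
have [s Hs] : cofin (fun u => z + u *: p \notin b0 /\ ~ C (b0 + <[z + u *: p]>)%VS).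
  by apply: pC => //; rewrite -yE.
have key t : exists2 u, u \in s & B (a + <[(z + u *: p) + t *: be]>)%VS.
  pose c := (b + <[z + t *: be]>)%VS.
  have dc : \dim c = h.+2 by rewrite dim_addl // db.
  have cT : (c <= T)%VS by rewrite subv_addline bT (subvP yT) // memvD // memvZ.
  have Cc : C c by apply: Hp => //; apply: (subvP (addvSl _ _)).
  have ac : (a <= c)%VS := subv_trans (capvSl _ _) (addvSl _ _).
  have [b' [Bb' [ab' b'c]]] := star Cc ac da.
  have [x xb' xa] : exists2 x, x \in b' & x \notin a.
    by apply: subv_exN; apply/negP => /dimvS; rewrite da (dB Bb'); dlia.
  have b'E : b' = (a + <[x]>)%VS by apply: addline_eq => //; rewrite da (dB Bb').
  have /memv_addline [r] := subvP b'c x xb'.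
  rewrite bE => /memv_addline [q xq].
  have r0 : r != 0.
    apply/negP => /eqP r0; apply: nBb; suff -> : b = b' by [].
    rewrite bE b'E.
    have q0 : q != 0.
      by apply: contraNneq xa => q0; move: xq; rewrite r0 q0 !scale0r !subr0.
    rewrite -(addline_Z a p q0); apply/esym/addline_shift.
    by move: xq; rewrite r0 scale0r subr0.
  have b'E' : b' = (a + <[(z + (q / r) *: p) + t *: be]>)%VS.
    rewrite b'E -(addline_Z a (_ + _ + _) r0); apply: addline_shift.
    have -> : r *: (z + (q / r) *: p + t *: be) = r *: (z + t *: be) + q *: p.
      by rewrite addrAC scalerDr scalerA mulrCA divff // mulr1.
    by rewrite opprD addrA.
  exists (q / r); last by rewrite -b'E'.
  apply: NNPP => /negP /Hs [zu]; apply; apply/CE; split; first by rewrite dim_addl ?db0.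
  exists b'; split=> //; rewrite b'E' subv_addline.
  rewrite (subv_trans (addvSl _ _) (addvSl b0 _)) /=.
  rewrite memvD ?mem_addline // memvZ //; apply: (subvP (addvSl _ _)); exact: mem_addline.
have [u us nu] : exists2 u, u \in s &
    ~ cofin (fun t => ~ B (a + <[(z + u *: p) + t *: be]>)%VS).
  apply: NNPP => H.
  have /cofin_ex [t Ht] : cofin (fun t => forall u, u \in s -> ~ B (a + <[(z + u *: p) + t *: be]>)%VS).
    by apply: cofin_all => u us; apply: NNPP => nu; apply: H; exists u.
  by have [u us Bu] := key t; apply: (Ht u us).
apply: nCy; apply/CE; split=> //; exists b0; split=> //.
apply: NNPP => nB0; apply: nu.
have := pcl_infty (z + u *: p) pB da bea nB0.
by apply: cofin_sub => t [].
Qed.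

(** Induction on j, a bound for the codimension of T :&: b in b. A vector w of b outside T is moved
    to w' = w + s v, and T to T' = c0 + <w'>, which meets the moved b in one more dimension. The
    point p is still a vertex for T', since every c < T' through p, other than c0, meets c0 in a
    member of B. *)
Lemma vertex_all j T y p b : \dim T = h.+3 -> (y <= T)%VS -> \dim y = h.+2 -> ~ C y ->
  p \in T -> (forall c, p \in c -> (c <= T)%VS -> \dim c = h.+2 -> C c) ->
  p \in b -> \dim b = h.+1 -> (h.+1 <= \dim (T :&: b) + j)%N -> B b.
Proof.
elim: j T y b => [|j IH] T y b dT yT dy nCy pT Hp pb db dTb.
  have bT : (b <= T)%VS.
    apply/capv_idPr; apply: vs_eqdim; first exact: capvSr.
    by rewrite db -[X in (_ <= X)%N]addn0.
  exact: vertex_members dT yT dy nCy Hp pb bT db.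
apply: NNPP => nBb.
have [bT|] := boolP (b <= T)%VS.
  by apply: nBb; apply: vertex_members dT yT dy nCy Hp pb bT db.
move=> /subv_exN [w wb wT].
have py : p \notin y by apply/negP => py; apply: nCy; apply: Hp.
have Tbb : (\dim (T :&: b) <= h)%N.
  rewrite -ltnS -db ltn_neqAle dimvS ?capvSr // andbT; apply: contraNneq wT => e.
  have e' : (T :&: b)%VS = b by apply: vs_eqdim; rewrite ?capvSr // e.
  by apply: (subvP (capvSl T b)); rewrite e'.
have [c0 [Tbc0 [c0T dc0]]] := vs_between (d := h.+2) (capvSl T b) (ltac:(dlia)).
have pTb : p \in (T :&: b)%VS by rewrite memv_cap pT.
have pc0 : p \in c0 := subvP Tbc0 _ pTb.
have yc0 : ~~ (y <= c0)%VS.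
  apply: contra py => yc0; suff -> : y = c0 by [].
  by apply: vs_eqdim; rewrite ?dy ?dc0.
have [v vy vc0] := subv_exN yc0.
have TE : T = (c0 + <[v]>)%VS by apply: addline_eq => //; [exact: (subvP yT)| dlia].
pose d := (y :&: c0)%VS.
have dd : \dim d = h.+1.
  have e : (y + c0 = T)%VS.
    by apply: subv_anti; rewrite subv_add yT c0T /= TE subv_addline addvSr (subvP (addvSl _ _)).
  by have := dimv_sum_cap y c0; rewrite e dy dc0 dT -/d; dlia.
have vd : v \notin d by rewrite memv_cap (negPf vc0) andbF.
have yE : y = (d + <[v]>)%VS by apply: addline_eq; rewrite ?capvSl // dy dd.
have wTb : w \notin (T :&: b)%VS by rewrite memv_cap (negPf wT).
have [D [TbD [Db [wD bE]]]] := vs_avoid (capvSr T b) wb wTb.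
have dD : \dim D = h by apply: succn_inj; rewrite -db bE dim_addl.
(* For s at infinity this space is y, outside C; in [cf2], s = 0 gives b, assumed outside B. *)
have cf1 : cofin (fun s => w + s *: v \notin d /\ ~ C (d + <[w + s *: v]>)%VS).
  by apply: (pcl_infty w pC) => //; rewrite -yE.
have cf2 : cofin (fun s => w + s *: v \notin D /\ ~ B (D + <[w + s *: v]>)%VS).
  by apply: pB => //; rewrite -bE.
have [s [[wd nC'] [wD' nB']]] := cofin_ex (cofin_and cf1 cf2).
set w' := w + s *: v in wd nC' wD' nB'.
have vT' : v \in T by rewrite (subvP yT).
have w'T : w' \notin T by apply: memv_shift.
have w'c0 : w' \notin c0 by apply: contra w'T => /(subvP c0T).
pose T' := (c0 + <[w']>)%VS.
have dT' : \dim T' = h.+3 by rewrite dim_addl // dc0.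
apply: nB'; apply: (IH T' (d + <[w']>)%VS) => //.
- by rewrite subv_addline mem_addline (subv_trans (capvSr _ _) (addvSl _ _)).
- by rewrite dim_addl // dd.
- exact: (subvP (addvSl _ _)).
- move=> c pc cT' dc.
  case: (eqVneq c c0) => [->|cc0]; first by apply: Hp.
  have c0T' : (c0 <= T')%VS := addvSl _ _.
  have dcc : \dim (c :&: c0)%VS = h.+1.
    have h1 := dimv_sum_cap c c0; rewrite dc dc0 in h1.
    have h2 := dimvS (_ : c + c0 <= T')%VS; rewrite subv_add cT' c0T' dT' in h2.
    have h3 : (\dim (c :&: c0)%VS < h.+2)%N.
      rewrite ltnNge; apply: contra cc0 => h3.
      have e1 : (c :&: c0 = c)%VS by apply: vs_eqdim; rewrite ?capvSl ?dc.
      have e2 : (c :&: c0 = c0)%VS by apply: vs_eqdim; rewrite ?capvSr ?dc0.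
      by rewrite -e1 e2.
    by have := h2 isT; dlia.
  apply/CE; split=> //; exists (c :&: c0)%VS; split; last exact: capvSl.
  apply: vertex_members dT yT dy nCy Hp _ (subv_trans (capvSr _ _) c0T) dcc.
  by rewrite memv_cap pc.
- exact: (subvP (subv_trans TbD (addvSl _ _))).
- by rewrite dim_addl // dD.
have w'Tb : w' \notin (T :&: b)%VS by rewrite memv_cap (negPf w'T).
have := dimvS (_ : (T :&: b) + <[w']> <= T' :&: (D + <[w']>))%VS.
rewrite subv_addline subv_cap memv_cap !mem_addline (subv_trans Tbc0 (addvSl _ _)).
by rewrite (subv_trans TbD (addvSl _ _)) dim_addl // => /(_ isT); dlia.
Qed.

(** c0 is moved towards c1 by exchanging one vector at a time; at the first step that leaves C, the
    two consecutive spaces span T. *)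
Lemma exists_mixed c0 c1 : C c0 -> \dim c1 = h.+2 -> ~ C c1 ->
  exists T y b, [/\ \dim T = h.+3, (y <= T)%VS, \dim y = h.+2, ~ C y & B b /\ (b <= T)%VS].
Proof.
move=> + dc1 nC1.
move: {2}(h.+2 - \dim (c0 :&: c1))%N (leqnn (h.+2 - \dim (c0 :&: c1))%N) => j.
elim: j c0 => [|j IH] c0 dj C0; have [dc0 [b [Bb bc0]]] := (CE c0).1 C0.
  case: nC1; suff -> : c1 = c0 by [].
  have e1 : (c0 :&: c1 = c0)%VS by apply: vs_eqdim; rewrite ?capvSl ?dc0 //; dlia.
  by apply/esym/vs_eqdim; rewrite ?dc0 ?dc1 // -e1 capvSr.
have [w w1 w0] : exists2 w, w \in c1 & w \notin c0.
  apply: subv_exN; apply/negP => c10; apply: nC1; suff -> : c1 = c0 by [].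
  by apply: vs_eqdim; rewrite ?dc0 ?dc1.
have [v v0 v1] : exists2 v, v \in c0 & v \notin c1.
  apply: subv_exN; apply/negP => c01; apply: nC1; suff <- : c0 = c1 by [].
  by apply: vs_eqdim; rewrite ?dc0 ?dc1.
have vcap : v \notin (c0 :&: c1)%VS by rewrite memv_cap (negPf v1) andbF.
have [D [cD [Dc0 [vD c0E]]]] := vs_avoid (capvSl c0 c1) v0 vcap.
have dD : \dim D = h.+1 by apply: succn_inj; rewrite -dc0 c0E dim_addl.
have wD : w \notin D by apply: contra w0 => /(subvP Dc0).
have dc' : \dim (D + <[w]>)%VS = h.+2 by rewrite dim_addl ?dD.
case: (classic (C (D + <[w]>)%VS)) => [C'|nC'].
  apply: IH C'.
  have wc : w \notin (c0 :&: c1)%VS by rewrite memv_cap (negPf w0).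
  have := dimvS (_ : (c0 :&: c1) + <[w]> <= (D + <[w]>) :&: c1)%VS.
  rewrite subv_addline subv_cap capvSr memv_cap mem_addline w1 (subv_trans cD (addvSl _ _)).
  by rewrite dim_addl // => /(_ isT); dlia.
exists (c0 + <[w]>)%VS, (D + <[w]>)%VS, b; split=> //.
- by rewrite dim_addl // dc0.
- by rewrite subv_addline mem_addline (subv_trans Dc0 (addvSl _ _)).
- by split=> //; apply: subv_trans bc0 (addvSl _ _).
Qed.

End Incidence.
End Subspaces.

(** * Growth of functions *)

Section IntegralSpan.
Variables (K : closedFieldType) (W : Type) (IX IY : finType).
Variables (X : IX -> W -> K) (Y : IY -> W -> K) (M E : nat).

Definition gensX (g : W -> K) := exists i, g = X i.
Definition gensXY (g : W -> K) := (exists i, g = X i) \/ (exists i, g = Y i).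

Hypothesis M0 : (0 < M)%N.
Hypothesis Yint : forall i, exists G : 'I_M -> W -> K,
  (forall j, pfd gensX E (G j)) /\
  forall w, Y i w ^+ M = \sum_(j < M) G j w * Y i w ^+ j.

Definition mono (al : IX -> nat) (be : IY -> nat) (w : W) :=
  \prod_i X i w ^+ al i * \prod_i Y i w ^+ be i.

(** The X-exponents are bounded one by one and not in total, so that the monomials fill a box and
    are counted by [card_box]. *)
Inductive sp (a : nat) : (W -> K) -> Prop :=
| sp_zero : sp a (fun _ => 0)
| sp_mono c al be f : (forall i, (al i <= a)%N) -> (forall i, (be i < M)%N) ->
    sp a f -> sp a (fun w => c * mono al be w + f w)
| sp_ext f g : sp a f -> f =1 g -> sp a g.

Lemma sp_add a f g : sp a f -> sp a g -> sp a (fun w => f w + g w).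
Proof.
move=> sf sg; elim: sf => {f} [|c al be f ha hb _ IH|f f' _ IH ff'].
- by apply: sp_ext sg _ => w; rewrite add0r.
- by apply: sp_ext (sp_mono c ha hb IH) _ => w; rewrite addrA.
- by apply: sp_ext IH _ => w; rewrite ff'.
Qed.

Lemma sp_le a b f : sp a f -> (a <= b)%N -> sp b f.
Proof.
move=> sf ab; elim: sf => {f} [|c al be f ha hb _ IH|f f' _ IH ff'].
- exact: sp_zero.
- by apply: sp_mono => // i; apply: leq_trans ab.
- exact: sp_ext IH ff'.
Qed.

Lemma sp_scale a c f : sp a f -> sp a (fun w => c * f w).
Proof.
elim => {f} [|d al be f ha hb _ IH|f f' _ IH ff'].
- by apply: sp_ext (sp_zero a) _ => w; rewrite mulr0.
- by apply: sp_ext (sp_mono (c * d) ha hb IH) _ => w; rewrite mulrDr mulrA.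
- by apply: sp_ext IH _ => w; rewrite ff'.
Qed.

Lemma sp_sum a (I : Type) (r : seq I) (F : I -> W -> K) :
  (forall i, sp a (F i)) -> sp a (fun w => \sum_(i <- r) F i w).
Proof.
move=> H; elim: r => [|i r IH].
  by apply: sp_ext (sp_zero a) _ => w; rewrite big_nil.
by apply: sp_ext (sp_add (H i) IH) _ => w; rewrite big_cons.
Qed.

Lemma prod_expS (I : finType) (F : I -> K) (al : I -> nat) i :
  F i * \prod_j F j ^+ al j = \prod_j F j ^+ ((j == i) + al j)%N.
Proof.
rewrite (bigD1 i) //= [RHS](bigD1 i) //= eqxx add1n exprS -mulrA; congr (_ * (_ * _)).
by apply: eq_bigr => j /negPf ->.
Qed.

Lemma sp_mulX a i f : sp a f -> sp a.+1 (fun w => X i w * f w).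
Proof.
elim => {f} [|d al be f ha hb _ IH|f f' _ IH ff'].
- by apply: sp_ext (sp_zero _) _ => w; rewrite mulr0.
- have ha' j : (((j == i) + al j)%N <= a.+1)%N.
    by rewrite -add1n leq_add // leq_b1.
  apply: sp_ext (sp_mono d ha' hb IH) _ => w; rewrite mulrDr; congr (_ + _).
  by rewrite /mono -prod_expS; ring.
- by apply: sp_ext IH _ => w; rewrite ff'.
Qed.

Lemma sp_mulG a d f g : pfd gensX d f -> sp a g -> sp (a + d) (fun w => f w * g w).
Proof.
move=> fd; elim: fd a g => {d f} [d c|d f [i ->]|d f f' _ IH _ IH'|d e f f' _ IH _ IH'|d f f' _ IH ff'] a g sg.
- by apply: sp_scale; apply: sp_le sg (leq_addr _ _).
- by apply: sp_le (sp_mulX i sg) _; rewrite addnS ltnS leq_addr.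
- by apply: sp_ext (sp_add (IH _ _ sg) (IH' _ _ sg)) _ => w; rewrite mulrDl.
- rewrite [(d + e)%N]addnC addnA.
  by apply: sp_ext (IH _ _ (IH' _ _ sg)) _ => w; rewrite mulrA.
- by apply: sp_ext (IH _ _ sg) _ => w; rewrite ff'.
Qed.

(** When the exponent of [Y i] reaches M, the integral equation lowers it again, and its
    coefficients raise the X-exponents by at most E. *)
Lemma sp_mulY a i f : sp a f -> sp (a + E) (fun w => Y i w * f w).
Proof.
elim => {f} [|d al be f ha hb _ IH|f f' _ IH ff'].
- by apply: sp_ext (sp_zero _) _ => w; rewrite mulr0.
- suff H : sp (a + E) (fun w => Y i w * mono al be w).
    by apply: sp_ext (sp_add (sp_scale d H) IH) _ => w; rewrite mulrDr mulrCA.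
  have ha' j : (al j <= a + E)%N by apply: leq_trans (ha j) (leq_addr _ _).
  have e w : Y i w * mono al be w = mono al (fun j => (j == i) + be j)%N w.
    by rewrite /mono -prod_expS; ring.
  case: (ltnP (be i).+1 M) => bi.
    have hb' j : (((j == i) + be j)%N < M)%N by case: eqP => [->|_] //; apply: hb.
    apply: sp_ext (sp_mono 1 ha' hb' (sp_zero _)) _ => w.
    by rewrite e mul1r addr0.
  have {}bi : (be i).+1 = M by apply/eqP; rewrite eqn_leq bi andbT.
  have [G [dG HG]] := Yint i.
  pose be' (k : nat) j := if j == i then k else be j.
  have hb' (k : 'I_M) j : (be' k j < M)%N by rewrite /be'; case: eqP.
  have sk (k : 'I_M) : sp (a + E) (fun w => G k w * mono al (be' k) w).
    apply: sp_mulG (dG k) _; apply: sp_ext (sp_mono 1 ha (hb' k) (sp_zero _)) _ => w.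
    by rewrite mul1r addr0.
  apply: sp_ext (sp_sum (index_enum _) sk) _ => w.
  rewrite e /mono; rewrite [in RHS](bigD1 i) //= eqxx add1n bi HG mulr_suml mulr_sumr.
  apply: eq_bigr => k _; rewrite (bigD1 i) //= /be' eqxx.
  have -> : \prod_(j | j != i) Y j w ^+ (if j == i then (k : nat) else be j) =
            \prod_(j | j != i) Y j w ^+ ((j == i) + be j)%N.
    by apply: eq_bigr => j /negPf ->.
  by ring.
- by apply: sp_ext IH _ => w; rewrite ff'.
Qed.

Lemma sp_mulXY a d f g : pfd gensXY d f -> sp a g -> sp (a + d * E.+1) (fun w => f w * g w).
Proof.
move=> fd; elim: fd a g => {d f} [d c|d f Xf|d f f' _ IH _ IH'|d e f f' _ IH _ IH'|d f f' _ IH ff'] a g sg.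
- by apply: sp_scale; apply: sp_le sg (leq_addr _ _).
- case: Xf => [[i ->]|[i ->]].
    by apply: sp_le (sp_mulX i sg) _; rewrite mulSn; lia.
  by apply: sp_le (sp_mulY i sg) _; rewrite mulSn; lia.
- by apply: sp_ext (sp_add (IH _ _ sg) (IH' _ _ sg)) _ => w; rewrite mulrDl.
- rewrite mulnDl [(d * _ + _)%N]addnC addnA.
  by apply: sp_ext (IH _ _ (IH' _ _ sg)) _ => w; rewrite mulrA.
- by apply: sp_ext (IH _ _ sg) _ => w; rewrite ff'.
Qed.

Definition box a := ({ffun IX -> 'I_a.+1} * {ffun IY -> 'I_M})%type.
Definition box_mono a (x : box a) := mono (fun i => x.1 i : nat) (fun i => x.2 i : nat).

Lemma card_box a : #|{: box a}| = (a.+1 ^ #|IX| * M ^ #|IY|)%N.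
Proof. by rewrite card_prod !card_ffun !card_ord. Qed.

Lemma sp_coef a f : sp a f -> exists c : box a -> K, forall w, f w = \sum_x c x * box_mono x w.
Proof.
elim => {f} [|d al be f ha hb _ [c Hc]|f f' _ [c Hc] ff'].
- by exists (fun _ => 0) => w; rewrite big1 // => x _; rewrite mul0r.
- pose x0 : box a := ([ffun i => inord (al i)], [ffun i => insubd (Ordinal M0) (be i)]).
  exists (fun x => (x == x0)%:R * d + c x) => w.
  under eq_bigr do rewrite mulrDl; rewrite big_split /= -Hc; congr (_ + _).
  rewrite (bigD1 x0) //= eqxx mul1r big1 ?addr0; last by move=> x /negPf ->; rewrite !mul0r.
  congr (_ * _); rewrite /box_mono /mono; congr (_ * _); apply: eq_bigr => i _.
    by rewrite ffunE inordK // ltnS.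
  by rewrite ffunE insubdK // unfold_in.
- by exists c => w; rewrite -ff'.
Qed.

(** Each of the d factors costs at most E + 1 in the X-exponents. With [card_box], the functions of
    degree d lie in a space whose dimension is of order d^#IX. *)
Lemma span_bound d f : pfd gensXY d f ->
  exists c : box (d * E.+1) -> K, forall w, f w = \sum_x c x * box_mono x w.
Proof.
move=> fd; apply: sp_coef; rewrite -[(d * _)%N]add0n.
have s1 : sp 0 (fun _ => 1).
  apply: sp_ext (@sp_mono 0 1 (fun _ => 0%N) (fun _ => 0%N) _ _ _ (sp_zero _)) _ => // w.
  by rewrite /mono !big1 ?mulr1 ?addr0.
by apply: sp_ext (sp_mulXY fd s1) _ => w; rewrite mulr1.
Qed.

End IntegralSpan.

Section Dependence.
Variable K : closedFieldType.

(** A relation has to vanish on each piece in R, coefficient by coefficient in J: this is #|R| #|J|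
    linear equations in #|I| unknowns. The denominators [om] are nonzero and cancel. *)
Lemma dependence (Om : Type) (I R J : finType) (W : R -> Type)
    (pi : forall k, W k -> Om) (om : forall k, W k -> K) (m : forall k, J -> W k -> K)
    (l : I -> Om -> K) :
  (forall k w, om k w != 0) ->
  (forall i k, exists a : J -> K, forall w, l i (pi k w) * om k w = \sum_j a j * m k j w) ->
  (#|R| * #|J| < #|I|)%N ->
  exists c : I -> K, (exists i, c i != 0) /\
    forall k w, \sum_i c i * l i (pi k w) = 0.
Proof.
move=> om0 H RJ.
have [A HA] : exists A : I -> R -> J -> K, forall i k w,
    l i (pi k w) * om k w = \sum_j A i k j * m k j w.
  have [A HA] := fin_all_exists (fun i => fin_all_exists (H i)).
  by exists A.
pose Q : 'M[K]_(#|I|, #|{: R * J}|) :=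
  \matrix_(i, x) A (enum_val i) (enum_val x).1 (enum_val x).2.
have kQ : kermx Q != 0.
  rewrite -mxrank_eq0 mxrank_ker subn_eq0 -ltnNge; apply: leq_ltn_trans (rank_leq_col _) _.
  by rewrite card_prod.
have /rowV0Pn [v /sub_kermxP vQ v0] := kQ.
exists (fun i => v 0 (enum_rank i)); split.
  have /rV0Pn [i vi] := v0; exists (enum_val i); by rewrite enum_valK.
move=> k w; apply: (mulIf (om0 k w)); rewrite mul0r mulr_suml.
under eq_bigr do rewrite -mulrA HA mulr_sumr.
rewrite exchange_big big1 //= => j _.
under eq_bigr do rewrite mulrA; rewrite -mulr_suml.
have := vQ => /rowP /(_ (enum_rank (k, j))); rewrite !mxE => e.
rewrite (reindex_onto enum_val enum_rank) /=; last by move=> i _; rewrite enum_rankK.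
rewrite (eq_bigl xpredT) => [|i]; last by rewrite enum_valK eqxx.
by under eq_bigr do rewrite enum_valK; rewrite [X in X * _](_ : _ = 0) ?mul0r // -[RHS]e; apply: eq_bigr => i _; rewrite mxE enum_rankK.
Qed.

(** Since eD + 1 <= (e+1)D, any D above R (e+1)^r A will do. *)
Lemma poly_dominated (R A e r : nat) : exists D, (R * ((e * D).+1 ^ r * A) < D ^ r.+1)%N.
Proof.
pose D := (R * (e.+1 ^ r * A)).+1%N; exists D.
have h : ((e * D).+1 ^ r <= (e.+1 * D) ^ r)%N 
  by case: (r) => [|r']; rewrite ?expn0 // leq_exp2r // mulSn -add1n leq_add2r.
apply: (@leq_ltn_trans (R * ((e.+1 * D) ^ r * A))%N).
  by apply: leq_mul => //; apply: leq_mul.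
rewrite expnMn expnS.
have -> : (R * (e.+1 ^ r * D ^ r * A) = R * (e.+1 ^ r * A) * D ^ r)%N by ring.
by rewrite ltn_mul2r expn_gt0 /= ltnSn.
Qed.

End Dependence.

(** * Affine charts of the Grassmannian, and independent functions from chains *)

Section Chart.
Variables (K : closedFieldType) (n k m : nat).
Notation vT := 'rV[K]_n.+1.
Notation gset := ({vspace vT} -> Prop).
Variables (G : 'M[K]_(k + m, n.+1)) (G' : 'M[K]_(n.+1, k + m)).
Hypotheses (GG' : G *m G' = 1%:M) (G'G : G' *m G = 1%:M).

(** In the basis G, the chart of the complements of the span of the last m rows: each is the graph
    of a unique linear map A from the span of the first k rows. *)
Definition graph_mx (A : 'M[K]_(k, m)) : 'M[K]_(k, n.+1) := row_mx 1%:M A *m G.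
Definition graph A := rowspan (graph_mx A).

Lemma rank_graph A : \rank (graph_mx A) = k.
Proof.
apply/rank_right_inv; exists (G' *m col_mx 1%:M 0).
by rewrite /graph_mx mulmxA -(mulmxA _ G) GG' mulmx1 mul_row_col mulmx1 mulmx0 addr0 det1 oner_neq0.
Qed.

Lemma dim_graph A : \dim (graph A) = k.
Proof. by rewrite dim_rowspan rank_graph. Qed.

Let P (M : 'M[K]_(k, n.+1)) := lsubmx (M *m G').
Let Q (M : 'M[K]_(k, n.+1)) := rsubmx (M *m G').

Lemma pmx_P : pmx (@mxgen K k n.+1) P.
Proof.
move=> i j; have H : pmx (@mxgen K k n.+1) (fun M => M *m G').
  by apply: pmx_mul; [exact: pmx_id | exact: pmx_const].
by apply: pf_ext (H i (lshift m j)) _ => M; rewrite [RHS]mxE.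
Qed.

Lemma pmx_Q : pmx (@mxgen K k n.+1) Q.
Proof.
move=> i j; have H : pmx (@mxgen K k n.+1) (fun M => M *m G').
  by apply: pmx_mul; [exact: pmx_id | exact: pmx_const].
by apply: pf_ext (H i (rshift k j)) _ => M; rewrite [RHS]mxE.
Qed.

(** On the chart A = P^-1 Q. Multiplying by det(P)^d clears the denominators, because det(P) P^-1 is
    the adjugate. *)
Lemma chart_ratio d (phi : 'M[K]_(k, m) -> K) : pfd (@mxgen K k m) d phi ->
  exists2 psi, mpf psi & forall M, \det (P M) != 0 ->
    psi M = \det (P M) ^+ d * phi (invmx (P M) *m Q M).
Proof.
have dP : mpf (fun M => \det (P M)) by apply: pf_det; apply: pmx_P.
elim=> {d phi} [d c|d g [i [j ->]]|d f g _ [p pp Hp] _ [q pq Hq]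
   |d e f g _ [p pp Hp] _ [q pq Hq]|d f g _ [p pp Hp] fg].
- exists (fun M => \det (P M) ^+ d * c) => //; apply: pf_mul; [exact: pf_exp | exact: pf_const].
- exists (fun M => \det (P M) ^+ d * (\adj (P M) *m Q M) i j).
    have H : pmx (@mxgen K k n.+1) (fun M => \adj (P M) *m Q M).
      by apply: pmx_mul; [apply: pmx_adj; apply: pmx_P | exact: pmx_Q].
    by apply: pf_mul; [exact: pf_exp | exact: H].
  move=> M d0; rewrite /invmx unitmxE unitfE d0 -scalemxAl [in RHS]mxE exprS.
  by rewrite [RHS]mulrACA mulfV // mul1r.
- exists (fun M => p M + q M) => [|M d0]; first exact: pf_add.
  by rewrite Hp // Hq // mulrDr.
- exists (fun M => p M * q M) => [|M d0]; first exact: pf_mul.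
  by rewrite Hp // Hq // exprD; ring.
- by exists p => // M d0; rewrite Hp // fg.
Qed.

Lemma graph_of_mx M : \det (P M) != 0 -> rowspan M = graph (invmx (P M) *m Q M).
Proof.
move=> d0; rewrite /graph -[RHS](rowspan_mul _ d0) /graph_mx mulmxA mul_mx_row mulmx1.
have uP : P M \in unitmx by rewrite unitmxE unitfE.
by rewrite mulmxA mulmxV // mul1mx /P /Q hsubmxK -mulmxA G'G mulmx1.
Qed.

Lemma mx_of_graph M A : \rank M = k -> rowspan M = graph A ->
  \det (P M) != 0 /\ invmx (P M) *m Q M = A.
Proof.
move=> rM e.
have /submxP [X eX] : (M <= graph_mx A)%MS by rewrite -rowspan_le -/(graph A) -e subvv.
have MG : M *m G' = row_mx X (X *m A).
  by rewrite eX /graph_mx mulmxA -mulmxA GG' mulmx1 mul_mx_row mulmx1.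
have eP : P M = X by rewrite /P MG row_mxKl.
have eQ : Q M = X *m A by rewrite /Q MG row_mxKr.
have uX : X \in unitmx.
  rewrite -row_free_unit /row_free eqn_leq rank_leq_row -{1}rM eX; exact: mxrankM_maxl.
by rewrite eP eQ mulmxA mulVmx // mul1mx -unitfE -unitmxE.
Qed.

(** The zeros of phi on the chart, together with everything off the chart. The extra factor
    [\det (P M)] vanishes off the chart, even when d = 0. *)
Lemma gclosed_chart phi : pf (@mxgen K k m) phi ->
  gclosed k (fun U => \dim U = k /\ forall A, U = graph A -> phi A = 0).
Proof.
case=> d /chart_ratio [psi ppsi Hpsi]; apply/gclosedP; split=> [U []//|M rM nS].
have [A eA fA] : exists2 A, rowspan M = graph A & phi A != 0.
  apply: NNPP => H; apply: nS; split; first by rewrite dim_rowspan.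
  by move=> A eA; apply: NNPP => fA; apply: H; exists A => //; apply/eqP.
have [d0 AE] := mx_of_graph rM eA.
exists (fun M => \det (P M) * psi M).
  by apply: pf_mul => //; apply: pf_det; apply: pmx_P.
rewrite Hpsi // AE !mulf_neq0 ?expf_neq0 //; split=> // M' rM' [_ HM'].
case: (eqVneq (\det (P M')) 0) => [->|d0']; first by rewrite mul0r.
by rewrite Hpsi // HM' ?mulr0 //; apply: graph_of_mx.
Qed.

(** The coordinate ring of Y on the chart is a domain: the zero sets of phi and psi, extended by
    everything off the chart, are closed and cover Y. *)
Lemma girred_domain (Y : gset) phi psi : girred k Y -> (forall U, Y U -> \dim U = k) ->
  pf (@mxgen K k m) phi -> pf (@mxgen K k m) psi ->
  (forall A, Y (graph A) -> phi A * psi A = 0) ->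
  (forall A, Y (graph A) -> phi A = 0) \/ (forall A, Y (graph A) -> psi A = 0).
Proof.
move=> [_ iY] dY pphi ppsi H.
have [U YU|YF|YF] := iY _ _ (gclosed_chart pphi) (gclosed_chart ppsi).
- case: (classic (exists A, U = graph A)) => [[A UA]|nA]; last first.
    by left; split; [exact: dY | move=> A UA; case: nA; exists A].
  have /eqP := H A (eq_ind _ Y YU _ UA); rewrite mulf_eq0 => /orP[/eqP f0|/eqP f0].
    left; split=> [|A' UA']; first exact: dY.
    suff -> : A' = A by [].
    have e : rowspan (graph_mx A) = graph A' by rewrite -UA' UA.
    have e' : rowspan (graph_mx A) = graph A by [].
    by rewrite -(mx_of_graph (rank_graph A) e).2 (mx_of_graph (rank_graph A) e').2.
  right; split=> [|A' UA']; first exact: dY.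
  suff -> : A' = A by [].
  have e : rowspan (graph_mx A) = graph A' by rewrite -UA' UA.
  have e' : rowspan (graph_mx A) = graph A by [].
  by rewrite -(mx_of_graph (rank_graph A) e).2 (mx_of_graph (rank_graph A) e').2.
- by left => A /YF [_]; apply.
- by right => A /YF [_]; apply.
Qed.

Lemma pmx_graph : pmx (@mxgen K k m) graph_mx.
Proof.
apply: pmx_mul; last exact: pmx_const.
by apply: pmx_row; [exact: pmx_const | exact: pmx_id].
Qed.

Definition fun_indep (Y : gset) (I : finType) (l : I -> 'M[K]_(k, m) -> K) :=
  forall c : I -> K, (forall A, Y (graph A) -> \sum_i c i * l i A = 0) -> forall i, c i = 0.

(* Restricting a relation to Z kills all but the terms free of phi; these having
   zero coefficients, phi can be divided out. *)
Lemma indep_step (Z Y : gset) (I : finType) l phi (D : nat) :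
  girred k Y -> (forall U, Y U -> \dim U = k) -> (forall U, Z U -> Y U) ->
  (forall i, pf (@mxgen K k m) (l i)) -> @fun_indep Z I l ->
  pf (@mxgen K k m) phi -> (forall A, Z (graph A) -> phi A = 0) ->
  (exists2 A, Y (graph A) & phi A != 0) ->
  @fun_indep Y (I * 'I_D)%type (fun x A => l x.1 A * phi A ^+ x.2).
Proof.
move=> iY dY ZY pl ind pphi phiZ [A0 YA0 phiA0].
have key E : forall c : I -> nat -> K,
   (forall A, Y (graph A) -> \sum_(j < E) \sum_i c i j * l i A * phi A ^+ j = 0) ->
   forall i j, (j < E)%N -> c i j = 0.
  elim: E => [//|E IH] c Hc.
  have Hc' A : Y (graph A) -> (\sum_i c i 0%N * l i A) +
      phi A * (\sum_(j < E) \sum_i c i j.+1 * l i A * phi A ^+ j) = 0.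
    move=> YA; rewrite -[RHS](Hc A YA) [RHS]big_ord_recl /=; congr (_ + _).
      by apply: eq_bigr => i _; rewrite expr0 mulr1.
    rewrite mulr_sumr; apply: eq_bigr => j _; rewrite mulr_sumr.
    by apply: eq_bigr => i _; rewrite /bump /= add1n exprS; ring.
  have c0 : forall i, c i 0%N = 0.
    apply: ind => A ZA; have := Hc' A (ZY _ ZA); by rewrite phiZ // mul0r addr0.
  have [|A YA|phi0|H] := @girred_domain Y phi
     (fun A => \sum_(j < E) \sum_i c i j.+1 * l i A * phi A ^+ j) iY dY pphi.
  - apply: pf_sum => j _; apply: pf_sum => i _.
    by apply: pf_mul; [apply: pf_scale | apply: pf_exp].
  - by have := Hc' A YA; rewrite [X in X + _]big1 ?add0r // => i _; rewrite c0 mul0r.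
  - by move/eqP: phiA0; rewrite phi0.
  - move=> i [_|j jE]; first exact: c0.
    exact: (IH (fun i j => c i j.+1) H i j jE).
move=> c Hc [i j].
pose c' i (j : nat) := if insub j is Some j' then c (i, j') else 0.
have c'E i0 (j0 : 'I_D) : c' i0 j0 = c (i0, j0) by rewrite /c' valK.
rewrite -c'E; apply: (key D c') => // A YA; rewrite -[RHS](Hc A YA).
rewrite exchange_big (pair_bigA _ (fun i (j : 'I_D) => c' i j * l i A * phi A ^+ j)) /=.
by apply: eq_bigr => -[i1 j1] _; rewrite c'E /= mulrA.
Qed.

(** At each step of the chain some f vanishes on the smaller set but not on the larger; by
    [indep_step], its powers f^j with j < D multiply the number of independent functions by D while
    degrees stay linear in D. The common point [graph G A0] lets one chart serve the whole chain. *)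
Lemma chain_indep (S : gset) (c : nat -> gset) s A0 :
  (forall U, S U -> \dim U = k) ->
  (forall i, (i <= s)%N -> rel_closed k S (c i) /\ girred k (c i)) ->
  (forall i, (i < s)%N -> (forall U, c i U -> c i.+1 U) /\ exists U, c i.+1 U /\ ~ c i U) ->
  c 0%N (graph A0) ->
  exists e, forall D, exists (I : finType) (l : I -> 'M[K]_(k, m) -> K),
    #|I| = (D ^ s)%N /\ (forall i, pfd (@mxgen K k m) (e * D) (l i)) /\ fun_indep S l.
Proof.
move=> dS Hc Hi cA0.
have cS i : (i <= s)%N -> forall U, c i U -> S U.
  by move=> /Hc [[F [_ HF]] _] U /HF [].
have c0 i : (i <= s)%N -> c i (graph A0).
  by elim: i => [//|i IH] si; apply: (Hi i si).1; apply: IH; apply: ltnW.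
have [e He] : exists e, forall D, exists (I : finType) (l : I -> 'M[K]_(k, m) -> K),
    #|I| = (D ^ s)%N /\ (forall i, pfd (@mxgen K k m) (e * D) (l i)) /\ fun_indep (c s) l.
  elim: s Hc Hi cS c0 => [|s IH] Hc Hi cS c0.
    exists 0%N => D; exists unit, (fun _ _ => 1); split; first by rewrite card_unit expn0.
    split=> [i|c' Hc' []]; first exact: pfd_const.
    by have := Hc' _ (c0 0%N isT); rewrite (bigD1 tt) //= big1 ?addr0 ?mulr1 //; case.
  have [||||e He] := IH.
  - by move=> i si; apply: Hc; apply: leqW.
  - by move=> i si; apply: Hi; apply: leqW.
  - by move=> i si; apply: cS; apply: leqW.
  - by move=> i si; apply: c0; apply: leqW.
  have [[F [clF HF]] _] := Hc s (leqnSn s).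
  have [csub [U0 [U0' nU0]]] := Hi s (leqnn _).
  have [_ irr] := Hc s.+1 (leqnn _).
  have dc U : c s.+1 U -> \dim U = k by move=> /(cS s.+1 (leqnn _)) /dS.
  (* A point outside F exists on the chart: otherwise F and the complement of the chart would cover
     an irreducible set, although U0 is outside F and A0 is on the chart. *)
  have [A cA nFA] : exists2 A, c s.+1 (graph A) & ~ F (graph A).
    apply: NNPP => H.
    have coff := gclosed_chart (pf_const (@mxgen K k m) 1).
    have [_ iY] := irr; have [U cU|cF|coff'] := iY _ _ clF coff.
    - case: (classic (F U)) => [FU|nF]; [by left | right; split; first exact: dc].
      by move=> A UA; case: H; exists A; rewrite -UA.
    - by apply: nU0; apply/HF; split; [apply: cS U0' | apply: cF].
    - have [_ /(_ A0 erefl) /eqP] := coff' _ (c0 s.+1 (leqnn _)).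
      by rewrite oner_eq0.
  have [f pff [fA f0]] := gclosed_sclosed clF (rank_graph A) nFA.
  have [d pd] : pf (@mxgen K k m) (fun A => f (graph_mx A)) by apply: pf_mxcomp pff pmx_graph.
  exists (e + d)%N => D; have [I [l [cI [pl il]]]] := He D.
  exists (I * 'I_D)%type, (fun (x : I * 'I_D) A => l x.1 A * f (graph_mx A) ^+ x.2).
  split; first by rewrite card_prod cI card_ord expnSr.
  split.
    case=> i j /=; rewrite mulnDl; apply: pfd_mul (pl i) _.
    have : pfd (@mxgen K k m) (d * j) (fun A => f (graph_mx A) ^+ j).
      elim: (j : nat) => [|j' IHj]; first by rewrite muln0; apply: pfd_const.
      by rewrite mulnS; apply: pfd_ext (pfd_mul pd IHj) _ => B; rewrite exprS.
    by move/pfd_le; apply; rewrite leq_mul2l ltnW ?orbT.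
  apply: (@indep_step (c s)) => //.
  - by move=> i; exists (e * D)%N.
  - by exists d.
  - move=> B /HF [_ FB]; apply: f0 => //; exact: rank_graph.
  - by exists A.
exists e => D; have [I [l [cI [pl il]]]] := He D; exists I, l; do !split=> //.
by move=> c' Hc'; apply: il => A /(cS s (leqnn _)); apply: Hc'.
Qed.

End Chart.

(** * Dimension bounds *)

Section Meets.
Variables (K : closedFieldType) (n : nat).
Notation vT := 'rV[K]_n.+1.
Notation gset := ({vspace vT} -> Prop).

Lemma dim_line_le (v : vT) (V : {vspace vT}) : (\dim (<[v]> + V) <= (\dim V).+1)%N.
Proof.
have [vV|vV] := boolP (v \in V); last by rewrite addvC dim_addl.
by rewrite (addv_idPr _) // leqnSn.
Qed.

Lemma pencil_member l (u v : vT) (a : 'M[K]_(l, n.+1)) (b : {vspace vT}) :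
  \rank (col_mx u (col_mx v a)) = l.+2 -> \dim b = l.+1 ->
  (rowspan a <= b)%VS -> (b <= rowspan (col_mx u (col_mx v a)))%VS ->
  b = rowspan (col_mx u a) \/ exists s, b = rowspan (col_mx (s *: u + v) a).
Proof.
move=> rM db ab bM.
have da : (\dim (rowspan a) <= l)%N by rewrite dim_rowspan rank_leq_row.
have [x xb xa] : exists2 x, x \in b & x \notin rowspan a.
  by apply: subv_exN; apply/negP => /dimvS /leq_trans /(_ da); rewrite db ltnn.
have := subvP bM x xb; rewrite mem_rowspan => /submxP [w xw].
rewrite -[w]hsubmxK mul_row_col -[rsubmx w]hsubmxK mul_row_col in xw.
set y := lsubmx w in xw; set w' := rsubmx w in xw; set r := lsubmx w' in xw.
set z := rsubmx w' in xw.
rewrite (mx11_scalar y) (mx11_scalar r) !mul_scalar_mx in xw.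
have ez : z *m a \in rowspan a by rewrite mem_rowspan submxMl.
have fin q t : q != 0 -> x = q *: t + z *m a -> \rank (col_mx t a) = l.+1 ->
    b = rowspan (col_mx t a).
  move=> q0 xt rt; apply/esym/vs_eqdim; last by rewrite db dim_rowspan rt.
  rewrite [rowspan _](rowspan_col t a) rowspan1 subv_add ab andbT -memvE.
  rewrite -[t]scale1r -(mulVf q0) -scalerA memvZ //.
  by rewrite -(addrK (z *m a) (q *: t)) -xt memvB // (subvP ab).
case: (eqVneq (r 0 0) 0) => [r0|r0].
  left; apply: (fin (y 0 0)).
  - apply: contraNneq xa => y0; by rewrite xw r0 y0 !scale0r !add0r.
  - by rewrite {1}xw r0 scale0r add0r.
  - by have := rank_pencil (s := 1) (r := 0) rM; rewrite scale1r scale0r addr0 oner_neq0 => ->.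
right; exists (y 0 0 / r 0 0); apply: (fin (r 0 0)) => //.
- by rewrite {1}xw scalerDr scalerA mulrCA divff // mulr1 addrA.
- by have := rank_pencil (s := y 0 0 / r 0 0) (r := 1) rM; rewrite scale1r oner_neq0 orbT => ->.
Qed.

Lemma pencil_meetsE (S : gset) l (u v : vT) (a : 'M[K]_(l, n.+1)) :
  (forall U, S U -> \dim U = l.+1) -> \rank (col_mx u (col_mx v a)) = l.+2 ->
  pencil_meets S (col_mx u (col_mx v a)) <->
  exists b, S b /\ (rowspan a <= b)%VS /\ (b <= rowspan (col_mx u (col_mx v a)))%VS.
Proof.
move=> dS rM; rewrite /pencil_meets !(col_mxKu, col_mxKd).
have RC t : rowspan (col_mx t a) = (<[t]> + rowspan a)%VS.
  by rewrite [LHS](rowspan_col t a) rowspan1.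
have RM : rowspan (col_mx u (col_mx v a)) = (<[u]> + (<[v]> + rowspan a))%VS.
  by rewrite [LHS](rowspan_col u (col_mx v a)) rowspan1 (rowspan_col v a) rowspan1.
have av : (rowspan a <= <[u]> + (<[v]> + rowspan a))%VS.
  exact: subv_trans (addvSr _ _) (addvSr _ _).
split=> [[Sb|[s Sb]]|[b [Sb [ab bM]]]].
- exists (rowspan (col_mx u a)); split=> //; rewrite RC RM addvSr; split=> //.
  by rewrite subv_add addvSl.
- exists (rowspan (col_mx (s *: u + v) a)); split=> //; rewrite RC RM addvSr; split=> //.
  rewrite subv_add av andbT -memvE; apply: memv_add; first by rewrite memvZ ?memv_line.
  by apply: (subvP (addvSl _ _)); exact: memv_line.
have [bE|[s bE]] := pencil_member rM (dS _ Sb) ab bM.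
  by left; rewrite -bE.
by right; exists s; rewrite -bE.
Qed.

Definition meets (Z : gset) j : gset := fun U => \dim U = j /\ exists p, Z p /\ (p <= U)%VS.

Lemma col_mx3 l (M : 'M[K]_(l.+2, n.+1)) : exists (u v : vT) (a : 'M[K]_(l, n.+1)),
  M = col_mx u (col_mx v a).
Proof.
exists (usubmx (M : 'M_(1 + (1 + l), n.+1))), (usubmx (dsubmx (M : 'M_(1 + (1 + l), n.+1)))).
by exists (dsubmx (dsubmx (M : 'M_(1 + (1 + l), n.+1)))); rewrite !vsubmxK.
Qed.

(** Induction on j. If a < U has codimension 2, then U meets Z exactly when some member of the
    pencil [a, U] does, because a and a point lie in a hyperplane of U. One elimination along a
    pencil thus raises the dimension by 1. *)
Lemma meets_closed Z j : gclosed 1 Z -> gclosed j.+1 (meets Z j.+1).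
Proof.
move=> cZ; elim: j => [|j IH].
  apply: (gclosed_eq _ cZ) => U; split=> [ZU|[dU [p [Zp pU]]]].
    by split; [exact: gclosed_dim cZ ZU | exists U; rewrite subvv].
  suff <- : p = U by [].
  by apply: vs_eqdim => //; rewrite dU (gclosed_dim cZ Zp).
apply/gclosedP; split=> [U []//|].
apply: (@sclosed_eq _ _ _ (@pencil_meets K n (meets Z j.+1) j)); last exact: pencil_meets_closed.
move=> M; have [u [v [a ->]]] := col_mx3 M => rM.
rewrite pencil_meetsE //; last by move=> U [].
split=> [[b [[db [p [Zp pb]]] [ab bM]]]|[dM [p [Zp pM]]]].
  split; first by rewrite dim_rowspan.
  by exists p; split=> //; apply: subv_trans bM.
have dp := gclosed_dim cZ Zp.
have da : (\dim (rowspan a) <= j)%N by rewrite dim_rowspan rank_leq_row.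
have aM : (rowspan a <= rowspan (col_mx u (col_mx v a)))%VS.
  rewrite [X in (_ <= X)%VS](rowspan_col u (col_mx v a)) (rowspan_col v a).
  exact: subv_trans (addvSr _ _) (addvSr _ _).
have apM : (rowspan a + p <= rowspan (col_mx u (col_mx v a)))%VS by rewrite subv_add aM.
have dap : (\dim (rowspan a + p) <= j.+1)%N.
  apply: leq_trans (_ : \dim (rowspan a) + \dim p <= _)%N.
    by rewrite -dimv_sum_cap leq_addr.
  by rewrite dp addn1.
have [|b [apb [bM db]]] := vs_between (d := j.+1) apM; first by rewrite dap dM leqnSn.
exists b; split; last by split=> //; apply: subv_trans apb; apply: addvSl.
by split=> //; exists p; split=> //; apply: subv_trans apb; apply: addvSr.
Qed.

(** By [star], c is in C exactly when the pencil [a, c] meets B for any one a, so a single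
    elimination along pencils suffices. *)
Lemma containing_closed h (B : gset) : gclosed h.+1 B ->
  (forall a c, containing_family h.+1 B c -> (a <= c)%VS -> \dim a = h ->
    exists b, B b /\ (a <= b)%VS /\ (b <= c)%VS) ->
  gclosed h.+2 (containing_family h.+1 B).
Proof.
move=> cB star; apply/gclosedP; split=> [U []//|].
apply: (@sclosed_eq _ _ _ (@pencil_meets K n B h)); last exact: pencil_meets_closed.
move=> M; have [u [v [a ->]]] := col_mx3 M => rM.
rewrite pencil_meetsE //; last by move=> U; apply: gclosed_dim.
split=> [[b [Bb [ab bM]]]|CM].
  by split; [rewrite dim_rowspan | exists b].
apply: star => //.
  rewrite [X in (_ <= X)%VS](rowspan_col u (col_mx v a)) (rowspan_col v a).
  exact: subv_trans (addvSr _ _) (addvSr _ _).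
apply/eqP; rewrite eqn_leq {1}dim_rowspan rank_leq_row /=.
have := dim_rowspan (col_mx u (col_mx v a)).
rewrite rM [X in \dim X](rowspan_col u (col_mx v a)) (rowspan_col v a) !rowspan1.
move=> E; have := dim_line_le u (<[v]> + rowspan a); rewrite E ltnS => h1.
by have := leq_trans h1 (dim_line_le v (rowspan a)); rewrite ltnS.
Qed.

(** Noether normalisation. The cone over Z with vertex space [rowspan a] lies in the zeros of a form
    F that does not vanish at f. Restricted to the line y f + x E, F is a polynomial in y whose
    leading coefficient is the constant F(f, a), so y is integral over x. *)
Lemma integral_coordinate (Z : gset) r l (E : 'M[K]_(r, n.+1)) (f : vT) (a : 'M[K]_(l, n.+1)) :
  gclosed 1 Z -> \rank (col_mx f a) = l.+1 ->
  (forall p, Z p -> ~~ (p <= rowspan (col_mx f a))%VS) ->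
  exists e (G : 'I_e -> 'rV[K]_r -> K), (forall j, pf (@mxgen K 1 r) (G j)) /\
    forall (x : 'rV_r) y (z : 'rV_l), Z <[x *m E + y *: f + z *m a]>%VS ->
      y ^+ e = \sum_(j < e) G j x * y ^+ j.
Proof.
move=> cZ rk miss; have cS := meets_closed l cZ.
have nS : ~ meets Z l.+1 (rowspan (col_mx f a)).
  by move=> [_ [p [Zp pf]]]; have := miss p Zp; rewrite pf.
have [e [F [hF [F0 FS]]]] := gclosed_hsep cS rk nS.
have [p [cp [sp [Hp Tp]]]] := pfh_line hF.
exists e, (fun j x => - (F f a)^-1 * (p (col_mx f (col_mx (x *m E) a)))`_j); split=> [j|x y z Zv].
  apply: pf_scale.
  have H : pmx (@mxgen K 1 r) (fun x => col_mx f (col_mx (x *m E) a)).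
    apply: pmx_col; first exact: pmx_const.
    apply: pmx_col; last exact: pmx_const.
    by apply: pmx_mul; [exact: pmx_id | exact: pmx_const].
  exact: (pf_mxcomp (cp j) H).
pose u := y *: f + x *m E.
have za : z *m a \in rowspan a by rewrite mem_rowspan submxMl.
have ev : x *m E + y *: f + z *m a = u + z *m a by rewrite /u [x *m E + _]addrC.
rewrite ev in Zv.
have ua : u \notin rowspan a.
  apply/negP => ua; have := miss _ Zv; rewrite -memvE memvD //.
    by rewrite [rowspan _](rowspan_col f a) (subvP (addvSr _ _)).
  by rewrite [rowspan _](rowspan_col f a) (subvP (addvSr _ _)).
have ra : \dim (rowspan a) = l.
  apply/eqP; rewrite eqn_leq {1}dim_rowspan rank_leq_row /=.
  have := dim_rowspan (col_mx f a); rewrite rk [X in \dim X](rowspan_col f a) rowspan1.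
  by move=> E'; have := dim_line_le f (rowspan a); rewrite E' ltnS.
have ru : \rank (col_mx u a) = l.+1.
  by rewrite -dim_rowspan [X in \dim X](rowspan_col u a) rowspan1 addvC dim_addl // ra.
have : F u a = 0.
  apply: FS => //; split; first by rewrite dim_rowspan.
  exists <[u + z *m a]>%VS; split=> //.
  rewrite -memvE [rowspan _](rowspan_col u a) rowspan1.
  by apply: memv_add; first exact: memv_line.
rewrite (Hp _ _ _ y) (horner_coef_wide _ (sp _)) big_ord_recr /= -Tp.
move/eqP; rewrite addr_eq0 => /eqP E0.
apply: (mulfI F0); rewrite mulr_sumr -[LHS]opprK -E0 -sumrN.
by apply: eq_bigr => j _; rewrite mulrA mulrA mulrN mulfV // mulN1r mulNr.
Qed.

End Meets.

Section DimensionBound.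
Variable K : closedFieldType.

Lemma pfd_uniform (W : Type) (X : (W -> K) -> Prop) (I : finType) (F : I -> W -> K) :
  (forall i, pf X (F i)) -> exists E, forall i, pfd X E (F i).
Proof.
move=> /fin_all_exists [d Hd]; exists (\max_i d i) => i.
by apply: pfd_le (Hd i) _; apply: leq_bigmax.
Qed.

Lemma pfd_compd (W W' : Type) (X : (W -> K) -> Prop) (X' : (W' -> K) -> Prop) (phi : W -> W') d f :
  (forall g, X' g -> pfd X 1 (fun w => g (phi w))) -> pfd X' d f -> pfd X d (fun w => f (phi w)).
Proof.
move=> H; elim=> {f d} [d c|d f /H Hf|d f g _ IHf _ IHg|d e f g _ IHf _ IHg|d f g _ IHf fg].
- exact: pfd_const.
- exact: (pfd_le Hf).
- exact: pfd_add.
- exact: pfd_mul.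
- by apply: pfd_ext IHf _ => w; rewrite fg.
Qed.

Definition integral_over (W : Type) (X : (W -> K) -> Prop) (y : W -> K) :=
  exists e (G : 'I_e -> W -> K), (forall j, pf X (G j)) /\
    forall w, y w ^+ e = \sum_(j < e) G j w * y w ^+ j.

(** Multiplying an equation by a power of y moves its coefficients up, so that finitely many
    equations can be given one common degree. *)
Lemma integral_shift (W : Type) (X : (W -> K) -> Prop) (y : W -> K) :
  integral_over X y -> exists e E, forall M, (e <= M)%N ->
    exists G : 'I_M -> W -> K, (forall j, pfd X E (G j)) /\
      forall w, y w ^+ M = \sum_(j < M) G j w * y w ^+ j.
Proof.
move=> [e [G [pG HG]]]; have [E HE] := pfd_uniform pG.
exists e, E => M eM.
pose G' (j : nat) w := if insub (j - (M - e))%N is Some j' then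
  (if (M - e <= j)%N then G j' w else 0) else 0.
exists (fun j => G' j); split=> [j|w].
  rewrite /G'; case: insubP => [j' _ _|_]; last exact: pfd_const.
  by case: (_ <= _)%N; [exact: HE | exact: pfd_const].
have [d Md] : exists d, M = (d + e)%N by exists (M - e)%N; rewrite subnK.
have dM : (M - e = d)%N by rewrite Md addnK.
rewrite /G' dM Md big_split_ord /= big1 ?add0r => [|j _].
  rewrite exprD HG mulr_sumr; apply: eq_bigr => j _.
  by rewrite addKn valK leq_addr exprD; ring.
by case: insub => [j'|]; rewrite ?mul0r // leqNgt ltn_ord mul0r.
Qed.

Lemma integral_uniform (W : Type) (X : (W -> K) -> Prop) (I : finType) (Y : I -> W -> K) :
  (forall i, integral_over X (Y i)) -> exists M0 E0, forall M E, (M0 <= M)%N -> (E0 <= E)%N ->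
    forall i, exists G : 'I_M -> W -> K, (forall j, pfd X E (G j)) /\
      forall w, Y i w ^+ M = \sum_(j < M) G j w * Y i w ^+ j.
Proof.
move=> H; have /fin_all_exists [e He] := fun i => integral_shift (H i).
have [E HE] := fin_all_exists He.
exists (\max_i e i), (\max_i E i) => M E0 eM EE i.
have [|G [pG HG]] := HE i M; first by apply: leq_trans eM; apply: leq_bigmax.
exists G; split=> // j; apply: pfd_le (pG j) _; apply: leq_trans EE; exact: leq_bigmax.
Qed.

(* The D ^ s independent functions of degree O(D) would lie in a space of
   dimension O(D ^ #|IX|). *)
Lemma growth_bound (Om : Type) (X0 : (Om -> K) -> Prop) (R IX IY : finType) (W : R -> Type)
    (pi : forall k, W k -> Om) (om : forall k, W k -> K)
    (X : forall k, IX -> W k -> K) (Y : forall k, IY -> W k -> K) (c0 e s : nat) :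
  (forall k w, om k w != 0) ->
  (forall k i, integral_over (gensX (X k)) (Y k i)) ->
  (forall k d f, pfd X0 d f ->
     pfd (gensXY (X k) (Y k)) (c0 * d) (fun w => f (pi k w) * om k w ^+ d)) ->
  (forall D, exists (I : finType) (l : I -> Om -> K), #|I| = (D ^ s)%N /\
     (forall i, pfd X0 (e * D) (l i)) /\
     forall c : I -> K, (forall k w, \sum_i c i * l i (pi k w) = 0) -> forall i, c i = 0) ->
  (s <= #|IX|)%N.
Proof.
move=> om0 intY Hgen Hl; rewrite leqNgt; apply/negP => IXs.
have [M [E [M0 HM]]] : exists M E, (0 < M)%N /\ forall k i, exists G : 'I_M -> W k -> K,
    (forall j, pfd (gensX (X k)) E (G j)) /\
    forall w, Y k i w ^+ M = \sum_(j < M) G j w * Y k i w ^+ j.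
  have /fin_all_exists [M1 H1] := fun k => integral_uniform (intY k).
  have [E1 H2] := fin_all_exists H1.
  exists (\max_k M1 k).+1, (\max_k E1 k); split=> // k; apply: H2.
    by apply: leqW; apply: leq_bigmax.
  exact: leq_bigmax.
(* In degree c0 e D each piece has (c0 e (E+1) D + 1)^#IX M^#IY monomials; D is chosen so that
   D^(#IX + 1) exceeds the total over all pieces. *)
have [D HD] := poly_dominated #|R| (M ^ #|IY|) (c0 * e * E.+1) #|IX|.
have [I [l [cI [pl il]]]] := Hl D.
have D0 : (0 < D)%N by case: D HD {Hl cI pl il} => //; rewrite exp0n.
pose a := (c0 * (e * D) * E.+1)%N.
have [|||c [[i ci] Hc]] := @dependence K Om I R (box IX IY M a) W pi
   (fun k w => om k w ^+ (e * D)) (fun k x w => box_mono (X k) (Y k) x w) l.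
- by move=> k w; rewrite expf_neq0.
- by move=> i k; have [c Hc] := span_bound M0 (HM k) (Hgen k _ _ (pl i)); exists c.
- rewrite card_box cI; apply: leq_trans (_ : D ^ #|IX|.+1 <= _)%N.
    apply: leq_trans HD; rewrite ltnS leq_mul2l leq_mul2r /a.
    by rewrite (_ : c0 * (e * D) * E.+1 = c0 * e * E.+1 * D)%N ?leqnn ?orbT //; ring.
  by rewrite leq_pexp2l.
- by case/eqP: ci; apply: il.
Qed.

(** Here the whole chart serves as the only piece: an affine space with k m coordinates, without
    denominators or integral coordinates. *)
Lemma grass_chain_bound n k m (S : {vspace 'rV[K]_n.+1} -> Prop) s
    (G : 'M[K]_(k + m, n.+1)) (G' : 'M[K]_(n.+1, k + m)) A0 (c : nat -> {vspace 'rV[K]_n.+1} -> Prop) :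
  G *m G' = 1%:M -> G' *m G = 1%:M -> (forall U, S U -> \dim U = k) ->
  (forall i, (i <= s)%N -> rel_closed k S (c i) /\ girred k (c i)) ->
  (forall i, (i < s)%N -> (forall U, c i U -> c i.+1 U) /\ exists U, c i.+1 U /\ ~ c i U) ->
  c 0%N (graph G A0) -> (s <= k * m)%N.
Proof.
move=> GG' G'G dS Hc Hi cA0.
have [e He] := chain_indep GG' G'G dS Hc Hi cA0.
have -> : (k * m)%N = #|{: 'I_k * 'I_m}| by rewrite card_prod !card_ord.
apply: (@growth_bound 'M[K]_(k, m) (@mxgen K k m) unit _ void (fun=> 'M[K]_(k, m))
  (fun _ A => A) (fun _ _ => 1) (fun _ x A => A x.1 x.2) (fun _ _ _ => 0) 1 e s).
- by move=> _ _; apply: oner_neq0.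
- by move=> _ [].
- move=> _ d f pf; rewrite mul1n.
  have H : pfd (gensXY (fun (x : 'I_k * 'I_m) (A : 'M[K]_(k, m)) => A x.1 x.2) (fun (_ : void) _ => 0)) d f.
    apply: (@pfd_compd _ _ _ _ id) pf => g [i [j ->]].
    by apply: pfd_gen; left; exists (i, j).
  by apply: pfd_ext H _ => w; rewrite expr1n mulr1.
move=> D; have [I [l [cI [pl il]]]] := He D; exists I, l; do !split => //.
by move=> c' Hc'; apply: il => A _; apply: (Hc' tt A).
Qed.

End DimensionBound.

Section Bases.
Variables (K : closedFieldType) (n : nat).
Notation vT := 'rV[K]_n.+1.

Lemma complete_basis j (P : 'M[K]_(j, n.+1)) : row_free P ->
  exists l (N : 'M[K]_(l, n.+1)), (j + l = n.+1)%N /\ row_free (col_mx P N).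
Proof.
move=> /eqP fP; exists (\rank (P^C)%MS), (row_base (P^C)%MS).
have e : (j + \rank (P^C)%MS = n.+1)%N.
  by rewrite mxrank_compl fP subnKC // -{1}fP rank_leq_col.
split=> //; rewrite /row_free {2}e -addsmxE.
rewrite (adds_eqmx (eqmx_refl P) (eq_row_base _)); exact: addsmx_compl_full.
Qed.

Lemma free_inv r (G : 'M[K]_(r, n.+1)) : r = n.+1 -> row_free G ->
  exists G', G *m G' = 1%:M /\ G' *m G = 1%:M.
Proof.
move=> rn fG; have /row_freeP [G' GG'] := fG.
have /row_fullP [X XG] : row_full G by rewrite /row_full (eqP fG) rn.
by exists G'; split=> //; rewrite -[G']mul1mx -XG -mulmxA GG' mulmx1.
Qed.

Lemma row_free_dim j (M : 'M[K]_(j, n.+1)) : row_free M = (\dim (rowspan M) == j).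
Proof. by rewrite dim_rowspan. Qed.

End Bases.

(** * Hyperplanes of a fixed space as points of the dual projective space *)

Section Dual.
Variables (K : closedFieldType) (n k : nat) (io : 'M[K]_(k.+1, n.+1)).
Hypothesis fio : row_free io.
Notation gset := ({vspace 'rV[K]_n.+1} -> Prop).

Definition dual (eta : 'rV[K]_k.+1) := rowspan (kermx eta^T *m io).

Lemma dual_eq (eta : 'rV[K]_k.+1) (M : 'M[K]_(k, k.+1)) : eta != 0 -> \rank M = k ->
  M *m eta^T = 0 -> dual eta = rowspan (M *m io) /\ \rank (M *m io) = k.
Proof.
move=> e0 rM /sub_kermxP Mk; split; last by rewrite mxrankMfree.
apply/esym/rowspan_eq/eqmxMr/eqmxP.
rewrite -(mxrank_leqif_eq Mk).2 rM mxrank_ker mxrank_tr rank_rV e0 subn1 //.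
Qed.

(** A basis of the hyperplane orthogonal to eta, valid where eta_j is nonzero. It is polynomial in
    eta, as [kermx] in [dual] is not. *)
Definition minors (j : 'I_k.+1) (eta : 'rV[K]_k.+1) : 'M[K]_(k, k.+1) :=
  \matrix_(i, c) (eta 0 j * (c == lift j i)%:R - eta 0 (lift j i) * (c == j)%:R).

Lemma minorsP j (eta : 'rV[K]_k.+1) : eta 0 j != 0 -> \rank (minors j eta) = k /\ minors j eta *m eta^T = 0.
Proof.
move=> ej; split.
  apply/rank_right_inv; exists (\matrix_(c, i) (c == lift j i)%:R).
  have -> : minors j eta *m (\matrix_(c, i) (c == lift j i)%:R) = (eta 0 j)%:M.
    apply/matrixP => i i'; rewrite !mxE (bigD1 (lift j i')) //= big1 => [|c ci].
      rewrite !mxE eqxx addr0 mulr1 [lift j i' == j]eq_sym (negPf (neq_lift _ _)) mulr0 subr0.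
      by rewrite (inj_eq (lift_inj (h := j))) eq_sym; case: (i == i'); rewrite ?mulr1 ?mulr0.
    by rewrite !mxE (negPf ci) mulr0.
  by rewrite det_scalar expf_neq0.
apply/matrixP => i i'; rewrite !mxE.
rewrite (bigD1 j) //= (bigD1 (lift j i)) /=; last by rewrite eq_sym neq_lift.
rewrite big1 => [|c /andP[cj ci]]; last by rewrite !mxE (negPf cj) (negPf ci) !mulr0 subrr mul0r.
rewrite !mxE !eqxx [lift j i == j]eq_sym (negPf (neq_lift _ _)) ord1.
by rewrite addr0 !mulr0 !mulr1 sub0r subr0 mulNr mulrC addNr.
Qed.

Lemma dualZ t (eta : 'rV[K]_k.+1) : t != 0 -> dual (t *: eta) = dual eta.
Proof.
move=> t0; apply/rowspan_eq/eqmxMr/eqmxP; apply/andP; split; apply/sub_kermxP.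
  have /sub_kermxP : (kermx (t *: eta)^T <= kermx (t *: eta)^T)%MS by [].
  rewrite {2}linearZ /= -scalemxAr => /eqP; rewrite scaler_eq0 (negPf t0) => /eqP //.
have /sub_kermxP : (kermx eta^T <= kermx eta^T)%MS by [].
by move=> e; rewrite linearZ /= -scalemxAr e scaler0.
Qed.

(** All nonzero vectors of L are tested because none is singled out; by [dualZ] one of them
    decides. *)
Definition dual_set (B : gset) : {vspace 'rV[K]_k.+1} -> Prop := fun L =>
  \dim L = 1%N /\ forall eta, eta != 0 -> eta \in L -> B (dual eta).

Lemma dual_set_line (B : gset) (eta : 'rV[K]_k.+1) : eta != 0 -> dual_set B <[eta]>%VS <-> B (dual eta).
Proof.
move=> e0; split=> [[_]|Be]; first by apply; rewrite ?memv_line.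
split; first by rewrite dim_vline e0.
move=> x x0 /vlineP [t xt]; rewrite xt dualZ //.
by apply: contraNneq x0 => t0; rewrite xt t0 scale0r.
Qed.

(** Where eta_j is nonzero, the equations of B are pulled back along [minors j]; the factor eta_j
    makes the result vanish elsewhere. *)
Lemma dual_set_closed (B : gset) : gclosed k B -> gclosed 1 (dual_set B).
Proof.
move=> cB; apply/gclosedP; split=> [L []//|eta re].
have e0 : eta != 0 by apply/negP => /eqP E0; move: re; rewrite E0 mxrank0.
rewrite rowspan1 dual_set_line // => nB.
have [j ej] : exists j, eta 0 j != 0 by apply/rV0Pn.
have [rm me] := minorsP ej; have [de rk] := dual_eq e0 rm me.
rewrite de in nB.
have [f pff [f0 fB]] := gclosed_sclosed cB rk nB.
exists (fun eta => f (minors j eta *m io) * eta 0 j).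
  apply: pf_mul; last exact: pmx_id.
  apply: (pf_mxcomp pff); apply: pmx_mul; last exact: pmx_const.
  move=> i c; apply: (@pf_ext _ _ _ (fun eta : 'rV[K]_k.+1 =>
     (c == lift j i)%:R * eta 0 j + (- (c == j)%:R) * eta 0 (lift j i))).
    by apply: pf_add; apply: pf_scale; apply: pmx_id.
  by move=> x; rewrite mxE; ring.
split=> [|x rx]; first by rewrite mulf_neq0.
have x0 : x != 0 by apply/negP => /eqP E0; move: rx; rewrite E0 mxrank0.
rewrite rowspan1 dual_set_line // => Bx.
case: (eqVneq (x 0 j) 0) => [->|xj]; first by rewrite mulr0.
have [rm' me'] := minorsP xj; have [de' rk'] := dual_eq x0 rm' me'.
by rewrite fB ?mul0r // -de'.
Qed.

End Dual.

(** * A fibre with a chain of length h meets every pencil *)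

Section FibreChain.
Variables (K : closedFieldType) (n : nat).
Notation vT := 'rV[K]_n.+1.
Notation gset := ({vspace vT} -> Prop).

(** The pencil [a, c] is a line in the dual of c. If the fibre missed it, projection from this line
    would make two coordinates integral over the remaining h - 1, too few for a chain of length
    h. *)
Lemma fibre_meets_pencil h (B : gset) (a c : {vspace vT}) : gclosed h.+1 B ->
  \dim a = h -> \dim c = h.+2 -> (a <= c)%VS ->
  gchain h.+1 (fun b => B b /\ (b <= c)%VS) h ->
  exists b, B b /\ (a <= b)%VS /\ (b <= c)%VS.
Proof.
move=> cB da dc ac [ch [Hch Hst]].
have [[F0 [_ HF0]] [[U0 /HF0 [[BU0 U0c] _]] _]] := Hch 0%N (leq0n _).
have chU0 : exists U, ch 0%N U by have [_ [[U chU] _]] := Hch 0%N (leq0n _); exists U.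
(* For h = 0 the space a is zero and nonemptiness of the fibre suffices. In the other case h now
   denotes the old value minus 1, so the chain has length h + 1. *)
case: h => [|h] in cB da dc ch Hch Hst F0 HF0 BU0 U0c chU0 *.
  exists U0; split=> //; split=> //.
  by have /eqP := da; rewrite dimv_eq0 => /eqP ->; apply: sub0v.
clear U0 BU0 U0c; case: chU0 => U0 chU0; have [[BU0 U0c] _] := (HF0 U0).1 chU0.
apply: NNPP => none.
have dU0 := gclosed_dim cB BU0.
have [q qa qU0] : exists2 q, q \in a & q \notin U0.
  by apply: subv_exN; apply/negP => aU; apply: none; exists U0.
have cE : c = (U0 + <[q]>)%VS by apply: addline_eq => //; [exact: (subvP ac) | rewrite dc dU0].
pose e := (a :&: U0)%VS.
have de : \dim e = h.
  have h1 := dimv_sum_cap a U0.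
  have aU : (a + U0 = c)%VS.
    by apply: subv_anti; rewrite subv_add ac U0c cE subv_addline addvSr (subvP (addvSl _ _)).
  rewrite aU da dU0 dc -/e in h1; dlia.
have [w2 w2U w2e] : exists2 w, w \in U0 & w \notin e.
  by apply: subv_exN; apply/negP => /dimvS; rewrite de dU0; lia.
have [w1 w1U w1e] : exists2 w, w \in U0 & w \notin (e + <[w2]>)%VS.
  by apply: subv_exN; apply/negP => /dimvS; rewrite dim_addl // de dU0; lia.
have [W [eW rW]] := rowspan_exd de.
pose T : 'M[K]_(1 + (1 + h), n.+1) := col_mx w1 (col_mx w2 W).
have eT : rowspan T = U0.
  apply: vs_eqdim.
    rewrite /T [rowspan _](rowspan_col w1 (col_mx w2 W)) (rowspan_col w2 W) !rowspan1 eW.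
    by rewrite !subv_add -!memvE w1U w2U capvSr.
  rewrite /T [rowspan _](rowspan_col w1 (col_mx w2 W)) (rowspan_col w2 W) !rowspan1 eW.
  by rewrite addvC [(<[w2]> + _)%VS]addvC dim_addl // dim_addl // de dU0.
have eTq : rowspan (col_mx T q) = c by rewrite rowspan_col eT rowspan1 cE.
have fTq : row_free (col_mx T q) by rewrite row_free_dim eTq dc addn1.
have [l [N [dN fN]]] := complete_basis fTq.
pose G : 'M[K]_((1 + (1 + h)) + (1 + l), n.+1) := col_mx T (col_mx q N).
have fG : row_free G.
  have GE : rowspan G = rowspan (col_mx (col_mx T q) N) by rewrite !rowspan_col addvA.
  by rewrite row_free_dim GE; move: fN; rewrite row_free_dim => /eqP ->; rewrite -!addnA.
have [G' [GG' G'G]] : exists G', G *m G' = 1%:M /\ G' *m G = 1%:M.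
  by apply: free_inv => //; rewrite -dN addnA.
have g0 : graph G 0 = U0.
  by rewrite /graph /graph_mx /G mul_row_col mul1mx mul0mx addr0 eT.
have dS U : B U /\ (U <= c)%VS -> \dim U = (1 + (1 + h))%N by case=> /(gclosed_dim cB).
rewrite -g0 in chU0.
have [ed He] := chain_indep GG' G'G dS Hch Hst chU0.
pose io0 : 'M[K]_(1 + (1 + (1 + h)), n.+1) := col_mx q T.
pose io : 'M[K]_((1 + (1 + h)).+1, n.+1) := io0.
have eio : rowspan io = c by rewrite [LHS](rowspan_col q T) rowspan1 eT addvC cE.
have fio : row_free io by rewrite row_free_dim eio dc.
pose Z := dual_set io B.
have cZ : gclosed 1 Z by apply: dual_set_closed.
pose Wt := {y : 'rV[K]_(1 + (1 + h)) | B (graph G (row_mx (- y^T) 0))}.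
(* Normalised covectors of the hyperplanes of c that do not contain q; in the chart centred at U0
   such a hyperplane has the matrix [row_mx (- y^T) 0]. *)
pose eta (y : 'rV[K]_(1 + (1 + h))) : 'rV[K]_(1 + (1 + (1 + h))) := row_mx 1%:M y.
have eta0 y : eta y != 0.
  apply/negP => /eqP; rewrite -[0]row_mx0 => /eq_row_mx [/matrixP /(_ 0 0) /eqP].
  by rewrite !mxE eqxx oner_eq0.
have Zeta (y : Wt) : Z <[eta (sval y)]>%VS.
  apply/(dual_set_line _ _ (eta0 _)).
  have [||-> _] := @dual_eq _ _ _ io fio (eta (sval y)) (row_mx (- (sval y)^T) 1%:M) (eta0 _).
  - apply/rank_right_inv; exists (col_mx (0 : 'M_(1, _)) (1%:M : 'M[K]_(1 + (1 + h))) : 'M[K]_(1 + (1 + (1 + h)), 1 + (1 + h))).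
    have dH : \det (row_mx (- (sval y)^T) 1%:M *m col_mx (0 : 'M_(1, _)) (1%:M : 'M[K]_(1 + (1 + h)))) != 0.
      by rewrite mul_row_col mulmx0 add0r mulmx1 det1 oner_neq0.
    exact: dH.
  - have H : row_mx (- (sval y)^T) 1%:M *m (eta (sval y))^T = 0.
      by rewrite /eta tr_row_mx mul_row_col trmx1 mulmx1 mul1mx addNr.
    exact: H.
  have E : row_mx (- (sval y)^T) 1%:M *m (col_mx q T : 'M_(1 + _, _)) = graph_mx G (row_mx (- (sval y)^T) 0).
    by rewrite /graph_mx /G !mul_row_col mul0mx addr0 !mul1mx addrC.
  by have := svalP y; rewrite /graph -E.
have fin : (h.+1 <= #|'I_h|)%N; last by move: fin; rewrite card_ord ltnn.
pose X (_ : unit) (i : 'I_h) (y : Wt) := (sval y) 0 (rshift 1 (rshift 1 i)).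
pose Y (_ : unit) (b : bool) (y : Wt) :=
  if b then (sval y) 0 (lshift _ 0) else (sval y) 0 (rshift 1 (lshift _ 0)).
(* A covector of this shape kills q and e, so its hyperplane contains a: these covectors form the
   missed line. *)
have misses (eta1 : 'rV[K]_(1 + (1 + (1 + h)))) (s t : 'M[K]_1) :
    eta1 = row_mx 0 (row_mx s (row_mx t 0)) -> eta1 != 0 -> ~ B (dual io eta1).
  move=> E e0 Bd; apply: none; exists (dual io eta1); split=> //.
  have mem (v : 'rV_(1 + (1 + (1 + h)))) : v *m eta1^T = 0 -> v *m io0 \in dual io eta1.
    by move=> /sub_kermxP vk; rewrite mem_rowspan; exact: (submxMr io vk).
  split; last by rewrite -eio rowspan_le submxMl.
  have aE : a = (e + <[q]>)%VS.
    by apply: addline_eq; rewrite ?capvSl ?da ?de // memv_cap (negPf qU0) andbF.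
  rewrite aE subv_addline; apply/andP; split; last first.
    have -> : q = row_mx 1%:M 0 *m io0 by rewrite mul_row_col mul1mx mul0mx addr0.
    by apply: mem; rewrite E tr_row_mx mul_row_col mul0mx addr0 mul1mx trmx0.
  rewrite -eW; apply/subvP => v; rewrite mem_rowspan => /submxP [x ->].
  have -> : x *m W = row_mx 0 (row_mx 0 (row_mx 0 x)) *m io0.
    by rewrite !mul_row_col !mul0mx !add0r.
  apply: mem; rewrite E !tr_row_mx !mul_row_col !mul0mx !add0r trmx0 mulmx0 //.
(* v1 and v2 span the missed line and E1 spans a complement; the coordinates along v1 and v2 are the
   ones shown to be integral. *)
pose E1 : 'M[K]_(1 + h, 1 + (1 + (1 + h))) :=
  col_mx (row_mx 1%:M 0) (row_mx 0 (row_mx 0 (row_mx 0 1%:M))).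
pose v1 : 'rV[K]_(1 + (1 + (1 + h))) := row_mx 0 (row_mx 1%:M 0).
pose v2 : 'rV[K]_(1 + (1 + (1 + h))) := row_mx 0 (row_mx 0 (row_mx 1%:M 0)).
have comb (y : 'rV[K]_(1 + (1 + h))) :
   eta y = row_mx 1%:M (rsubmx (rsubmx y)) *m E1 + (y 0 (lshift _ 0)) *: v1
     + (y 0 (rshift 1 (lshift _ 0))) *: v2.
  rewrite /eta -[y in LHS]hsubmxK -[rsubmx y in LHS]hsubmxK /E1 /v1 /v2.
  rewrite mul_row_col !mul_mx_row !mulmx0 !mulmx1 !scale_row_mx !scaler0 !add_row_mx.
  rewrite !(add_row_mx, addr0, add0r); congr (row_mx _ _); congr (row_mx _ _).
    by apply/matrixP => i j; rewrite !mxE !ord1 eqxx mulr1.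
  congr (row_mx _ _); by apply/matrixP => i j; rewrite !mxE !ord1 eqxx mulr1.
have lin_zero (x y : K) : x *: v1 + y *: v2 = row_mx 0 (row_mx x%:M (row_mx y%:M 0)).
  by rewrite /v1 /v2 !scale_row_mx !scaler0 !add_row_mx !(addr0, add0r) !scalemx1.
have free12 (x y : K) : x *: v1 + y *: v2 = 0 -> x = 0 /\ y = 0.
  rewrite lin_zero => /rowP E; split.
    by have := E (rshift 1 (lshift _ 0)); rewrite row_mxEr row_mxEl !mxE eqxx mulr1n.
  by have := E (rshift 1 (rshift 1 (lshift _ 0))); rewrite !row_mxEr row_mxEl !mxE eqxx mulr1n.
have missZ (f g : 'rV[K]_(1 + (1 + (1 + h)))) p :
   (forall v, v \in rowspan (col_mx f g) -> exists x y, v = x *: v1 + y *: v2) ->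
   Z p -> ~~ (p <= rowspan (col_mx f g))%VS.
  move=> sp Zp; apply/negP => pf.
  have p0 : vpick p != 0 by rewrite vpick0 -dimv_eq0 (gclosed_dim cZ Zp).
  have [x [y E]] := sp _ (subvP pf _ (memv_pick p)).
  rewrite lin_zero in E; apply: (misses _ _ _ E p0).
  by case: Zp => _; apply; rewrite ?memv_pick.
have span12 (f g v : 'rV[K]_(1 + (1 + (1 + h)))) : v \in rowspan (col_mx f g) ->
    exists x y, v = x *: f + y *: g.
  rewrite mem_rowspan => /submxP [w ->]; rewrite -[w]hsubmxK mul_row_col.
  rewrite (mx11_scalar (lsubmx w)) (mx11_scalar (rsubmx w)) !mul_scalar_mx.
  by do 2!eexists.
have rk2 (f g : 'rV[K]_(1 + (1 + (1 + h)))) :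
    (forall x y, x *: f + y *: g = 0 -> x = 0 /\ y = 0) -> \rank (col_mx f g) = 2%N.
  move=> H; apply/eqP; change (row_free (col_mx f g)); apply/row_free0 => w.
  rewrite -[w]hsubmxK mul_row_col.
  rewrite (mx11_scalar (lsubmx w)) (mx11_scalar (rsubmx w)) !mul_scalar_mx => /H [-> ->].
  have z0 : (0 : K)%:M = 0 :> 'M_1 by apply/matrixP => i j; rewrite !mxE mul0rn.
  by rewrite !z0 row_mx0.
have pfX f : pf (@mxgen K 1 (1 + h)) f ->
    pf (gensX (X tt)) (fun y : Wt => f (row_mx 1%:M (rsubmx (rsubmx (sval y))))).
  move=> pff; apply: (pf_mxcomp pff) => i j; rewrite ord1; case: (splitP j) => j' ij.
    have -> : j = lshift h j' by apply: val_inj.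
    by apply: pf_ext (pf_const _ 1) _ => y; rewrite row_mxEl !ord1 mxE eqxx.
  have -> : j = rshift 1 j' by apply: val_inj.
  by apply: (@pf_ext _ _ _ (X tt j')); [apply: pf_gen; exists j' | move=> y; rewrite row_mxEr !mxE].
apply: (@growth_bound K 'M[K]_(1 + (1 + h), 1 + l) (@mxgen K _ _) unit _ bool (fun=> Wt)
  (fun _ y => row_mx (- (sval y)^T) 0) (fun _ _ => 1) X Y 1 ed h.+1).
- by move=> _ _; apply: oner_neq0.
- move=> [] [].
    have [||e1 [g1 [pg1 Hg1]]] := @integral_coordinate K _ Z _ 1 E1 v1 v2 cZ.
    + exact: rk2.
    + by move=> p; apply: missZ => v /span12.
    exists e1, (fun j (y : Wt) => g1 j (row_mx 1%:M (rsubmx (rsubmx (sval y))))).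
    split=> [j|y]; first exact: pfX.
    apply: (Hg1 _ _ ((sval y) 0 (rshift 1 (lshift _ 0)))%:M).
    by rewrite mul_scalar_mx -comb.
  have [||e1 [g1 [pg1 Hg1]]] := @integral_coordinate K _ Z _ 1 E1 v2 v1 cZ.
  + by apply: rk2 => x y; rewrite addrC => /free12 [].
  + by move=> p; apply: missZ => v /span12 [x [y ->]]; exists y, x; rewrite addrC.
  exists e1, (fun j (y : Wt) => g1 j (row_mx 1%:M (rsubmx (rsubmx (sval y))))).
  split=> [j|y]; first exact: pfX.
  apply: (Hg1 _ _ ((sval y) 0 (lshift _ 0))%:M).
  by rewrite mul_scalar_mx addrAC -comb.
- move=> [] d f pff; rewrite mul1n.
  have H : pfd (gensXY (X tt) (Y tt)) d (fun y : Wt => f (row_mx (- (sval y)^T) (0 : 'M_(_, l)))).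
    apply: pfd_compd pff => g [i [j ->]].
    case: (splitP j) => j' ij; last first.
      have -> : j = rshift 1 j' by apply: val_inj.
      by apply: pfd_ext (pfd_const _ 1 0) _ => y; rewrite row_mxEr mxE.
    have -> : j = lshift l j' by apply: val_inj.
    suff H : pfd (gensXY (X tt) (Y tt)) 1 (fun y : Wt => (sval y) 0 i).
      by apply: pfd_ext (pfd_scale (-1) H) _ => y; rewrite row_mxEl !mxE ord1 mulN1r.
    apply: pfd_gen; case: (splitP i) => i' ii.
      by right; exists true; rewrite /Y; have -> : i = lshift _ 0 by apply: val_inj; rewrite /= ii ord1.
    case: (splitP i') => i'' ii'.
      right; exists false; rewrite /Y.
      by have -> : i = rshift 1 (lshift _ 0) by apply: val_inj; rewrite /= ii ii' ord1.
    left; exists i''; rewrite /X.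
    by have -> : i = rshift 1 (rshift 1 i'') by apply: val_inj; rewrite /= ii ii'.
  by apply: pfd_ext H _ => y; rewrite expr1n mulr1.
move=> D; have [I [ll [cI [pl il]]]] := He D; exists I, ll; do !split => //.
move=> c' Hc'; apply: il => A [BA gA].
(* Members of the fibre lie in c, so the columns of A along the complement of c vanish. *)
have A0 : rsubmx A = 0.
  move: gA; rewrite -eTq rowspan_le => /submxP [x]; rewrite /graph_mx -[x]hsubmxK => E.
  have : row_mx 1%:M A *m G = row_mx (lsubmx x) (row_mx (rsubmx x) 0) *m G.
    by rewrite [LHS]E /G !mul_row_col mul0mx addr0.
  move/(row_free_inj fG) => /eq_row_mx [_ ->]; exact: row_mxKr.
pose y : 'rV[K]_(1 + (1 + h)) := - (lsubmx A)^T.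
have yA : row_mx (- y^T) 0 = A by rewrite /y linearN /= trmxK opprK -A0 hsubmxK.
have By : B (graph G (row_mx (- y^T) 0)) by rewrite yA.
by have := Hc' tt (exist _ y By); rewrite /= yA.
Qed.

End FibreChain.

(** * Chains of subspaces that meet Z *)

Section ConeBound.
Variables (K : closedFieldType) (n : nat).
Notation vT := 'rV[K]_n.+1.
Notation gset := ({vspace vT} -> Prop).

Lemma pfd_exp (W : Type) (X : (W -> K) -> Prop) e f j :
  pfd X e f -> pfd X (e * j) (fun w => f w ^+ j).
Proof.
move=> pff; elim: j => [|j IH]; first by rewrite muln0; apply: pfd_const.
by rewrite mulnS; apply: pfd_ext (pfd_mul pff IH) _ => w; rewrite exprS.
Qed.

Lemma split_row l (F : 'M[K]_(l, n.+1)) (i : 'I_l) :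
  exists l' (a : 'M[K]_(l', n.+1)), l = l'.+1 /\ rowspan (col_mx (row i F) a) = rowspan F /\
    forall z : 'rV_l, exists z' : 'rV_l', z *m F = z 0 i *: row i F + z' *m a.
Proof.
case: l F i => [|l] F i; first by case: i.
exists l, (row' i F); split=> //.
have H (z : 'rV_l.+1) : z *m F = z 0 i *: row i F + (col' i z) *m row' i F.
  rewrite !mulmx_sum_row (bigD1_ord i) //=; congr (_ + _); apply: eq_bigr => j _.
  by rewrite !mxE; congr (_ *: _); apply/rowP => c; rewrite !mxE.
split; last by move=> z; exists (col' i z).
rewrite rowspan_col; apply: subv_anti; rewrite subv_add !rowspan_le row_sub /=.
apply/andP; split.
  by apply/row_subP => j; rewrite (_ : row j (row' i F) = row (lift i j) F) ?row_sub //; apply/rowP => c; rewrite !mxE.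
apply/subvP => v; rewrite mem_rowspan => /submxP [z ->]; rewrite H.
by apply: memv_add; rewrite mem_rowspan ?scalemx_sub ?submxMl.
Qed.

(** Parameters of pairs of a U in S and a point of Z on U are counted. Projection from Lam makes Z
    finite over a projective space of dimension rho; a vector of U with nonzero i-th coordinate
    determines row i of the chart matrix of U from the other h rows. There remain rho + h m
    coordinates. *)
Lemma cone_chain_bound h m l rho (Z S : gset) (Lam : {vspace vT}) s :
  gclosed 1 Z -> \dim Lam = l -> (l + rho.+1 = n.+1)%N -> (h.+1 + m = n.+1)%N ->
  (forall p, Z p -> ~~ (p <= Lam)%VS) ->
  (forall U, S U -> \dim U = h.+1 /\ exists p, Z p /\ (p <= U)%VS) ->
  gchain h.+1 S s -> (s <= rho + h * m)%N.
Proof.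
move=> cZ dL el em miss HS [c [Hc Hst]].
have [[F0 [_ HF0]] [[U0 cU0] _]] := Hc 0%N (leq0n _).
have [dU0 _] := HS _ ((HF0 _).1 cU0).1.
have [T [eT rT]] := rowspan_exd dU0.
have fT : row_free T by apply/eqP.
have [m' [N [dN fG]]] := complete_basis fT.
have em' : m' = m by lia.
subst m'.
have [G' [GG' G'G]] := free_inv dN fG.
set G := col_mx T N in fG GG' G'G.
have gG' A : graph_mx G A *m G' = row_mx 1%:M A by rewrite /graph_mx -mulmxA GG' mulmx1.
have g0 : graph G 0 = U0.
  by rewrite /graph /graph_mx /G mul_row_col mul1mx mul0mx addr0 eT.
have dS U : S U -> \dim U = h.+1 by case/HS.
rewrite -g0 in cU0.
have [ed He] := chain_indep GG' G'G dS Hc Hst cU0.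
have [F [eF rF]] := rowspan_exd dL.
have fF : row_free F by apply/eqP.
have [r' [E [dE fE]]] := complete_basis fF.
have er : r' = rho.+1 by lia.
subst r'.
have [H' [HH' H'H]] := free_inv dE fE.
pose vec (w : 'M[K]_(h.+1, m) * 'rV[K]_rho.+1 * 'rV[K]_l) := w.1.2 *m E + w.2 *m F.
(* A piece is given by the row to be solved for and by the projected coordinate normalised to 1. *)
pose R := ('I_h.+1 * 'I_rho.+1)%type.
pose W (k : R) := {w : 'M[K]_(h.+1, m) * 'rV[K]_rho.+1 * 'rV[K]_l |
  [/\ Z <[vec w]>%VS, (vec w <= graph_mx G w.1.1)%MS, w.1.2 0 k.2 = 1 &
      (vec w *m G') 0 (lshift m k.1) != 0]}.
pose X (k : R) (i : 'I_rho + 'I_h * 'I_m) (w : W k) : K := match i with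
  | inl a => (sval w).1.2 0 (lift k.2 a)
  | inr bc => (sval w).1.1 (lift k.1 bc.1) bc.2 end.
pose Y (k : R) (i : 'I_l) (w : W k) : K := (sval w).2 0 i.
pose om (k : R) (w : W k) := (vec (sval w) *m G') 0 (lshift m k.1).
have cardX : (rho + h * m)%N = #|{: 'I_rho + 'I_h * 'I_m}|.
  by rewrite card_sum card_prod !card_ord.
rewrite cardX.
have xgen k j : pfd (gensX (@X k)) 1 (fun w : W k => (sval w).1.2 0 j).
  case: (unliftP k.2 j) => [a ->|->]; first by apply: pfd_gen; exists (inl a).
  by apply: pfd_ext (pfd_const _ 1 1) _ => w; have [_ _ ->] := svalP w.
have XY k d f : pfd (gensX (@X k)) d f -> pfd (gensXY (@X k) (@Y k)) d f.
  apply: (@pfd_compd _ _ _ _ _ id) => g [i ->]; by apply: pfd_gen; left; exists i.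
have lin k p (Q : 'M[K]_(n.+1, p)) j :
    pfd (gensXY (@X k) (@Y k)) 1 (fun w : W k => (vec (sval w) *m Q) 0 j).
  have h1 : pfd (gensXY (@X k) (@Y k)) 1 (fun w : W k => \sum_a (E *m Q) a j * (sval w).1.2 0 a).
    by apply: pfd_sum => a _; apply: pfd_scale; apply: XY.
  have h2 : pfd (gensXY (@X k) (@Y k)) 1 (fun w : W k => \sum_a (F *m Q) a j * (sval w).2 0 a).
    by apply: pfd_sum => a _; apply: pfd_scale; apply: pfd_gen; right; exists a.
  apply: pfd_ext (pfd_add h1 h2) _ => w.
  rewrite /vec mulmxDl -!mulmxA mxE; congr (_ + _); rewrite mxE; apply: eq_bigr => a _; exact: mulrC.
(* [om] is the coordinate by which the solved row is divided. An entry of that row times [om] has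
   degree 2 in the generators, hence the constant 2. *)
apply: (@growth_bound K 'M[K]_(h.+1, m) (@mxgen K _ _) R _ _ W (fun k w => (sval w).1.1)
  om X Y 2 ed s).
- by move=> k w; have [_ _ _] := svalP w.
- move=> k i; have [l' [a [ll [eF' HF']]]] := split_row F i.
  have rk : \rank (col_mx (row i F) a) = l'.+1 by rewrite -dim_rowspan eF' eF dL.
  have ms p : Z p -> ~~ (p <= rowspan (col_mx (row i F) a))%VS by rewrite eF' eF; apply: miss.
  have [e [g [pg Hg]]] := integral_coordinate E cZ rk ms.
  exists e, (fun j (w : W k) => g j (sval w).1.2); split=> [j|w].
    by apply: (pf_mxcomp (pg j)) => i' c'; rewrite ord1; exists 1%N; apply: xgen.
  have [z' Ez] := HF' (sval w).2; have [Zv _ _ _] := svalP w.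
  by apply: (Hg _ _ z'); rewrite -addrA -Ez.
- move=> k d f; elim=> {d f} [d c'|d g [i [j ->]]|d f g _ IHf _ IHg|d e f g _ IHf _ IHg|d f g _ IHf fg].
  + apply: pfd_scale; apply: pfd_le (pfd_exp d (lin k _ G' _)) _; by rewrite mul1n leq_pmull.
  + case: (unliftP k.1 i) => [b ->|->].
      have g1 : pfd (gensXY (@X k) (@Y k)) 1 (fun w : W k => (sval w).1.1 (lift k.1 b) j).
        by apply: pfd_gen; left; exists (inr (b, j)).
      apply: pfd_le (pfd_mul g1 (pfd_exp d.+1 (lin k _ G' _))) _; by rewrite mul1n; lia.
    have g2 : pfd (gensXY (@X k) (@Y k)) 2 (fun w : W k => (vec (sval w) *m G') 0 (rshift h.+1 j)
        + \sum_b (-1) * ((vec (sval w) *m G') 0 (lshift m (lift k.1 b)) * (sval w).1.1 (lift k.1 b) j)).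
      apply: pfd_add; first exact: pfd_le (lin k _ G' _) _.
      apply: pfd_sum => b _; apply: pfd_scale; apply: (@pfd_mul _ _ _ 1 1); first exact: lin.
      by apply: pfd_gen; left; exists (inr (b, j)).
    have g3 := pfd_mul g2 (pfd_exp d (lin k _ G' (lshift m k.1))).
    apply: pfd_ext (pfd_le g3 _) _ => [|w]; first by rewrite mul1n; lia.
    have [_ /submxP [mu Emu] _ _] := svalP w.
    have E1 : vec (sval w) *m G' = row_mx mu (mu *m (sval w).1.1).
      by rewrite Emu -mulmxA gG' mul_mx_row mulmx1.
    rewrite exprS mulrA; congr (_ * _); rewrite E1 row_mxEr mxE.
    rewrite (bigD1_ord k.1) //= -addrA -big_split /= big1 ?addr0.
      by rewrite /om E1 row_mxEl mulrC.
    by move=> b _; rewrite row_mxEl mulN1r addrN.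
  + by apply: pfd_ext (pfd_add IHf IHg) _ => w; rewrite mulrDl.
  + rewrite mulnDr; apply: pfd_ext (pfd_mul IHf IHg) _ => w; rewrite exprD; ring.
  + by apply: pfd_ext IHf _ => w; rewrite fg.
move=> D; have [I [ll [cI [pl il]]]] := He D; exists I, ll; do !split => //.
move=> c' Hc'; apply: il => A SA.
have [_ [p [Zp pA]]] := HS _ SA.
have dp := gclosed_dim cZ Zp.
pose v := vpick p.
have v0 : v != 0 by rewrite vpick0 -dimv_eq0 dp.
have pE t : t != 0 -> p = <[t *: v]>%VS.
  move=> t0; apply/esym/vs_eqdim; first by rewrite -memvE memvZ ?memv_pick.
  by rewrite dp dim_vline scaler_eq0 (negPf t0) (negPf v0).
have vE : v = rsubmx (v *m H') *m E + lsubmx (v *m H') *m F.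
  by rewrite addrC -mul_row_col hsubmxK -mulmxA H'H mulmx1.
have [j xj] : exists j, (rsubmx (v *m H')) 0 j != 0.
  apply/rV0Pn; apply: contraTneq (miss _ Zp) => x0; rewrite negbK.
  rewrite (pE 1) ?oner_neq0 // scale1r -memvE -eF mem_rowspan vE x0 mul0mx add0r; exact: submxMl.
set xj' := (rsubmx _) 0 j in xj.
have vA : (v <= graph_mx G A)%MS by rewrite -mem_rowspan; apply: (subvP pA); exact: memv_pick.
have [i li] : exists i, (v *m G') 0 (lshift m i) != 0.
  have /submxP [mu Emu] := vA.
  have E1 : v *m G' = row_mx mu (mu *m A).
    by rewrite Emu -mulmxA gG' mul_mx_row mulmx1.
  have /rV0Pn [i mi] : mu != 0 by apply: contraNneq v0 => m0; rewrite Emu m0 mul0mx.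
  by exists i; rewrite E1 row_mxEl.
pose w : 'M[K]_(h.+1, m) * 'rV[K]_rho.+1 * 'rV[K]_l :=
  (A, xj'^-1 *: rsubmx (v *m H'), xj'^-1 *: lsubmx (v *m H')).
have vw : vec w = xj'^-1 *: v by rewrite /vec /= -!scalemxAl -scalerDr -vE.
have Hw : [/\ Z <[vec w]>%VS, (vec w <= graph_mx G w.1.1)%MS, w.1.2 0 (i, j).2 = 1 &
      (vec w *m G') 0 (lshift m (i, j).1) != 0].
  rewrite vw -pE ?invr_eq0 //; split=> //; first exact: scalemx_sub.
    by rewrite /= mxE mulVf.
  by rewrite -scalemxAl mxE mulf_neq0 ?invr_eq0.
exact: (Hc' (i, j) (exist _ w Hw)).
Qed.

End ConeBound.

(** * Chains of irreducible closed sets *)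

Section Chains.
Variables (K : closedFieldType) (n : nat).
Notation vT := 'rV[K]_n.+1.
Notation gset := ({vspace vT} -> Prop).

(** Chains indexed by their largest member, for inductions that replace this member by a smaller or
    a larger set. *)
Inductive ich (k : nat) : nat -> gset -> Prop :=
| ich0 Y : gclosed k Y -> girred k Y -> ich k 0 Y
| ichS d Y Y' : gclosed k Y -> girred k Y -> ich k d Y' -> (forall U, Y' U -> Y U) ->
    (exists U, Y U /\ ~ Y' U) -> ich k d.+1 Y.

Lemma ich_gchain k d (Y S : gset) : ich k d Y -> (forall U, Y U -> S U) -> gchain k S d.
Proof.
move=> iY YS.
suff [c [Hc [Hs [_ Hsub]]]] : exists c : nat -> gset,
    (forall i, (i <= d)%N -> gclosed k (c i) /\ girred k (c i)) /\
    (forall i, (i < d)%N -> (forall U, c i U -> c i.+1 U) /\ exists U, c i.+1 U /\ ~ c i U) /\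
    c d = Y /\ forall i, (i <= d)%N -> forall U, c i U -> Y U.
  exists c; split=> // i id; have [cl ir] := Hc i id; split=> //.
  by exists (c i); split=> // U; split=> [cU|[]//]; split=> //; apply: YS; apply: Hsub cU.
elim: iY {YS} => {d Y} [Y cY iY|d Y Y' cY iY _ [c [Hc [Hs [cd Hsub]]]] Y'Y st].
  exists (fun _ => Y); do !split=> // i; by rewrite ?leqn0 ?ltn0 // => _ U.
exists (fun i => if (i <= d)%N then c i else Y); split=> [i id|].
  by case: leqP => // id'; apply: Hc.
split=> [i id|].
  rewrite -ltnS id; case: (ltnP i d) => id'; first exact: Hs.
  have -> : i = d by apply/eqP; rewrite eqn_leq -ltnS id id'.
  by rewrite cd.
split=> [|i _ U]; first by rewrite ltnn.
by case: leqP => // id' cU; apply: Y'Y; apply: (Hsub i id' U cU).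
Qed.

Lemma gchain_trunc k (S : gset) d e : gchain k S d -> (e <= d)%N -> gchain k S e.
Proof.
move=> [c [Hc Hs]] ed; exists c; split=> i ie; first by apply: Hc; apply: leq_trans ed.
by apply: Hs; apply: leq_trans ed.
Qed.

Lemma gdim_bound k (S : gset) d e : gdim k S d -> gchain k S e -> (e <= d)%N.
Proof. by move=> [_ H] ce; rewrite leqNgt; apply/negP => de; apply: H; apply: gchain_trunc de. Qed.

Lemma ich_mono k d (Y Y' : gset) : ich k d Y -> (forall U, Y U -> Y' U) ->
  gclosed k Y' -> girred k Y' -> ich k d Y'.
Proof.
case=> {d Y} [Y _ _|d Y Y1 _ _ i1 Y1Y [U [YU nU]]] YY' cY' iY'; first exact: ich0.
apply: (ichS cY' iY' i1) => [V /Y1Y /YY'//|]; by exists U; split=> //; apply: YY'.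
Qed.

(* A minimal closed set meeting all tests, given by Zorn's lemma, is irreducible. *)
Lemma minimal_closed k (Y0 : gset) (T : Type) (t0 : T) (tau : T -> gset) :
  gclosed k Y0 -> (forall t, exists U, Y0 U /\ tau t U) ->
  (forall A : gset -> Prop, (exists Y, A Y) ->
     (forall Y, A Y -> gclosed k Y /\ (forall U, Y U -> Y0 U) /\ forall t, exists U, Y U /\ tau t U) ->
     (forall Y Y', A Y -> A Y' -> (forall U, Y U -> Y' U) \/ (forall U, Y' U -> Y U)) ->
     forall t, exists U, tau t U /\ forall Y, A Y -> Y U) ->
  (forall Y1 Y2, gclosed k Y1 -> gclosed k Y2 ->
     (forall U, Y1 U -> Y0 U) -> (forall U, Y2 U -> Y0 U) ->
     (forall t, exists U, tau t U /\ (Y1 U \/ Y2 U)) ->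
     (forall t, exists U, Y1 U /\ tau t U) \/ (forall t, exists U, Y2 U /\ tau t U)) ->
  exists Y, gclosed k Y /\ girred k Y /\ (forall U, Y U -> Y0 U) /\
    forall t, exists U, Y U /\ tau t U.
Proof.
move=> cY0 mY0 compact split_.
(* [Zorn_bigcup] gives maximal sets; complements in Y0 turn them into minimal closed ones. *)
pose co (A : gset) : gset := fun U => Y0 U /\ ~ A U.
pose P (A : gset) := gclosed k (co A) /\ forall t, exists U, co A U /\ tau t U.
have [F FP Ftot|A [[cA mA] maxA]] := @classical_sets.Zorn_bigcup {vspace vT} P.
  case: (classic (exists A, F A)) => [[A0 FA0]|nF]; last first.
    have e U : Y0 U <-> co (classical_sets.bigcup F id) U.
      by split=> [YU|[]//]; split=> // -[A FA]; case: nF; exists A.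
    split; first exact: gclosed_eq e cY0.
    by move=> t; have [U [YU tU]] := mY0 t; exists U; split=> //; apply/e.
  have e U : (forall A : {A | F A}, co (sval A) U) <-> co (classical_sets.bigcup F id) U.
    split=> [H|[YU nU] [A FA]].
      split=> [|[A FA AU]]; first by have [] := H (exist _ A0 FA0).
      by have [_] := H (exist _ A FA); apply.
    by split=> // AU; apply: nU; exists A.
  split.
    apply: (gclosed_eq e); apply: (gclosed_inter (exist _ A0 FA0)) => -[A FA].
    by have [] := FP _ FA.
  move=> t; have [|||U [tU HU]] := compact (fun Y => exists A, F A /\ Y = co A) _ _ _ t.
  - by exists (co A0), A0.
  - by move=> _ [A [FA ->]]; have [] := FP _ FA; split=> //; split=> // U [].
  - move=> _ _ [A [FA ->]] [A' [FA' ->]].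
    have [AA'|A'A] := Ftot _ _ FA FA'; [right | left] => U [YU nU]; split=> // AU; apply: nU.
      exact: AA'.
    exact: A'A.
  - exists U; split=> //; apply/e => -[A FA]; apply: HU; by exists A.
exists (co A); split=> //; split; last by split=> // U [].
have minA Y : gclosed k Y -> (forall U, Y U -> co A U) -> (forall t, exists U, Y U /\ tau t U) ->
    forall U, co A U -> Y U.
  move=> cY YA mY U AU; apply: NNPP => nYU.
  have e V : Y V <-> co (fun V => ~ Y V) V.
    split=> [YV|[_ nn]]; last exact: NNPP.
    by split=> [|]; [have [] := YA V YV | apply].
  apply: (maxA (fun V => ~ Y V)).
    split=> [V AV YV|H]; first by have [_] := YA V YV; apply.
    by have [_ nA] := AU; apply: nA; apply: H.
  split; first exact: gclosed_eq e cY.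
  by move=> t; have [V [YV tV]] := mY t; exists V; split=> //; apply/e.
split; first by have [U [AU _]] := mA t0; exists U.
move=> F1 F2 cF1 cF2 cov.
have [|||H|H] := split_ (fun U => co A U /\ F1 U) (fun U => co A U /\ F2 U)
   (gclosed_and cA cF1) (gclosed_and cA cF2).
- by move=> U [[]].
- by move=> U [[]].
- move=> t; have [U [AU tU]] := mA t; exists U; split=> //.
  by have [FU|FU] := cov U AU; [left | right].
- left=> U AU; have YA V : co A V /\ F1 V -> co A V by case.
  by have [_] := minA _ (gclosed_and cA cF1) YA H U AU.
- right=> U AU; have YA V : co A V /\ F2 V -> co A V by case.
  by have [_] := minA _ (gclosed_and cA cF2) YA H U AU.
Qed.

(** Compactness of one test set. If some Y1 meets it in a finite list, the points of the list are
    discarded one by one, keeping each time the smaller of two comparable sets; discarding all would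
    leave a Y that misses the test set. *)
Lemma chain_point (T : eqType) (A : (T -> Prop) -> Prop) (tau : T -> Prop) :
  (exists Y, A Y) -> (forall Y, A Y -> exists U, Y U /\ tau U) ->
  (forall Y Y', A Y -> A Y' -> (forall U, Y U -> Y' U) \/ (forall U, Y' U -> Y U)) ->
  (forall Y, A Y -> (forall U, tau U -> Y U) \/
     exists l : seq T, forall U, Y U -> tau U -> U \in l) ->
  exists U, tau U /\ forall Y, A Y -> Y U.
Proof.
move=> [Y0 AY0] mA tot fin.
case: (classic (forall Y, A Y -> forall U, tau U -> Y U)) => [H|].
  by have [U [_ tU]] := mA Y0 AY0; exists U; split=> // Y AY; apply: H.
move=> H; have [Y1 H1] := not_all_ex_not _ _ H; have [AY1 nY1] := imply_to_and _ _ H1.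
have [//|[l Hl]] := fin Y1 AY1.
apply: NNPP => none.
suff [Y [AY [YY1 nY]]] : exists Y, A Y /\ (forall U, Y U -> Y1 U) /\
    forall U, U \in l -> tau U -> ~ Y U.
  by have [U [YU tU]] := mA Y AY; apply: (nY U _ tU YU); apply: Hl => //; apply: YY1.
elim: l {Hl} => [|V l [Y [AY [YY1 nY]]]]; first by exists Y1.
case: (classic (tau V)) => [tV|ntV]; last first.
  exists Y; split=> //; split=> // U; rewrite inE => /orP[/eqP ->//|]; exact: nY.
have [Y2 [AY2 nY2]] : exists Y2, A Y2 /\ ~ Y2 V.
  apply: NNPP => H2; apply: none; exists V; split=> // Y2 AY2.
  by apply: NNPP => nV; apply: H2; exists Y2.
have [YY2|Y2Y] := tot Y Y2 AY AY2.
  exists Y; split=> //; split=> // U; rewrite inE => /orP[/eqP -> _ /YY2//|]; exact: nY.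
exists Y2; split=> //; split=> [U /Y2Y /YY1//|U].
by rewrite inE => /orP[/eqP ->//|Ul tU /Y2Y]; apply: nY.
Qed.

(** The set x + c is the complement of the hyperplane at infinity c, which Z misses. By induction on
    the dimension of c: the slice at infinity D + <y> = c is missed, so only finitely many slices x
    + t y + D meet Z. *)
Lemma finite_section (Z : gset) (c : {vspace vT}) x : gclosed 1 Z ->
  (forall p, Z p -> ~~ (p <= c)%VS) -> x \notin c ->
  exists l : seq vT, forall d, d \in c -> Z <[x + d]>%VS -> d \in l.
Proof.
move=> cZ; move dc : (\dim c) => d; elim: d c dc x => [|d IH] c dc x miss xc.
  exists [:: 0] => v; have /eqP := dc; rewrite dimv_eq0 => /eqP ->.
  by rewrite memv0 inE.
have [y yc y0] : exists2 y, y \in c & y \notin 0%VS.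
  by apply: subv_exN; apply/negP => /dimvS; rewrite dc dimv0.
have [D [_ [Dc [yD cE]]]] := vs_avoid (sub0v c) yc y0.
have dD : \dim D = d by apply: succn_inj; rewrite -dc cE dim_addl.
have nS : ~ meets Z d.+1 (D + <[y]>)%VS.
  by rewrite -cE => -[_ [p [Zp pc]]]; have := miss p Zp; rewrite pc.
have [s Hs] := pcl_infty x (gclosed_pcl (meets_closed d cZ)) dD yD nS.
have missD p : Z p -> ~~ (p <= D)%VS by move=> /miss; apply: contra => /subv_trans; apply.
have [L HL] : exists L : seq vT, forall t, t \in s -> forall v, v \in D ->
    Z <[x + t *: y + v]>%VS -> t *: y + v \in L.
  elim: (s) => [|t s' [L HL]]; first by exists [::].
  have xtD : x + t *: y \notin D.
    by apply: contra xc => m; rewrite -(addrK (t *: y) x) memvB ?memvZ // (subvP Dc).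
  have [l Hl] := IH D dD _ missD xtD.
  exists ([seq t *: y + v | v <- l] ++ L) => t'; rewrite inE => /orP[/eqP ->|t's] v vD Zv.
    by rewrite mem_cat map_f //; apply: Hl.
  by rewrite mem_cat HL ?orbT.
exists L => v; rewrite {1}cE => /memv_addline [t vt] Zv.
have e : v = t *: y + (v - t *: y) by rewrite addrC subrK.
rewrite e; apply: HL => //; last by rewrite -addrA -e.
apply: NNPP => /negP /Hs [xtD]; apply; split; first by rewrite dim_addl ?dD.
exists <[x + v]>%VS; split=> //; rewrite -memvE; apply/memv_addline; exists 1.
by rewrite scale1r opprD addrACA subrr add0r.
Qed.

Lemma gclosed_sub1 (M : {vspace vT}) : gclosed 1 (fun p => \dim p = 1%N /\ (p <= M)%VS).
Proof.
have [A [eA _]] := @rowspan_exd _ _ (\dim M) M erefl; move: (\dim M) A eA => r A eA; apply/gclosedP; split=> [p []//|v rv nv].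
have nvA : v *m cokermx A != 0.
  by rewrite -submxE -rowspan_le eA; apply/negP => vM; apply: nv; rewrite dim_rowspan.
have [j vj] : exists j, (v *m cokermx A) 0 j != 0 by apply/rV0Pn.
exists (fun v => (v *m cokermx A) 0 j).
  have H : pmx (@mxgen K 1 n.+1) (fun v => v *m cokermx A).
    by apply: pmx_mul; [exact: pmx_id | exact: pmx_const].
  exact: H.
split=> // w _ [_]; rewrite -eA rowspan_le submxE => /eqP ->; by rewrite mxE.
Qed.

Lemma vline_pick (p : {vspace vT}) : \dim p = 1%N -> p = <[vpick p]>%VS /\ vpick p != 0.
Proof.
move=> dp; have v0 : vpick p != 0 by rewrite vpick0 -dimv_eq0 dp.
split=> //; apply/esym/vs_eqdim; first by rewrite -memvE memv_pick.
by rewrite dp dim_vline v0.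
Qed.

Lemma line_scale (v : vT) t : t != 0 -> <[t *: v]>%VS = <[v]>%VS.
Proof. by move=> t0; rewrite -[LHS]add0v -[RHS]add0v addline_Z. Qed.

(** By hypothesis Y projects from La onto the projective space of M modulo La, of dimension N.
    Replacing M by a hyperplane M', and Y by a minimal closed part over M' that still projects onto
    it, lowers N by 1. *)
Lemma section_chain (Z : gset) (La : {vspace vT}) l N (M : {vspace vT}) (Y : gset) :
  gclosed 1 Z -> (forall p, Z p -> ~~ (p <= La)%VS) -> \dim La = l ->
  (La <= M)%VS -> \dim M = (l.+1 + N)%N -> gclosed 1 Y -> girred 1 Y ->
  (forall p, Y p -> Z p) ->
  (forall x, x \in M -> x \notin La -> exists p, Y p /\ (p <= La + <[x]>)%VS) ->
  ich 1 N Y.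
Proof.
move=> cZ miss dL; elim: N M Y => [|N IH] M Y LM dM cY iY YZ mY; first exact: ich0.
have [M' [LM' [M'M dM']]] := vs_between (d := (l.+1 + N)%N) LM (ltac:(lia)).
pose T := {x : vT | x \in M' /\ x \notin La}.
pose tau (x : T) : gset := fun p => (p <= La + <[sval x]>)%VS.
have [x0 x0M x0L] : exists2 x, x \in M' & x \notin La.
  by apply: subv_exN; apply/negP => /dimvS; rewrite dM' dL; lia.
pose Y0 : gset := fun p => Y p /\ (\dim p = 1%N /\ (p <= M')%VS).
have cY0 : gclosed 1 Y0 by apply: gclosed_and cY (gclosed_sub1 M').
have LxM x : x \in M' -> (La + <[x]> <= M')%VS by move=> xM; rewrite subv_addline LM'.
have [|||Y' [cY' [iY' [Y'0 mY']]]] := @minimal_closed 1 Y0 T (exist _ x0 (conj x0M x0L)) tau cY0.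
- move=> [x [xM xL]]; have [p [Yp px]] := mY x (subvP M'M x xM) xL; exists p; split=> //.
  split=> //; split; first exact: gclosed_dim cY Yp.
  exact: subv_trans px (LxM x xM).
- move=> A exA HA totA [x [xM xL]]; apply: chain_point => //.
    by move=> Y1 /HA [_ [_ H]]; apply: (H (exist _ x (conj xM xL))).
  move=> Y1 /HA [cY1 [Y10 _]]; right.
  have [ls Hls] := finite_section cZ miss xL.
  exists [seq <[x + d]>%VS | d <- ls] => p Y1p; rewrite /tau /= => px.
  have Zp : Z p by apply: YZ; have [] := Y10 p Y1p.
  have [pE p0] := vline_pick (gclosed_dim cZ Zp).
  have /memv_addline [t vt] := subvP px _ (memv_pick p).
  have t0 : t != 0.
    apply/negP => /eqP t0; have := miss p Zp; rewrite {1}pE -memvE.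
    by move: vt; rewrite t0 scale0r subr0 => ->.
  pose d := t^-1 *: vpick p - x.
  have dLa : d \in La.
    by have := memvZ t^-1 vt; rewrite scalerBr scalerA mulVf // scale1r.
  have pE' : p = <[x + d]>%VS.
    by rewrite /d addrC subrK line_scale ?invr_eq0.
  by rewrite pE'; apply: map_f; apply: Hls => //; rewrite -pE'.
(* Connectedness: if Y1 misses the test at x1 and Y2 the one at x2, both miss the test at a general
   point of the line joining x1 and x2. *)
- move=> Y1 Y2 cY1 cY2 Y10 Y20 cov.
  case: (classic (forall t, exists U, Y1 U /\ tau t U)) => [|H1]; first by left.
  right=> -[x2 [x2M x2L]]; apply: NNPP => H2.
  have [[x1 [x1M x1L]] {}H1] := not_all_ex_not _ _ H1.
  have dLx x : x \notin La -> \dim (La + <[x]>)%VS = l.+1 by move=> xL; rewrite dim_addl ?dL.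
  have n1 : ~ meets Y1 l.+1 (La + <[x1]>)%VS by move=> [_ [p Hp]]; apply: H1; exists p.
  have n2 : ~ meets Y2 l.+1 (La + <[x2]>)%VS by move=> [_ [p Hp]]; apply: H2; exists p.
  have c1 := gclosed_pcl (meets_closed l cY1) x2 dL x1L n1.
  have c2 := pcl_infty x1 (gclosed_pcl (meets_closed l cY2)) dL x2L n2.
  have [t [[xL m1] [_ m2]]] := cofin_ex (cofin_and c1 c2).
  have xM : x1 + t *: x2 \in M' by apply: memv_comb.
  have [p [px [Y1p|Y2p]]] := cov (exist _ _ (conj xM xL)).
    by apply: m1; split; [exact: dLx | exists p].
  by apply: m2; split; [exact: dLx | exists p].
apply: (ichS cY iY (IH M' Y' LM' dM' cY' iY' _ _)).
- by move=> p /Y'0 [/YZ].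
- by move=> x xM xL; apply: (mY' (exist _ x (conj xM xL))).
- by move=> p /Y'0 [].
(* Strictness: a point of Y over an x outside M' is not in M', because Z misses La. *)
have [x xM xM'] : exists2 x, x \in M & x \notin M'.
  by apply: subv_exN; apply/negP => /dimvS; rewrite dM' dM; lia.
have xL : x \notin La by apply: contra xM' => /(subvP LM').
have [p [Yp px]] := mY x xM xL; exists p; split=> // /Y'0 [_ [_ pM']].
have := miss p (YZ p Yp); case/negP; apply/subvP => v vp.
have /memv_addline [t vt] := subvP px v vp.
case: (eqVneq t 0) => [t0|t0]; first by move: vt; rewrite t0 scale0r subr0.
case/negP: xM'; rewrite -[x]scale1r -(mulVf t0) -scalerA memvZ //.
rewrite -[t *: x](subKr v) memvB //; first exact: (subvP pM').
exact: (subvP LM').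
Qed.

End Chains.

(** * Closures of coordinate cells, and their chains *)

Section Schubert.
Variables (K : closedFieldType) (n k m : nat).
Notation vT := 'rV[K]_n.+1.
Notation gset := ({vspace vT} -> Prop).
Variables (G : 'M[K]_(k + m, n.+1)) (G' : 'M[K]_(n.+1, k + m)).
Hypotheses (GG' : G *m G' = 1%:M) (G'G : G' *m G = 1%:M).
Implicit Types (A : 'M[K]_(k, m)) (J : {set 'I_k * 'I_m}).

Definition supp J A := forall x, x \notin J -> A x.1 x.2 = 0.

Lemma graph_inj A A' : graph G A = graph G A' -> A = A'.
Proof.
move=> e; have e0 : rowspan (graph_mx G A) = graph G A by [].
by rewrite -(mx_of_graph GG' (rank_graph GG' A) e0).2 (mx_of_graph GG' (rank_graph GG' A) e).2.
Qed.

(** Cuts out the cell of J on the chart and contains everything off the chart. *)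
Definition coord_set J : gset := fun U => \dim U = k /\ forall A, U = graph G A -> supp J A.

Lemma coord_set_closed J : gclosed k (coord_set J).
Proof.
pose S (o : option ('I_k * 'I_m)) : gset := fun U => \dim U = k /\
  forall A, U = graph G A -> (if o is Some x then if x \in J then 0 else A x.1 x.2 else 0) = 0.
have cS o : gclosed k (S o).
  apply: (gclosed_chart GG' G'G
    (phi := fun A => if o is Some x then if x \in J then 0 else A x.1 x.2 else 0)).
  case: o => [x|]; last exact: pf_const.
  by case: (x \in J); [exact: pf_const | exact: pmx_id].
apply: (gclosed_eq _ (gclosed_inter None cS)) => U; split=> [HU|[dU HU] [x|]].
- split=> [|A UA x xJ]; first by have [] := HU None.
  by have [_ /(_ A UA)] := HU (Some x); rewrite (negPf xJ).
- by split=> // A UA; case: ifPn => // xJ; apply: HU.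
- by split.
Qed.

Lemma coord_setE J A : coord_set J (graph G A) <-> supp J A.
Proof.
split=> [[_]|sA]; first exact.
by split=> [|A' /graph_inj <-//]; apply: dim_graph GG' A.
Qed.

(** The Zariski closure of the cell of matrices supported on J. *)
Definition schubert J : gset := fun U =>
  forall F, gclosed k F -> (forall A, supp J A -> F (graph G A)) -> F U.

Lemma schubert_closed J : gclosed k (schubert J).
Proof.
pose I := {F : gset | gclosed k F /\ forall A, supp J A -> F (graph G A)}.
have i0 : I by exists (@grass K n k); split; [exact: gclosed_grass | move=> A _; exact: dim_graph GG' A].
apply: (gclosed_eq _ (gclosed_inter i0 (S := fun i : I => sval i) _)) => [U|[F [cF _]]//].
split=> [HU F cF FA|HU [F [cF FA]]]; last exact: HU.
exact: (HU (exist _ F (conj cF FA))).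
Qed.

Lemma pmx_graph_line A B : pmx (@idgen K) (fun t => graph_mx G (A + t *: B)).
Proof.
apply: pmx_mul; last exact: pmx_const.
apply: pmx_row; first exact: pmx_const.
by apply: pmx_add; [exact: pmx_const | exact: pmx_id_scale].
Qed.

Lemma supp_comb J A B t : supp J A -> supp J B -> supp J (A + t *: B).
Proof. by move=> sA sB x xJ; rewrite !mxE sA // sB // mulr0 addr0. Qed.

(** Two points of the cell are joined by a line inside it, and a general point of that line would
    avoid both F1 and F2. *)
Lemma schubert_irred J : girred k (schubert J).
Proof.
split.
  exists (graph G 0) => F _; apply=> x _; by rewrite mxE.
move=> F1 F2 cF1 cF2 cov.
have cov' A : supp J A -> F1 (graph G A) \/ F2 (graph G A).
  by move=> sA; apply: cov => F _; apply.
case: (classic (forall A, supp J A -> F1 (graph G A))) => [H1|H1].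
  by left=> U; apply.
right=> U; apply=> // A2 s2; apply: NNPP => n2.
have [A1 H] := not_all_ex_not _ _ H1; have [s1 n1] := imply_to_and _ _ H.
have l0 : A1 + 0 *: (A2 - A1) = A1 by rewrite scale0r addr0.
have l1 : A1 + 1 *: (A2 - A1) = A2 by rewrite scale1r addrC subrK.
have s12 : supp J (A2 - A1) by move=> x xJ; rewrite !mxE s1 // s2 // subrr.
have c1 := gclosed_curve (t0 := 0) cF1 (pmx_graph_line A1 (A2 - A1)).
rewrite l0 in c1; have {}c1 := c1 (rank_graph GG' _) n1.
have c2 := gclosed_curve (t0 := 1) cF2 (pmx_graph_line A1 (A2 - A1)).
rewrite l1 in c2; have {}c2 := c2 (rank_graph GG' _) n2.
have [t [[_ m1] [_ m2]]] := cofin_ex (cofin_and c1 c2).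
by have [/m1|/m2] := cov' _ (supp_comb t s1 s12).
Qed.

Lemma supp_delta J x t : x \in J -> supp J (t *: delta_mx x.1 x.2).
Proof.
move=> xJ y yJ; rewrite !mxE; case: eqP => [e1|]; last by rewrite mulr0.
case: eqP => [e2|]; last by rewrite mulr0.
by case/negP: yJ; rewrite (_ : y = x) //; case: (x) (y) e1 e2 => [a b] [c d] /= -> ->.
Qed.

(** Indices are removed from J one at a time. Strictness shows on a matrix unit, which the closed
    [coord_set] keeps out of the smaller closure. *)
Lemma schubert_chain J : ich k #|J| (schubert J).
Proof.
move cJ : #|J| => N; elim: N J cJ => [|N IH] J cJ.
  by apply: ich0; [exact: schubert_closed | exact: schubert_irred].
have /set0Pn [x xJ] : J != set0 by rewrite -card_gt0 cJ.
have cJ' : #|J :\ x| = N by move: (cardsD1 x J); rewrite xJ cJ add1n => -[].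
have mon A : supp (J :\ x) A -> supp J A.
  by move=> sA y yJ; apply: sA; apply: contra yJ; rewrite inE => /andP[].
apply: (ichS (schubert_closed J) (@schubert_irred J) (IH _ cJ')).
  by move=> U HU F cF FA; apply: HU => // A /mon; apply: FA.
exists (graph G (1 *: delta_mx x.1 x.2)); split.
  by move=> F cF; apply; apply: supp_delta.
move=> /(_ _ (coord_set_closed (J :\ x))) H.
have /coord_setE /(_ x) : coord_set (J :\ x) (graph G (1 *: delta_mx x.1 x.2)).
  by apply: H => A; rewrite coord_setE.
by rewrite !inE eqxx => /(_ isT) /eqP; rewrite !mxE !eqxx mulr1 oner_eq0.
Qed.

End Schubert.

(** * Long chains in a set that meets every pencil *)

Section Hypersurface.
Variables (K : closedFieldType) (n : nat).
Notation vT := 'rV[K]_n.+1.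
Notation gset := ({vspace vT} -> Prop).

Lemma dim_pencil_base l (u v : vT) (a : 'M[K]_(l, n.+1)) :
  \rank (col_mx u (col_mx v a)) = l.+2 -> \dim (rowspan a) = l.
Proof.
move=> rM; apply/eqP; rewrite eqn_leq {1}dim_rowspan rank_leq_row /=.
have := dim_rowspan (col_mx u (col_mx v a)).
rewrite rM [X in \dim X](rowspan_col u (col_mx v a)) (rowspan_col v a) !rowspan1.
move=> E; have := dim_line_le u (<[v]> + rowspan a); rewrite E ltnS => h1.
by have := leq_trans h1 (dim_line_le v (rowspan a)); rewrite ltnS.
Qed.

Lemma pencil_trace (Y : gset) l (w u : vT) (a : 'M[K]_(l, n.+1)) : gclosed l.+1 Y ->
  \rank (col_mx w (col_mx u a)) = l.+2 ->
  let tau := fun U => U = rowspan (col_mx w a) \/ exists s, U = rowspan (col_mx (s *: w + u) a) in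
  (forall U, tau U -> Y U) \/
  exists ls : seq {vspace vT}, forall U, Y U -> tau U -> U \in ls.
Proof.
move=> cY rM tau.
have rk s r : (s != 0) || (r != 0) -> \rank (col_mx (s *: w + r *: u) a) = l.+1.
  exact: rank_pencil rM.
have RC t : rowspan (col_mx t a) = (rowspan a + <[t]>)%VS.
  by rewrite [LHS](rowspan_col t a) rowspan1 addvC.
have da := dim_pencil_base rM.
have nin t : \rank (col_mx t a) = l.+1 -> t \notin rowspan a.
  move=> rt; apply/negP => ta; have := rt; rewrite -dim_rowspan RC.
  by rewrite (addv_idPl _) // da => /n_Sn.
have wa : w \notin rowspan a.
  by apply: nin; have := rk 1 0; rewrite oner_neq0 scale1r scale0r addr0; apply.
have sa s : s *: w + u \notin rowspan a.
  by apply: nin; have := rk s 1; rewrite oner_neq0 orbT scale1r; apply.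
have pY := gclosed_pcl cY.
have fin (P : K -> Prop) : cofin P -> (forall s, P s -> ~ Y (rowspan (col_mx (s *: w + u) a))) ->
    exists ls : seq {vspace vT}, forall U, Y U -> tau U -> U \in ls.
  move=> [ls Hls] HP; exists (rowspan (col_mx w a) :: [seq rowspan (col_mx (s *: w + u) a) | s <- ls]).
  move=> U YU [->|[s Us]]; rewrite inE ?eqxx // Us; apply/orP; right; apply/mapP; exists s => //.
  apply: NNPP => /negP /Hls /HP; by rewrite -Us.
case: (classic (Y (rowspan (col_mx w a)))) => [Yw|nYw]; last first.
  right; rewrite RC in nYw; apply: (fin _ (pcl_infty u pY da wa nYw)) => s [_].
  by rewrite RC addrC.
case: (classic (forall s, Y (rowspan (col_mx (s *: w + u) a)))) => [Ys|/not_all_ex_not [s0 ns0]].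
  by left=> U [->|[s ->]].
right; rewrite RC in ns0; have [ls Hls] := pY _ _ w da (sa s0) ns0.
apply: (fin (fun s => s - s0 \notin ls)).
  exists [seq t + s0 | t <- ls] => s; apply: contra => sl; apply/mapP; exists (s - s0) => //.
  by rewrite subrK.
move=> s /Hls [_]; rewrite RC.
by have -> : s0 *: w + u + (s - s0) *: w = s *: w + u by rewrite addrAC -scalerDl [s0 + _]addrC subrK.
Qed.

(** The pencils in the direction of one entry z0 of the chart all meet B, so B projects onto the
    other (h+1)(m+1) - 1 entries. These are set to zero one after the other, passing each time to a
    minimal closed set that still meets every pencil of the remaining cell. *)
Lemma hypersurface_chain h m (B : gset) (binf : {vspace vT}) :
  (h.+1 + m.+1 = n.+1)%N -> gclosed h.+1 B -> girred h.+1 B ->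
  (forall a c : {vspace vT}, \dim a = h -> \dim c = h.+2 -> (a <= c)%VS ->
     exists b, B b /\ (a <= b)%VS /\ (b <= c)%VS) ->
  \dim binf = h.+1 -> ~ B binf -> ich h.+1 (h.+1 * m.+1).-1 B.
Proof.
move=> en cB iB mB dbi nB.
have [w wb w0] : exists2 x, x \in binf & x \notin 0%VS.
  by apply: subv_exN; apply/negP => /dimvS; rewrite dbi dimv0.
have [D [_ [Db [wD bE]]]] := vs_avoid (sub0v binf) wb w0.
have dD : \dim D = h by apply: succn_inj; rewrite -dbi bE dim_addl.
have [u _ ub] : exists2 x, x \in fullv & x \notin binf.
  by apply: subv_exN; apply/negP => /dimvS; rewrite dbi dimvf /dim /= mul1n; lia.
have [DM [eD rD]] := rowspan_exd dD.
(* The basis is arranged so that binf = D + <w> is the point at infinity of the pencil through the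
   origin of the chart. *)
pose T : 'M[K]_(1 + h, n.+1) := col_mx u DM.
have uD : u \notin (D + <[w]>)%VS by rewrite -bE.
have fTw : row_free (col_mx T w).
  rewrite row_free_dim rowspan_col (rowspan_col u DM) !rowspan1 eD -addvA addvC.
  by rewrite dim_addl // dim_addl // dD addn1.
have [m' [N [dN fN]]] := complete_basis fTw.
have em' : m' = m by lia.
subst m'.
pose G : 'M[K]_((1 + h) + (1 + m), n.+1) := col_mx T (col_mx w N).
have fG : row_free G.
  have GE : rowspan G = rowspan (col_mx (col_mx T w) N) by rewrite !rowspan_col addvA.
  by rewrite row_free_dim GE; move: fN; rewrite row_free_dim => /eqP ->; rewrite -!addnA.
have [G' [GG' G'G]] : exists G', G *m G' = 1%:M /\ G' *m G = 1%:M.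
  by apply: free_inv => //; rewrite -dN -!addnA.
pose z0 : 'I_(1 + h) * 'I_(1 + m) := (lshift h 0, lshift m 0).
pose E0 : 'M[K]_(1 + h, 1 + m) := col_mx (row_mx 1%:M 0) 0.
have E0z x : x != z0 -> E0 x.1 x.2 = 0.
  case: x => i j xz; rewrite /E0 /=; case: (splitP i) => i' ii; last first.
    by have -> : i = rshift 1 i' by [apply: val_inj]; rewrite col_mxEd mxE.
  have -> : i = lshift h i' by apply: val_inj.
  rewrite col_mxEu; case: (splitP j) => j' jj; last first.
    by have -> : j = rshift 1 j' by [apply: val_inj]; rewrite row_mxEr mxE.
  case/eqP: xz; congr (_, _); apply: val_inj; rewrite /= ?ii ?jj ord1 //.
pose a_ A := dsubmx (graph_mx G A : 'M[K]_(1 + h, n.+1)).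
pose u_ A := usubmx (graph_mx G A : 'M[K]_(1 + h, n.+1)).
have gE A : graph_mx G A = col_mx (u_ A) (a_ A) by rewrite vsubmxK.
have shift A s : graph_mx G (A + s *: E0) = col_mx (s *: w + u_ A) (a_ A).
  have -> : graph_mx G (A + s *: E0) = s *: (row_mx 0 E0 *m G) + graph_mx G A.
    rewrite /graph_mx -[X in row_mx X _]addr0 -add_row_mx mulmxDl addrC; congr (_ + _).
    by rewrite -[X in row_mx X _](scaler0 _ s) -scale_row_mx -scalemxAl.
  rewrite gE /G mul_row_col mul0mx add0r /E0 mul_col_mx mul_row_col mul1mx !mul0mx addr0.
  by rewrite scale_col_mx scaler0 add_col_mx add0r.
clearbody E0.
have wG : w = row_mx 0 (row_mx 1%:M 0) *m G.
  by rewrite /G !mul_row_col !mul0mx mul1mx add0r addr0.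
have wgraph A : w \notin graph G A.
  rewrite /graph mem_rowspan; apply/negP => /submxP [mu E].
  have gG' : graph_mx G A *m G' = row_mx 1%:M A by rewrite /graph_mx -mulmxA GG' mulmx1.
  have : w *m G' = row_mx 0 (row_mx 1%:M 0) by rewrite wG -mulmxA GG' mulmx1.
  rewrite {1}E -mulmxA gG' mul_mx_row mulmx1 => /eq_row_mx [m0 _].
  by case/negP: w0; rewrite memv0 E m0 mul0mx.
have rM A : \rank (col_mx w (col_mx (u_ A) (a_ A))) = h.+2.
  rewrite -gE -dim_rowspan [X in \dim X](rowspan_col w (graph_mx G A)) rowspan1 addvC.
  by rewrite dim_addl ?wgraph // (dim_graph GG').
pose tau A : gset := fun U =>
  U = rowspan (col_mx w (a_ A)) \/ exists s, U = rowspan (col_mx (s *: w + u_ A) (a_ A)).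
have tauP (Y : gset) A : (exists U, Y U /\ tau A U) <->
    pencil_meets Y (col_mx w (col_mx (u_ A) (a_ A))).
  rewrite /pencil_meets !(col_mxKu, col_mxKd); split=> [[U [YU [<-|[s Us]]]]|[Yw|[s Ys]]].
  - by left.
  - by right; exists s; rewrite -Us.
  - by exists (rowspan (col_mx w (a_ A))); split=> //; left.
  - by exists (rowspan (col_mx (s *: w + u_ A) (a_ A))); split=> //; right; exists s.
have offchart A A' : rowspan (col_mx w (a_ A)) <> graph G A'.
  move=> E; have := wgraph A'; rewrite -E [rowspan _](rowspan_col w (a_ A)) rowspan1.
  by rewrite (subvP (addvSl _ _)) // memv_line.
have tau_graph A U A' : tau A U -> U = graph G A' -> exists s, A' = A + s *: E0.
  move=> [->|[s ->]]; first by move/offchart.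
  by rewrite -shift => /(graph_inj GG') <-; exists s.
have pmx_ua A1 A2 : pmx (@idgen K) (fun t => col_mx w (graph_mx G (A1 + t *: A2))).
  apply: pmx_col; first exact: pmx_const.
  exact: pmx_graph_line.
have main N' : forall (J : {set 'I_(1 + h) * 'I_(1 + m)}) (Y : gset), #|J| = N'.+1 -> z0 \in J -> gclosed h.+1 Y -> girred h.+1 Y ->
    (forall U, Y U -> B U) -> (forall A, supp J A -> exists U, Y U /\ tau A U) -> ich h.+1 N' Y.
  elim: N' => [|N' IH] J Y cJ zJ cY iY YB mY; first exact: ich0.
  have [x xz xJ] : exists2 x, x != z0 & x \in J.
    have : (0 < #|J :\ z0|)%N by move: (cardsD1 z0 J); rewrite zJ cJ [(true + _)%N]add1n => -[<-].
    by rewrite card_gt0 => /set0Pn [x]; rewrite !inE => /andP[]; exists x.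
  pose J' := J :\ x.
  have zJ' : z0 \in J' by rewrite !inE eq_sym xz.
  have cJ' : #|J'| = N'.+1 by move: (cardsD1 x J); rewrite xJ cJ [(true + _)%N]add1n => -[].
  have mon (A : 'M[K]_(1 + h, 1 + m)) : supp J' A -> supp J A.
    by move=> sA y yJ; apply: sA; apply: contra yJ; rewrite inE => /andP[].
  have cS : gclosed h.+1 (coord_set G J') := coord_set_closed GG' G'G J'.
  pose Y0 : gset := fun U => Y U /\ coord_set G J' U.
  have supp0 : supp J' (0 : 'M[K]_(1 + h, 1 + m)) by move=> y _; rewrite mxE.
  have suppE (A : 'M[K]_(1 + h, 1 + m)) s : supp J' A -> supp J' (A + s *: E0).
    move=> sA y yJ; rewrite !mxE sA // add0r E0z ?mulr0 //; by apply: contraNneq yJ => ->.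
  have [|||Y' [cY' [iY' [Y'0 mY']]]] := @minimal_closed K n h.+1 Y0 {A | supp J' A}
     (exist _ 0 supp0) (fun A => tau (sval A)) (gclosed_and cY cS).
  - move=> [A sA]; have [U [YU tU]] := mY _ (mon _ sA); exists U; split=> //.
    split=> //; split; first exact: gclosed_dim cY YU.
    by move=> A' UA'; have [s ->] := tau_graph _ _ _ tU UA'; apply: suppE.
  - move=> Fm exF HF totF [A sA]; apply: chain_point => //.
      by move=> Y1 /HF [_ [_ H]]; apply: (H (exist _ A sA)).
    by move=> Y1 /HF [cY1 _]; apply: (pencil_trace cY1 (rM A)).
  - move=> Y1 Y2 cY1 cY2 _ _ cov.
    case: (classic (forall t : {A | supp J' A}, exists U, Y1 U /\ tau (sval t) U)) => [|H1]; first by left.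
    right=> -[A2 s2]; apply: NNPP => H2; have [[A1 s1] {}H1] := not_all_ex_not _ _ H1.
    have {}H1 : ~ pencil_meets Y1 (col_mx w (col_mx (u_ A1) (a_ A1))) by move/tauP.
    have {}H2 : ~ pencil_meets Y2 (col_mx w (col_mx (u_ A2) (a_ A2))) by move/tauP.
    have l0 : A1 + 0 *: (A2 - A1) = A1 by rewrite scale0r addr0.
    have l1 : A1 + 1 *: (A2 - A1) = A2 by rewrite scale1r addrC subrK.
    have s12 : supp J' (A2 - A1) by move=> y yJ; rewrite !mxE s1 // s2 // subrr.
    have k1 := sclosed_curve (t0 := 0) (pencil_meets_closed cY1) (pmx_ua A1 (A2 - A1)).
    rewrite l0 gE in k1; have {}k1 := k1 (rM A1) H1.
    have k2 := sclosed_curve (t0 := 1) (pencil_meets_closed cY2) (pmx_ua A1 (A2 - A1)).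
    rewrite l1 gE in k2; have {}k2 := k2 (rM A2) H2.
    have [t [[_ n1] [_ n2]]] := cofin_ex (cofin_and k1 k2).
    rewrite gE in n1 n2.
    have [U [tU [YU|YU]]] := cov (exist _ _ (supp_comb t s1 s12)).
      by apply: n1; apply/tauP; exists U.
    by apply: n2; apply/tauP; exists U.
  apply: (ichS cY iY (IH J' Y' cJ' zJ' cY' iY' _ _)).
  - by move=> U /Y'0 [/YB].
  - by move=> A sA; apply: (mY' (exist _ A sA)).
  - by move=> U /Y'0 [].
  (* Strictness: the pencil of s times the matrix unit at x has its point at infinity outside B for
     general s, since s = 0 gives binf. So Y meets it on the chart, where the entry x is s and not
     0. *)
  have [s [[_ nBs] s0]] : exists s, (\rank (col_mx w (a_ (0 + s *: delta_mx x.1 x.2))) = h.+1 /\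
      ~ B (rowspan (col_mx w (a_ (0 + s *: delta_mx x.1 x.2))))) /\ s != 0.
    apply: cofin_ex; apply: cofin_and (cofin_neq 0).
    have e0 : rowspan (col_mx w (a_ (0 + 0 *: delta_mx x.1 x.2))) = binf.
      rewrite [LHS](rowspan_col w (a_ _)) rowspan1 scale0r addr0 /a_ /graph_mx /G.
      by rewrite mul_row_col mul1mx mul0mx addr0 col_mxKd eD addvC -bE.
    apply: (gclosed_curve (t0 := 0) (M := fun s => col_mx w (a_ (0 + s *: delta_mx x.1 x.2))) cB).
    - apply: (@pmx_col K K _ 1 h); first exact: pmx_const.
      move=> i j; apply: (@pf_ext _ _ _ (fun s => graph_mx G (0 + s *: delta_mx x.1 x.2) (rshift 1 i) j)).
        exact: (pmx_graph_line G 0 (delta_mx x.1 x.2) (rshift 1 i) j).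
      by move=> s; rewrite [RHS]mxE.
    - by rewrite -dim_rowspan e0.
    - by rewrite e0.
  have sx : supp J (0 + s *: delta_mx x.1 x.2) by rewrite add0r; apply: supp_delta.
  have [U [YU tU]] := mY _ sx.
  exists U; split=> // /Y'0 [_ [dU HU]].
  case: tU => [Uw|[s' Us']]; first by apply: nBs; rewrite -Uw; apply: YB.
  rewrite -shift in Us'; have /(_ x) := HU _ Us'.
  rewrite !inE eqxx => /(_ isT) /eqP.
  by rewrite !mxE !eqxx E0z // mulr1 mulr0 add0r addr0 (negPf s0).
have cT : #|[set: 'I_(1 + h) * 'I_(1 + m)]| = (h.+1 * m.+1).-1.+1.
  by rewrite cardsT card_prod !card_ord.
apply: (main _ _ B cT) => //; first by rewrite inE.
move=> A _; apply/tauP/pencil_meetsE => //; first by move=> U; apply: gclosed_dim.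
apply: mB; rewrite ?(dim_pencil_base (rM A)) ?dim_rowspan ?rM //.
rewrite [X in (_ <= X)%VS](rowspan_col w (col_mx (u_ A) (a_ A))) (rowspan_col (u_ A) (a_ A)).
exact: subv_trans (addvSr _ _) (addvSr _ _).
Qed.

End Hypersurface.

(** * Clustered families *)

Section Avoid.
Variables (K : closedFieldType) (n : nat).
Notation vT := 'rV[K]_n.+1.
Notation gset := ({vspace vT} -> Prop).

Lemma cofin_notin (W : {vspace vT}) (y z : vT) : (y \notin W) || (z \notin W) ->
  cofin (fun t => y + t *: z \notin W).
Proof.
move=> H; case: (classic (exists t0, y + t0 *: z \in W)) => [[t0 m0]|none].
  exists [:: t0] => t; rewrite inE => tt0; apply/negP => m.
  have zW : z \in W.
    have d0 : t - t0 != 0 by rewrite subr_eq0.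
    rewrite -[z]scale1r -(mulVf d0) -scalerA memvZ // scalerBl.
    have -> : t *: z - t0 *: z = (y + t *: z) - (y + t0 *: z) by rewrite opprD addrACA subrr add0r.
    exact: memvB.
  have yW : y \in W by rewrite -(addrK (t0 *: z) y) memvB // memvZ.
  by rewrite yW zW in H.
by exists [::] => t _; apply/negP => m; apply: none; exists t.
Qed.

Lemma exists_outside (U : {vspace vT}) (Ws : seq {vspace vT}) :
  (forall W, W \in Ws -> ~~ (U <= W)%VS) -> exists2 y, y \in U & forall W, W \in Ws -> y \notin W.
Proof.
elim: Ws => [|W Ws IH] H; first by exists 0; rewrite ?mem0v.
have [|y yU Hy] := IH; first by move=> W' W'Ws; apply: H; rewrite inE W'Ws orbT.
have [z zU zW] := subv_exN (H W (mem_head _ _)).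
have c1 : cofin (fun t => y + t *: z \notin W) by apply: cofin_notin; rewrite zW orbT.
have c2 : cofin (fun t => forall W', W' \in Ws -> y + t *: z \notin W').
  by apply: cofin_all => W' /Hy yW'; apply: cofin_notin; rewrite yW'.
have [t [t1 t2]] := cofin_ex (cofin_and c1 c2).
exists (y + t *: z); first exact: memv_comb.
by move=> W'; rewrite inE => /orP[/eqP ->//|/t2].
Qed.

Lemma avoid_vectors (U : {vspace vT}) (l : seq vT) j : (j < \dim U)%N ->
  exists D : {vspace vT}, (D <= U)%VS /\ \dim D = j /\ forall x, x \in l -> x != 0 -> x \notin D.
Proof.
elim: j => [|j IH] jU.
  by exists 0%VS; rewrite sub0v dimv0; split=> //; split=> // x _; rewrite memv0.
have [D [DU [dD HD]]] := IH (ltnW jU).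
have [|y yU Hy] := @exists_outside U (D :: [seq (D + <[x]>)%VS | x <- l]).
  move=> W; rewrite inE => /orP[/eqP ->|/mapP [x _ ->]]; apply/negP => /dimvS; first by rewrite dD; lia.
  by have := dim_line_le x D; rewrite addvC dD => h2 h1; have := leq_trans h1 h2; rewrite leqNgt jU.
have yD : y \notin D by apply: Hy; rewrite mem_head.
exists (D + <[y]>)%VS; rewrite subv_addline DU yU dim_addl // dD; split=> //; split=> // x xl x0.
apply/negP => /memv_addline [t xt].
have t0 : t != 0.
  apply/negP => /eqP t0; have := HD x xl x0; by move: xt; rewrite t0 scale0r subr0 => ->.
have Dx : (D + <[x]>)%VS \in D :: [seq (D + <[x]>)%VS | x <- l].
  by rewrite inE; apply/orP; right; exact: (map_f (fun x => (D + <[x]>)%VS)).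
case/negP: (Hy _ Dx).
apply/memv_addline; exists t^-1; rewrite -memvN opprB.
by rewrite -[y]scale1r -(mulVf t0) -scalerA -scalerBr memvZ.
Qed.

Lemma adapted_basis h (a c : {vspace vT}) : (a <= c)%VS -> \dim a = h -> \dim c = h.+2 ->
  exists (u v : vT) (A : 'M[K]_(h, n.+1)),
    [/\ a = rowspan A, c = rowspan (col_mx u (col_mx v A)) & \rank (col_mx u (col_mx v A)) = h.+2].
Proof.
move=> ac da dc; have [A [eA rA]] := rowspan_exd da.
have [v vc va] : exists2 x, x \in c & x \notin a.
  by apply: subv_exN; apply/negP => /dimvS; rewrite dc da; lia.
have [u uc uv] : exists2 x, x \in c & x \notin (a + <[v]>)%VS.
  by apply: subv_exN; apply/negP => /dimvS; rewrite dim_addl // dc da; lia.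
have e : rowspan (col_mx u (col_mx v A)) = ((a + <[v]>) + <[u]>)%VS.
  rewrite [LHS](rowspan_col u (col_mx v A)) (rowspan_col v A) !rowspan1 eA.
  by rewrite addvC [(<[v]> + _)%VS]addvC.
have de : \dim ((a + <[v]>) + <[u]>)%VS = h.+2 by rewrite dim_addl // dim_addl // da.
exists u, v, A; split=> //; last by rewrite -dim_rowspan e.
by rewrite e; apply/esym/vs_eqdim; rewrite ?dc ?de // !subv_addline ac vc uc.
Qed.

Lemma chart_at k m (U : {vspace vT}) (T : 'M[K]_(k, n.+1)) : rowspan T = U -> \dim U = k ->
  (k + m = n.+1)%N -> exists (N : 'M[K]_(m, n.+1)) G', col_mx T N *m G' = 1%:M /\ G' *m col_mx T N = 1%:M.
Proof.
move=> eT dU em; have fT : row_free T by rewrite row_free_dim eT dU.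
have [m' [N [dN fG]]] := complete_basis fT.
have em' : m' = m by lia.
by subst m'; have [G' [H1 H2]] := free_inv dN fG; exists N, G'.
Qed.

Lemma graph0 k m (T : 'M[K]_(k, n.+1)) (N : 'M[K]_(m, n.+1)) : graph (col_mx T N) 0 = rowspan T.
Proof. by rewrite /graph /graph_mx mul_row_col mul1mx mul0mx addr0. Qed.

Lemma grass_upper k m g : (k + m = n.+1)%N -> gchain k (@grass K n k) g -> (g <= k * m)%N.
Proof.
move=> em [c [Hc Hs]]; have [[F0 [_ HF0]] [[U0 cU0] _]] := Hc 0%N (leq0n _).
have [dU0 _] := (HF0 _).1 cU0.
have [T [eT _]] := rowspan_exd dU0.
have [N [G' [GG' G'G]]] := chart_at eT dU0 em.
by apply: (grass_chain_bound GG' G'G (S := @grass K n k) (A0 := 0) (c := c)) => //; rewrite graph0 eT.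
Qed.

Lemma grass_lower k m : (k + m = n.+1)%N -> gchain k (@grass K n k) (k * m).
Proof.
move=> em; have [|U [_ [_ dU]]] := @vs_between K n 0%VS fullv k (sub0v _).
  by rewrite dimv0 dimvf /dim /= mul1n -em leq_addr.
have [T [eT _]] := rowspan_exd dU.
have [N [G' [GG' G'G]]] := chart_at eT dU em.
have := schubert_chain GG' G'G [set: 'I_k * 'I_m].
rewrite cardsT card_prod !card_ord => /ich_gchain; apply=> V HV.
by apply: HV (gclosed_grass K n k) _ => A _; apply: dim_graph GG' A.
Qed.

Definition vertices k (F : gset) : gset := fun p =>
  \dim p = 1%N /\ forall b, \dim b = k -> (p <= b)%VS -> F b.

Lemma rowspan_over h (v : vT) (b : {vspace vT}) : \dim b = h.+1 -> v != 0 -> v \in b ->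
  exists R : 'M[K]_(h, n.+1), b = rowspan (col_mx v R) /\ \rank (col_mx v R) = h.+1.
Proof.
move=> db v0 vb.
have v0' : v \notin 0%VS by rewrite memv0.
have [D [_ [Db [vD bE]]]] := vs_avoid (sub0v b) vb v0'.
have dD : \dim D = h by apply: succn_inj; rewrite -db bE dim_addl.
have [R [eR _]] := rowspan_exd dD; exists R.
have e : rowspan (col_mx v R) = b.
  by rewrite [LHS](rowspan_col v R) rowspan1 eR bE addvC.
by split=> //; rewrite -dim_rowspan e.
Qed.

(** An overspace of <v> is spanned by [col_mx v R]. For a fixed R the condition is pulled back from
    F; then all R are intersected. *)
Lemma vertices_closed h (F : gset) : gclosed h.+1 F -> gclosed 1 (vertices h.+1 F).
Proof.
move=> cF; apply/gclosedP; split=> [p []//|].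
apply: (@sclosed_eq K n 1 (fun v => forall R : 'M[K]_(h, n.+1),
    \rank (col_mx v R : 'M_(h.+1, _)) = h.+1 -> F (rowspan (col_mx v R : 'M_(h.+1, _))))).
  move=> v rv; have v0 : v != 0 by apply/negP => /eqP v0; move: rv; rewrite v0 mxrank0.
  rewrite /vertices rowspan1; split=> [H|[_ H] R rk].
    split=> [|b db]; first by rewrite dim_vline v0.
    rewrite -memvE => vb; have [R [-> rk]] := rowspan_over db v0 vb; exact: H.
  apply: H; first by rewrite dim_rowspan.
  by rewrite -memvE [rowspan _](rowspan_col v R) rowspan1 (subvP (addvSl _ _)) // memv_line.
apply: sclosed_all => R.
have pR : pmx (@mxgen K 1 n.+1) (fun v : vT => col_mx v R : 'M[K]_(h.+1, n.+1)).
  by apply: (@pmx_col K _ _ 1 h); [exact: pmx_id | exact: pmx_const].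
exact: (sclosed_pull (gclosed_sclosed cF) pR).
Qed.

Lemma overspaces_irred h (p : {vspace vT}) (F1 F2 : gset) : \dim p = 1%N ->
  gclosed h.+1 F1 -> gclosed h.+1 F2 ->
  (forall b, \dim b = h.+1 -> (p <= b)%VS -> F1 b \/ F2 b) ->
  vertices h.+1 F1 p \/ vertices h.+1 F2 p.
Proof.
move=> dp cF1 cF2 cov; have [pE v0] := vline_pick dp; set v := vpick p in pE v0.
case: (classic (vertices h.+1 F1 p)) => [|n1]; first by left.
right; split=> // b2 db2 pb2; apply: NNPP => nF2; apply: n1; split=> // b1 db1 pb1.
apply: NNPP => nF1.
have vb b : (p <= b)%VS -> v \in b by rewrite pE -memvE.
have [R1 [e1 r1]] := rowspan_over db1 v0 (vb _ pb1).
have [R2 [e2 r2]] := rowspan_over db2 v0 (vb _ pb2).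
pose M t := (col_mx v (R1 + t *: (R2 - R1)) : 'M[K]_(h.+1, n.+1)).
have pM : pmx (@idgen K) M.
  apply: (@pmx_col K _ _ 1 h); first exact: pmx_const.
  apply: pmx_add; [exact: pmx_const | exact: pmx_id_scale].
have M0 : M 0 = col_mx v R1 by rewrite /M scale0r addr0.
have M1 : M 1 = col_mx v R2 by rewrite /M scale1r addrC subrK.
have c1 := gclosed_curve (t0 := 0) cF1 pM; rewrite M0 -e1 in c1.
have c2 := gclosed_curve (t0 := 1) cF2 pM; rewrite M1 -e2 in c2.
have [t [[rt m1] [_ m2]]] := cofin_ex (cofin_and (c1 r1 nF1) (c2 r2 nF2)).
have [||/m1|/m2] // := cov (rowspan (M t)).
  by rewrite dim_rowspan.
by rewrite pE -memvE [rowspan _](rowspan_col v _) rowspan1 (subvP (addvSl _ _)) // memv_line.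
Qed.

Lemma overspace_ex k (p : {vspace vT}) : \dim p = 1%N -> (0 < k <= n.+1)%N ->
  exists b, \dim b = k /\ (p <= b)%VS.
Proof.
move=> dp kn; have [|b [pb [_ db]]] := @vs_between K n p fullv k (subvf _); last by exists b.
by rewrite dp dimvf /dim /= mul1n.
Qed.

(** By [overspaces_irred] the overspaces of one point lie in F1 or in F2, so the vertex sets of F1
    and F2 cover Z, and irreducibility of Z selects one. *)
Lemma meets_irred h (Z : gset) : (h < n.+1)%N -> gclosed 1 Z -> girred 1 Z -> girred h.+1 (meets Z h.+1).
Proof.
move=> hn cZ [[p Zp] iZ]; split.
  have [b [db pb]] := overspace_ex (k := h.+1) (gclosed_dim cZ Zp) hn.
  by exists b; split=> //; exists p.
move=> F1 F2 cF1 cF2 cov.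
have [q Zq|H|H] := iZ _ _ (vertices_closed cF1) (vertices_closed cF2).
- apply: overspaces_irred (gclosed_dim cZ Zq) cF1 cF2 _ => b db qb.
  by apply: cov; split=> //; exists q.
- by left=> b [db [q [/H [_ Hq] qb]]]; apply: Hq.
- by right=> b [db [q [/H [_ Hq] qb]]]; apply: Hq.
Qed.

End Avoid.

(** * From a clustered family to its vertex set *)

Section Clustered.
Variables (K : closedFieldType) (n h : nat).
Notation vT := 'rV[K]_n.+1.
Notation gset := ({vspace vT} -> Prop).
Variable B : gset.
Hypotheses (cB : gclosed h.+1 B) (iB : girred h.+1 B).
Notation C := (containing_family h.+1 B).

(** Two closed sets of b cover B: those for which every overspace c satisfies the conclusion, and
    those for which every overspace lies in F. The second cannot contain B, because of c0, so
    irreducibility leaves the first. *)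
Lemma clustered_star (F : gset) : gclosed h.+2 F -> (exists c, C c /\ ~ F c) ->
  (forall c, C c -> ~ F c -> gchain h.+1 (fun b => B b /\ (b <= c)%VS) h) ->
  forall a c, C c -> (a <= c)%VS -> \dim a = h -> exists b, B b /\ (a <= b)%VS /\ (b <= c)%VS.
Proof.
move=> cF [c0 [Cc0 nF0]] Hfib.
have star0 a c : C c -> ~ F c -> (a <= c)%VS -> \dim a = h ->
    exists b, B b /\ (a <= b)%VS /\ (b <= c)%VS.
  move=> Cc nF ac da; have [dc _] := Cc.
  exact: fibre_meets_pencil cB da dc ac (Hfib c Cc nF).
pose S1 : gset := fun b => \dim b = h.+1 /\ forall a c : {vspace vT}, (b <= c)%VS -> \dim c = h.+2 ->
  (a <= c)%VS -> \dim a = h -> exists b', B b' /\ (a <= b')%VS /\ (b' <= c)%VS.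
pose S2 : gset := fun b => \dim b = h.+1 /\ forall u, u \notin b -> F (b + <[u]>)%VS.
have cS2 : gclosed h.+1 S2.
  apply/gclosedP; split=> [b []//|].
  apply: (@sclosed_eq K n h.+1 (fun N => forall u : vT,
     \rank (col_mx u N : 'M_(h.+2, _)) = h.+2 -> F (rowspan (col_mx u N : 'M_(h.+2, _))))).
    move=> N rN; have dN : \dim (rowspan N) = h.+1 by rewrite dim_rowspan.
    have e u : rowspan (col_mx u N) = (rowspan N + <[u]>)%VS.
      by rewrite [LHS](rowspan_col u N) rowspan1 addvC.
    split=> [H|[_ H] u rk].
      split=> // u uN; rewrite -e; apply: H.
      by rewrite -dim_rowspan [X in \dim X]e dim_addl // dN.
    rewrite [rowspan _]e; apply: H; apply/negP => uN; move: rk; rewrite -dim_rowspan [X in \dim X]e.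
    by rewrite (addv_idPl _) // dN => /n_Sn.
  apply: sclosed_all => u.
  have pu : pmx (@mxgen K h.+1 n.+1) (fun N => col_mx u N : 'M[K]_(h.+2, n.+1)).
    by apply: (@pmx_col K _ _ 1 h.+1); [exact: pmx_const | exact: pmx_id].
  exact: (sclosed_pull (gclosed_sclosed cF) pu).
have span_eq (X : 'M[K]_h.+2) (M : 'M[K]_(h.+2, n.+1)) : \rank (X *m M) = h.+2 ->
    rowspan (X *m M) = rowspan M.
  move=> rk; apply: vs_eqdim; first by rewrite rowspan_le submxMl.
  by rewrite !dim_rowspan rk rank_leq_row.
(* Every basis of an overspace of [rowspan N] has the form [X *m col_mx u N], so S1 is an
   intersection of pullbacks of [pencil_meets B]. *)
pose P1 (N : 'M[K]_(h.+1, n.+1)) := forall uX : vT * 'M[K]_h.+2,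
     \rank (uX.2 *m (col_mx uX.1 N : 'M_(h.+2, _))) = h.+2 ->
     pencil_meets B (uX.2 *m (col_mx uX.1 N : 'M_(h.+2, _)) : 'M_(1 + (1 + h), _)).
have P1E N : \rank N = h.+1 -> P1 N <-> S1 (rowspan N).
  move=> rN; have dN : \dim (rowspan N) = h.+1 by rewrite dim_rowspan.
  have e u : rowspan (col_mx u N) = (rowspan N + <[u]>)%VS.
    by rewrite [LHS](rowspan_col u N) rowspan1 addvC.
  split=> [H|[_ H] [u X] /= rk].
    split=> // a c Nc dc ac da.
    have [x [y [A [eA eM rM]]]] := adapted_basis ac da dc.
    have [u uc uN] : exists2 x, x \in c & x \notin rowspan N.
      by apply: subv_exN; apply/negP => /dimvS; rewrite dc dN ltnn.
    have cE : c = rowspan (col_mx u N).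
      by rewrite e; apply: addline_eq => //; rewrite dc dN.
    have /submxP [X EX] : (col_mx x (col_mx y A) <= (col_mx u N : 'M_(h.+2, _)))%MS.
      by rewrite -rowspan_le -eM cE subvv.
    have := H (u, X); rewrite /= -EX => /(_ rM); rewrite eA eM.
    by move/(pencil_meetsE (fun U => @gclosed_dim _ _ _ _ U cB) rM).
  have [x [y [A EA]]] := col_mx3 (X *m (col_mx u N : 'M_(h.+2, _))).
  rewrite EA; rewrite EA in rk; apply/pencil_meetsE => //.
    by move=> U; apply: gclosed_dim.
  have eS : rowspan (col_mx x (col_mx y A)) = (rowspan N + <[u]>)%VS.
    by rewrite -e -EA; apply: span_eq; rewrite EA.
  apply: H; rewrite ?(dim_pencil_base rk) //.
  - by rewrite eS addvSl.
  - by rewrite dim_rowspan rk.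
  - rewrite [X in (_ <= X)%VS](rowspan_col x (col_mx y A)) (rowspan_col y A).
    exact: subv_trans (addvSr _ _) (addvSr _ _).
have cS1 : gclosed h.+1 S1.
  apply/gclosedP; split=> [b []//|].
  apply: (sclosed_eq P1E); apply: sclosed_all => -[u X] /=.
  have pu : pmx (@mxgen K h.+1 n.+1) (fun N => X *m (col_mx u N : 'M_(h.+2, _))).
    apply: pmx_mul; first exact: pmx_const.
    by apply: (@pmx_col K _ _ 1 h.+1); [exact: pmx_const | exact: pmx_id].
  exact: (sclosed_pull (pencil_meets_closed cB) pu).
have S12 b : B b -> S1 b \/ S2 b.
  move=> Bb; have db := gclosed_dim cB Bb.
  case: (classic (S2 b)) => [|nS2]; first by right.
  left; have [u0 u0b nFu] : exists2 u0, u0 \notin b & ~ F (b + <[u0]>)%VS.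
    apply: NNPP => H; apply: nS2; split=> // u ub; apply: NNPP => nF; apply: H; by exists u.
  have [N [eN rN]] := rowspan_exd db.
  rewrite -eN; apply/P1E => // -[u X] /= rk; apply: NNPP => nP.
  have e x : rowspan (col_mx x N) = (b + <[x]>)%VS.
    by rewrite [LHS](rowspan_col x N) rowspan1 addvC eN.
  (* A curve from an overspace outside F to one where the pencil condition fails; a general point of
     it has both properties, against [star0]. *)
  pose M t := (col_mx (u0 + t *: (u - u0)) N : 'M[K]_(h.+2, n.+1)).
  have pM : pmx (@idgen K) M.
    apply: (@pmx_col K _ _ 1 h.+1); last exact: pmx_const.
    by apply: pmx_add; [exact: pmx_const | exact: pmx_id_scale].
  have M0 : M 0 = col_mx u0 N by rewrite /M scale0r addr0.
  have M1 : M 1 = col_mx u N by rewrite /M scale1r addrC subrK.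
  have c1 := gclosed_curve (t0 := 0) cF pM; rewrite M0 -dim_rowspan e dim_addl // db in c1.
  have {}c1 := c1 erefl nFu.
  have pXM : pmx (@idgen K) (fun t => X *m M t) by apply: pmx_mul => //; exact: pmx_const.
  have c2 := sclosed_curve (t0 := 1) (pencil_meets_closed cB) pXM; rewrite M1 in c2.
  have [t [[rM nFt] [rXM nPt]]] := cofin_ex (cofin_and c1 (c2 rk nP)).
  apply: nPt; have [x [y [A EA]]] := col_mx3 (X *m M t).
  have sE := span_eq _ _ rXM.
  rewrite EA; rewrite EA in rXM sE; apply/pencil_meetsE => //.
    by move=> U; apply: gclosed_dim.
  rewrite sE; apply: star0 => //.
  - split; first by rewrite dim_rowspan.
    by exists b; split=> //; rewrite [rowspan _]e addvSl.
  - rewrite -sE [X in (_ <= X)%VS](rowspan_col x (col_mx y A)) (rowspan_col y A).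
    exact: subv_trans (addvSr _ _) (addvSr _ _).
  - exact: dim_pencil_base rXM.
have [_ irr] := iB; have [//|H1|H2] := irr _ _ cS1 cS2.
  move=> a c [dc [b [Bb bc]]] ac da; have [_ H] := H1 b Bb; exact: H bc dc ac da.
have [dc0 [b [Bb bc0]]] := Cc0; have [db H] := H2 b Bb.
have [u uc ub] : exists2 x, x \in c0 & x \notin b.
  by apply: subv_exN; apply/negP => /dimvS; rewrite dc0 db ltnn.
by case: nF0; rewrite (addline_eq bc0 uc ub) ?dc0 ?db //; apply: H.
Qed.

Hypothesis star : forall a c, C c -> (a <= c)%VS -> \dim a = h ->
  exists b, B b /\ (a <= b)%VS /\ (b <= c)%VS.
Variable c1 : {vspace vT}.
Hypotheses (dc1 : \dim c1 = h.+2) (nC1 : ~ C c1).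

Let cC : gclosed h.+2 C := containing_closed cB star.
Let dB b : B b -> \dim b = h.+1. Proof. exact: gclosed_dim. Qed.
Let CE c : C c <-> \dim c = h.+2 /\ exists b, B b /\ (b <= c)%VS. Proof. by []. Qed.
Let Z := vertices h.+1 B.

Lemma mixed_meets T y b : \dim T = h.+3 -> (y <= T)%VS -> \dim y = h.+2 -> ~ C y ->
  B b -> (b <= T)%VS -> exists p, Z p /\ (p <= b)%VS.
Proof.
move=> dT yT dy nCy Bb bT.
have [p [p0 [pb Hp]]] := exists_vertex dB CE (gclosed_pcl cB) (gclosed_pcl cC) star dT yT dy nCy Bb bT.
exists <[p]>%VS; rewrite -memvE; split=> //; split; first by rewrite dim_vline p0.
move=> b' db'; rewrite -memvE => pb'.
have pT : p \in T := subvP bT _ pb.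
(* With j = h.+1 the condition on the dimension of T :&: b' is void, so every b' through p is
   reached. *)
apply: (vertex_all dB CE (gclosed_pcl cB) (gclosed_pcl cC) star dT yT dy nCy pT Hp pb' db' (j := h.+1)).
exact: leq_addl.
Qed.

(** [Bad] collects the b such that every c sharing at least dimension h with b lies in C. Any other
    member of B spans with some c outside C a T of dimension h+3, which provides a vertex on b. Both
    conditions are closed, and [exists_mixed] yields a member that is not [Bad]. *)
Lemma members_meet b : B b -> meets Z h.+1 b.
Proof.
pose Bad : gset := fun b => \dim b = h.+1 /\
  forall c : {vspace vT}, \dim c = h.+2 -> (h <= \dim (c :&: b))%N -> C c.
have cBad : gclosed h.+1 Bad.
  apply/gclosedP; split=> [x []//|].
  apply: (@sclosed_eq K n h.+1 (fun N => forall x : vT * vT * 'M[K]_(h, h.+1),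
     \rank (col_mx x.1.1 (col_mx x.1.2 (x.2 *m N)) : 'M_(h.+2, _)) = h.+2 ->
     C (rowspan (col_mx x.1.1 (col_mx x.1.2 (x.2 *m N)) : 'M_(h.+2, _))))).
    move=> N rN; have dN : \dim (rowspan N) = h.+1 by rewrite dim_rowspan.
    split=> [H|[_ H] [[u v] R] /= rk].
      split=> // c dc hc.
      have [|a [_ [acN da]]] := vs_between (d := h) (sub0v (c :&: rowspan N)%VS).
        by rewrite dimv0.
      move: acN; rewrite subv_cap => /andP[ac aN].
      have [u [v [A [eA eM rM]]]] := adapted_basis ac da dc.
      have /submxP [R ER] : (A <= N)%MS by rewrite -rowspan_le -eA.
      rewrite eM ER; apply: (H (u, v, R)); by rewrite /= -ER.
    apply: H; first by rewrite dim_rowspan.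
    rewrite -{1}(dim_pencil_base rk) dimvS // subv_cap; apply/andP; split; last by rewrite rowspan_le submxMl.
    rewrite [X in (_ <= X)%VS](rowspan_col u (col_mx v (R *m N))) (rowspan_col v (R *m N)).
    exact: subv_trans (addvSr _ _) (addvSr _ _).
  apply: sclosed_all => -[[u v] R] /=.
  have pu : pmx (@mxgen K h.+1 n.+1) (fun N => col_mx u (col_mx v (R *m N)) : 'M[K]_(h.+2, n.+1)).
    apply: (@pmx_col K _ _ 1 (1 + h)); first exact: pmx_const.
    apply: pmx_col; first exact: pmx_const.
    by apply: pmx_mul; [exact: pmx_const | exact: pmx_id].
  exact: (sclosed_pull (gclosed_sclosed cC) pu).
have cov x : B x -> Bad x \/ meets Z h.+1 x.
  move=> Bx; have dx := dB Bx; case: (classic (Bad x)) => [|nBad]; first by left.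
  right; split=> //.
  have [c [dc [hc nCc]]] : exists c, \dim c = h.+2 /\ (h <= \dim (c :&: x))%N /\ ~ C c.
    apply: NNPP => H; apply: nBad; split=> // c dc hc; apply: NNPP => nCc.
    by apply: H; exists c.
  apply: (@mixed_meets (c + x)%VS c x) => //; rewrite ?addvSl ?addvSr //.
  have h1 := dimv_sum_cap c x; rewrite dc dx in h1.
  have [w wx wc] : exists2 w, w \in x & w \notin c.
    by apply: subv_exN; apply/negP => xc; apply: nCc; split=> //; exists x.
  have d1 : (h.+2 < \dim (c + x))%N.
    by rewrite -dc -(dim_addl wc) dimvS // subv_addline addvSl (subvP (addvSr _ _)).
  apply/eqP; rewrite eqn_leq d1 andbT -(leq_add2r (\dim (c :&: x))) h1.
  by rewrite -addSnnS leq_add2l.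
have [_ irr] := iB.
have [//|H|H] := irr _ _ cBad (meets_closed h (vertices_closed cB)); last exact: H.
have [[b0 Bb0] _] := iB.
have [c0 Cc0] : exists c0, C c0.
  have [u _ ub] : exists2 u, u \in fullv & u \notin b0.
    apply: subv_exN; apply/negP => /dimvS H1.
    by have := leq_trans (dimvS (subvf c1)) H1; rewrite dc1 (dB Bb0) ltnn.
  exists (b0 + <[u]>)%VS; split; first by rewrite dim_addl // (dB Bb0).
  by exists b0; rewrite addvSl.
have [T [y [b' [dT yT dy nCy [Bb' b'T]]]]] := exists_mixed CE Cc0 dc1 nC1.
have [_ Hb'] := H b' Bb'; case: nCy; apply: Hb' => //.
have h1 := dimv_sum_cap y b'; rewrite dy (dB Bb') in h1.
have d1 : (\dim (y + b') <= h.+3)%N by rewrite -dT dimvS // subv_add yT.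
by move: (leq_add d1 (leqnn (\dim (y :&: b')))); rewrite h1 -addSnnS leq_add2l.
Qed.

Lemma memberE V : B V <-> \dim V = h.+1 /\ exists p, Z p /\ (p <= V)%VS.
Proof.
split=> [/members_meet//|[dV [p [[_ Hp] pV]]]]; exact: Hp.
Qed.

(** Z misses c1, so v + c1 contains only finitely many points v + d of Z. A D of dimension h in c1
    that avoids the nonzero d makes D + <v> meet Z in p alone. *)
Lemma separate_vertex (W : gset) p : (forall q, W q -> Z q) -> Z p -> ~ W p ->
  exists b, \dim b = h.+1 /\ (p <= b)%VS /\ ~ exists q, W q /\ (q <= b)%VS.
Proof.
move=> WZ Zp nWp; have cZ : gclosed 1 Z := vertices_closed cB.
have miss q : Z q -> ~~ (q <= c1)%VS.
  move=> [dq Hq]; apply/negP => qc; apply: nC1; split=> //.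
  have [|b [qb [bc db]]] := vs_between (d := h.+1) qc; first by rewrite dq dc1 leqnSn.
  by exists b; split=> //; apply: Hq.
have [pE v0] := vline_pick (gclosed_dim cZ Zp); set v := vpick p in pE v0.
have vc : v \notin c1 by have := miss p Zp; rewrite pE -memvE.
have [l Hl] := finite_section cZ miss vc.
have [D [Dc [dD HD]]] := @avoid_vectors K n c1 l h (ltac:(rewrite dc1; lia)).
have vD : v \notin D by apply: contra vc => /(subvP Dc).
exists (D + <[v]>)%VS; split; first by rewrite dim_addl // dD.
split; first by rewrite pE addvSr.
move=> [q [Wq qb]]; have Zq := WZ q Wq.
have [qE w0] := vline_pick (gclosed_dim cZ Zq); set w := vpick q in qE w0.
have /memv_addline [t wt] : w \in (D + <[v]>)%VS by apply: (subvP qb); rewrite qE memv_line.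
have t0 : t != 0.
  apply/negP => /eqP t0; have := miss q Zq; rewrite qE -memvE.
  by move: wt; rewrite t0 scale0r subr0 => /(subvP Dc) ->.
pose d := t^-1 *: w - v.
have dDm : d \in D by have := memvZ t^-1 wt; rewrite scalerBr scalerA mulVf // scale1r.
have qd : q = <[v + d]>%VS by rewrite /d addrC subrK line_scale ?invr_eq0.
have dl : d \in l by apply: Hl; [exact: (subvP Dc) | rewrite -qd].
case: (eqVneq d 0) => [d0|d0]; last by have := HD d dl d0; rewrite dDm.
by apply: nWp; rewrite pE -[v]addr0 -d0 -qd.
Qed.

(** If F1 and F2 cover Z, the b meeting either part cover B; [separate_vertex] recovers a part of Z
    from the set of b that meet it. *)
Lemma vertices_irred : girred 1 Z.
Proof.
have [[b Bb] irr] := iB; have cZ : gclosed 1 Z := vertices_closed cB.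
split; first by have [_ [p [Zp _]]] := members_meet Bb; exists p.
move=> F1 F2 cF1 cF2 cov.
have key (F : gset) : (forall b, B b -> meets (fun p => Z p /\ F p) h.+1 b) -> forall p, Z p -> F p.
  move=> H p Zp; apply: NNPP => nFp.
  have [q [dq [pq nq]]] := @separate_vertex (fun p => Z p /\ F p) p (fun q => @proj1 _ _) Zp
     (fun H => nFp H.2).
  by apply: nq; have [_ Hp] := Zp; have [_] := H q (Hp q dq pq).
have [x Bx|H|H] := irr _ _ (meets_closed h (gclosed_and cZ cF1)) (meets_closed h (gclosed_and cZ cF2)).
- have [dx [p [Zp px]]] := members_meet Bx.
  by have [Fp|Fp] := cov p Zp; [left | right]; split=> //; exists p.
- by left; apply: key.
- by right; apply: key.
Qed.

(** Each member of a chain in Z is replaced by the set of b that meet it; below the lowest, the b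
    through a single point p0 give h m further steps. *)
Lemma vertices_chain_up m r : (h.+1 + m = n.+1)%N -> gchain 1 Z r -> gchain h.+1 B (h * m + r).
Proof.
move=> em [c [Hc Hs]]; have cZ : gclosed 1 Z := vertices_closed cB.
have hn : (h < n.+1)%N by lia.
have cZi i : (i <= r)%N -> gclosed 1 (c i) /\ forall p, c i p -> Z p.
  move=> /Hc [[F [cF HF]] _]; split; last by move=> p /HF [].
  by apply: (gclosed_eq _ (gclosed_and cZ cF)) => p; rewrite HF.
have cM i : (i <= r)%N -> gclosed h.+1 (meets (c i) h.+1) /\ girred h.+1 (meets (c i) h.+1).
  move=> ir; have [ci _] := cZi i ir; have [_ ii] := Hc i ir.
  by split; [exact: meets_closed | exact: meets_irred].
have [[p0 cp0] _] := (Hc 0%N (leq0n _)).2.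
have [c0 c0Z] := cZi 0%N (leq0n _).
have dp0 := gclosed_dim c0 cp0; have [pE v0] := vline_pick dp0; set v := vpick p0 in pE v0.
have [b0 [db0 pb0]] := overspace_ex (k := h.+1) dp0 hn.
have vb0 : v \in b0 by apply: (subvP pb0); rewrite pE memv_line.
have [R [eR rR]] := rowspan_over db0 v0 vb0.
have [N [G' [GG' G'G]]] := @chart_at K n (1 + h) m b0 (col_mx v R) (esym eR) db0 em.
(* When row 0 of A vanishes, the first row v of the graph matrix is unchanged, so all these b
   contain p0. *)
pose J : {set 'I_(1 + h) * 'I_m} := setX (~: [set (0 : 'I_h.+1)]) setT.
have cJ : #|J| = (h * m)%N by rewrite cardsX cardsT cardsC1 !card_ord.
have := schubert_chain GG' G'G J; rewrite cJ => iJ.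
have ich_i i : (i <= r)%N -> ich h.+1 (h * m + i) (meets (c i) h.+1).
  elim: i => [|i IH] ir.
    rewrite addn0; have [cM0 iM0] := cM 0%N ir; apply: (ich_mono iJ) => // U HU.
    apply: HU => // A sA; split; first exact: (dim_graph GG').
    exists p0; split=> //; rewrite pE -memvE /graph mem_rowspan.
    have E : v = row (lshift h 0) (graph_mx (col_mx (col_mx v R) N) A).
      rewrite /graph_mx mul_row_col mul1mx.
      have A0 : row (lshift h 0) A = 0.
        by apply/rowP => j; rewrite !mxE (sA (lshift h 0, j)) // !inE.
      by rewrite linearD /= row_mul A0 mul0mx addr0; apply/rowP => j; rewrite mxE col_mxEu.
    by rewrite {1}E; exact: row_sub.
  have [cMi iMi] := cM i.+1 ir; rewrite addnS.
  have [sub [q [cq ncq]]] := Hs i ir.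
  apply: (ichS cMi iMi (IH (ltnW ir))).
    by move=> U [dU [p [cp pU]]]; split=> //; exists p; split=> //; apply: sub.
  have [_ ciZ] := cZi i.+1 ir; have [_ ciZ'] := cZi i (ltnW ir).
  have [b [db [qb nb]]] := separate_vertex ciZ' (ciZ q cq) ncq.
  by exists b; split; [split=> //; exists q | case].
apply: (ich_gchain (ich_i r (leqnn r))) => U [dU [p [cp pU]]].
have [_ crZ] := cZi r (leqnn r); have [_ Hp] := crZ p cp; exact: Hp.
Qed.

(** Z misses a linear space of dimension l but none of dimension l + 1. That none larger is missed
    makes Z project onto a space of projective dimension n - l, whence the chain in Z; that this one
    is missed makes the projection finite, whence the bound on chains in B. *)
Lemma vertices_chain_down m b : (h.+1 + m = n.+1)%N -> gchain h.+1 B b ->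
  exists N, gchain 1 Z N /\ (b <= N + h * m)%N.
Proof.
move=> em chB; have cZ : gclosed 1 Z := vertices_closed cB.
pose missing l := exists La : {vspace vT}, \dim La = l /\ forall p, Z p -> ~~ (p <= La)%VS.
have [[p0 Zp0] _] := vertices_irred.
have bnd l : missing l -> (l <= n)%N.
  move=> [La [dL miss]]; have := dimvS (subvf La).
  rewrite dL dimvf /dim /= mul1n leq_eqVlt ltnS => /orP[/eqP ln|//].
  have e : La = fullv by apply: vs_eqdim; rewrite ?subvf // dimvf /dim /= mul1n dL ln.
  by have := miss p0 Zp0; rewrite e subvf.
have m0 : missing 0%N.
  exists 0%VS; rewrite dimv0; split=> // p [dp _]; apply/negP => /dimvS.
  by rewrite dp dimv0.
have [l [[La [dL miss]] maxl]] : exists l, missing l /\ ~ missing l.+1.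
  apply: NNPP => H; have all l : missing l.
    by elim: l => [//|l IH]; apply: NNPP => nl; apply: H; exists l.
  by have := bnd _ (all n.+1); rewrite ltnn.
have ln : (l <= n)%N by apply: bnd; exists La.
exists (n - l)%N; split.
  have iZ := vertices_irred.
  have : ich 1 (n - l) Z.
    apply: (section_chain cZ miss dL (subvf _) _ cZ iZ) => //.
      by rewrite dimvf /dim /= mul1n; lia.
    move=> x _ xL; apply: NNPP => none; apply: maxl.
    exists (La + <[x]>)%VS; rewrite dim_addl // dL; split=> // p Zp; apply/negP => px.
    by apply: none; exists p.
  by move/ich_gchain; apply.
apply: (@cone_chain_bound K n h m l (n - l) Z B La) => //; first by lia.
by move=> U /memberE.
Qed.

End Clustered.

Theorem theorem3p7 (K : closedFieldType) (char0 : [pchar K] =i pred0)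
    (n k : nat) (hk1 : (1 <= k)%N) (hkn : (k < n)%N)
    (B : {vspace 'rV[K]_n.+1} -> Prop) (eps g b : nat)
    (hBcl : gclosed k B) (hBirr : girred k B)
    (hg : gdim k (@grass K n k) g) (hb : gdim k B b) (heps : g = (b + eps)%N)
    (heps0 : (0 < eps)%N)
    (hcl : clustered k 1 B) :
  (eps <= n - k + 1)%N /\
  ((2 <= eps)%N ->
    exists Z : {vspace 'rV[K]_n.+1} -> Prop,
      gclosed 1 Z /\ girred 1 Z /\ gdim 1 Z (n - k + 1 - eps) /\
      forall V : {vspace 'rV[K]_n.+1},
        B V <-> (\dim V = k /\ exists p, Z p /\ (p <= V)%VS)).
Proof.
case: k hk1 hkn hBcl hBirr hg hb hcl => [//|h] _ hn cB iB hg hb hcl.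
have [m em] : exists m, (h.+1 + m.+1 = n.+1)%N by exists (n - h.+1)%N; lia.
have -> : (n - h.+1 + 1 = m.+1)%N by lia.
have g_up : (g <= h.+1 * m.+1)%N by apply: (grass_upper (K := K) em); case: hg.
have g_low : (h.+1 * m.+1 <= g)%N by apply: (gdim_bound hg); apply: grass_lower.
(* As eps > 0, B is not the whole Grassmannian, whose chains reach length g > b. *)
have [b_inf dbi nBi] : exists2 U, \dim U = h.+1 & ~ B U.
  apply: NNPP => H; have all U : \dim U = h.+1 -> B U.
    by move=> dU; apply: NNPP => nB; apply: H; exists U.
  have [[c [Hc Hs]] _] := hg.
  suff /(gdim_bound hb) : gchain h.+1 B g by lia.
  exists c; split=> // i ig; have [[F [cF HF]] irr] := Hc i ig; split=> //.
  exists F; split=> // U; rewrite HF; split=> -[BU FU]; split=> //; first exact: all.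
  exact: gclosed_dim cB BU.
have [F [cF [exF HF]]] := hcl.
have star : forall a c, containing_family h.+1 B c -> (a <= c)%VS -> \dim a = h ->
    exists b, B b /\ (a <= b)%VS /\ (b <= c)%VS.
  apply: (clustered_star cB iB cF exF) => c Cc nF.
  by have [] := HF c Cc nF; rewrite subn1.
(* If C were everything, B would meet every pencil and contain a chain of length g - 1, which forces
   eps = 1. *)
have main : (2 <= eps)%N -> exists c1, \dim c1 = h.+2 /\ ~ containing_family h.+1 B c1.
  move=> e2; apply: NNPP => H.
  have /ich_gchain /(_ (fun U BU => BU)) /(gdim_bound hb) : ich h.+1 (h.+1 * m.+1).-1 B.
    apply: (hypersurface_chain em cB iB _ dbi nBi) => a c da dc ac.
    apply: star => //; apply: NNPP => nC; apply: H; by exists c.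
  by lia.
(* Z is nonempty, and a chain of length 0 in it already gives B one of length h(m+1), so eps is at
   most m+1. *)
have bounds : (2 <= eps)%N -> exists c1, [/\ \dim c1 = h.+2, ~ containing_family h.+1 B c1 & (eps <= m.+1)%N].
  move=> /main [c1 [dc1 nC1]]; exists c1; split=> //.
  have iZ := vertices_irred cB iB star dc1 nC1.
  have cZ := vertices_closed cB.
  have : gchain 1 (vertices h.+1 B) 0 by apply: (ich_gchain (ich0 cZ iZ)).
  move=> /(vertices_chain_up cB dc1 nC1 em) /(gdim_bound hb); lia.
split.
  case: (ltnP 1 eps) => [/bounds [c1 []]//|e1]; exact: leq_trans e1 _.
move=> /bounds [c1 [dc1 nC1 em1]].
have cZ := vertices_closed cB.
have iZ := vertices_irred cB iB star dc1 nC1.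
exists (vertices h.+1 B); split; first exact: cZ.
split; first exact: iZ.
split; last exact: (memberE cB iB star dc1 nC1).
split.
  have [N [chN bN]] := vertices_chain_down cB iB star dc1 nC1 em hb.1.
  apply: gchain_trunc chN _; lia.
move=> /(vertices_chain_up cB dc1 nC1 em) /(gdim_bound hb); lia.
Qed.
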